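(* The category $\mathcal O(H_c)$ is a Serre subcategory of $H_c\text{-mod}_{coh}$. Moreover, let $M\in H_c\text{-mod}_{coh}$ be irreducible, and let $W'\subseteq W$ be a subgroup which is the stabiliser of some point of $\mathfrak h$ and whose fixed point set $\mathfrak h^{W'}$ is an irreducible component of $\operatorname{Supp}M$. Let $Y=\{x\in\mathfrak h\mid \operatorname{Stab}_W(x)=W'\}$, let $i_Y:Y\hookrightarrow\mathfrak h$ be the inclusion, and let $Sh(M)$ be the coherent sheaf on $\mathfrak h$ corresponding to the $\mathbb C[\mathfrak h]$-module $M$. Then $M$ lies in $\mathcal O(H_c)$ if and only if the flat connection on $i_Y^*Sh(M)$ determined by $$\nabla_y m=ym-\sum_{s\in S\setminus W'}c(s)\langle y,\alpha_s\rangle\frac{2}{1-\lambda_s}\frac1{\alpha_s}(s-1)m\qquad(m\in M,\ y\in\mathfrak h^{W'})$$ has regular singularities.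
   Context: Let $W$ be a finite group acting faithfully on a finite dimensional $\mathbb C$-vector space $\mathfrak h$. Let $S=\{s\in W\mid \operatorname{rk}(s-1)=1\}$. For $s\in S$ let $\alpha_s^\vee\in\mathfrak h$ and $\alpha_s\in\mathfrak h^*$ be the nontrivial eigenvectors of $s$, with eigenvalues $\lambda_s^{-1}$ and $\lambda_s$, normalised so that $\langle\alpha_s^\vee,\alpha_s\rangle=2$. Given a $W$-invariant function $c:S\to\mathbb C$, the rational Cherednik algebra $H_c=H_c(W,\mathfrak h)$ is the unital associative $\mathbb C$-algebra generated by $\mathfrak h,\mathfrak h^*,W$ with relations $wx={}^w\!x\,w$, $wy={}^w\!y\,w$, $[x,x']=0$, $[y,y']=0$, $[y,x]=\langle y,x\rangle-\sum_{s\in S}c(s)\langle y,\alpha_s\rangle\langle\alpha_s^\vee,x\rangle s$ for $x,x'\in\mathfrak h^*$, $y,y'\in\mathfrak h$, $w\in W$. $H_c\text{-mod}_{coh}$ is the category of $H_c$-modules finitely generated over $\mathbb C[\mathfrak h]\subseteq H_c$. $\mathcal O(H_c)$ is the category of finitely generated $H_c$-modules on which $\mathfrak h$ acts locally nilpotently. Modules in $H_c\text{-mod}_{coh}$ are viewed as coherent sheaves on $\mathfrak h$, which defines their support. It is known that for every $M\in H_c\text{-mod}_{coh}$ the displayed formula determines a flat connection on $i_Y^*Sh(M)$ (coherent sheaf pullback), and that every irreducible component of $\operatorname{Supp}M$ is of the form $\mathfrak h^{W'}$. A coherent sheaf with flat connection has regular singularities if its pullback to every smooth curve immersed in the variety has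 regular singularities in the usual sense. *)

(* Defs.v *)
From HB Require Import structures.
From mathcomp Require Import all_boot all_order all_algebra all_fingroup.
From mathcomp Require Import all_character generic_quotient.
From mathcomp Require Import boolp reals complex mpoly.

Set Implicit Arguments.
Unset Strict Implicit.
Unset Printing Implicit Defensive.

Import GRing.Theory.
Local Open Scope ring_scope.
Local Open Scope quotient_scope.

(* h is C^n seen as column vectors, on which w acts by v |-> rho w *m v, and   *)
(* h^* is the space of row vectors, on which w acts by x |-> x *m rho w^-1.    *)

Section Reflections.
Variables (R : realType) (n : nat) (W : finGroupType).
Local Notation C := R[i].
Variable rho : mx_representation C [set: W] n.

Definition pairing (K : pzRingType) (y : 'cV[K]_n) (x : 'rV[K]_n) : K :=
  (x *m y) 0 0.

Definition act_h (w : W) (y : 'cV[C]_n) : 'cV[C]_n := rho w *m y.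
Definition act_dual (w : W) (x : 'rV[C]_n) : 'rV[C]_n := x *m rho w^-1%g.

Definition reflections : {set W} := [set s : W | \rank (rho s - 1%:M) == 1%N].

Definition stabiliser (v : 'cV[C]_n) : {set W} := [set w | act_h w v == v].

Definition fixed_points (W' : {set W}) (v : 'cV[C]_n) : Prop :=
  forall w, w \in W' -> act_h w v = v.

End Reflections.

(* The eigenvectors of a reflection are only determined up to                  *)
(* (coroot, root) |-> (t coroot, t^-1 root); neither the algebra nor the       *)
(* connection below depends on that choice. The values of coroot, root, eigen  *)
(* and param outside the set of reflections are irrelevant.                    *)
Record cherednik_datum (R : realType) (n : nat) (W : finGroupType) :=
  CherednikDatum {
    rep : mx_representation R[i] [set: W] n;
    rep_faithful : mx_faithful rep;
    coroot : W -> 'cV[R[i]]_n;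
    dual_root : W -> 'rV[R[i]]_n;
    eigen : W -> R[i];
    eigen_neq1 : forall s, s \in reflections rep -> eigen s != 1;
    act_coroot : forall s, s \in reflections rep ->
      act_h rep s (coroot s) = (eigen s)^-1 *: coroot s;
    act_dual_root : forall s, s \in reflections rep ->
      act_dual rep s (dual_root s) = eigen s *: dual_root s;
    pairing_root : forall s, s \in reflections rep ->
      pairing (coroot s) (dual_root s) = 2;
    param : W -> R[i];
    param_invariant : forall s w : W, s \in reflections rep ->
      param (s ^ w)%g = param s
  }.

(* The algebra H_c by generators and relations: the quotient of the algebra    *)
(* expressions in h^*, h, W and C by the congruence generated by the axioms of *)
(* unital associative C-algebras, the linearity of h^*, h -> H_c, the          *)
(* multiplicativity of W -> H_c, and the defining relations. It is only a      *)
(* pzRingType because 0 <> 1 in H_c is a consequence of the PBW theorem.       *)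
Section CherednikAlgebra.
Variables (R : realType) (n : nat) (W : finGroupType).
Local Notation C := R[i].
Variable d : cherednik_datum R n W.

Inductive hc_term : Type :=
| HcX of 'rV[C]_n
| HcY of 'cV[C]_n
| HcW of W
| HcC of C
| HcAdd of hc_term & hc_term
| HcMul of hc_term & hc_term.

Definition HcOpp t := HcMul (HcC (-1)) t.

Inductive hc_eq : hc_term -> hc_term -> Prop :=
| hc_refl t : hc_eq t t
| hc_sym t u : hc_eq t u -> hc_eq u t
| hc_trans t u v : hc_eq t u -> hc_eq u v -> hc_eq t v
| hc_congD t t' u u' :
    hc_eq t t' -> hc_eq u u' -> hc_eq (HcAdd t u) (HcAdd t' u')
| hc_congM t t' u u' :
    hc_eq t t' -> hc_eq u u' -> hc_eq (HcMul t u) (HcMul t' u')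
| hc_addA t u v : hc_eq (HcAdd t (HcAdd u v)) (HcAdd (HcAdd t u) v)
| hc_addC t u : hc_eq (HcAdd t u) (HcAdd u t)
| hc_add0 t : hc_eq (HcAdd (HcC 0) t) t
| hc_addN t : hc_eq (HcAdd (HcOpp t) t) (HcC 0)
| hc_mulA t u v : hc_eq (HcMul t (HcMul u v)) (HcMul (HcMul t u) v)
| hc_mul1l t : hc_eq (HcMul (HcC 1) t) t
| hc_mul1r t : hc_eq (HcMul t (HcC 1)) t
| hc_mulDl t u v :
    hc_eq (HcMul (HcAdd t u) v) (HcAdd (HcMul t v) (HcMul u v))
| hc_mulDr t u v :
    hc_eq (HcMul t (HcAdd u v)) (HcAdd (HcMul t u) (HcMul t v))
| hc_scalarD a b : hc_eq (HcC (a + b)) (HcAdd (HcC a) (HcC b))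
| hc_scalarM a b : hc_eq (HcC (a * b)) (HcMul (HcC a) (HcC b))
| hc_scalar_central a t : hc_eq (HcMul (HcC a) t) (HcMul t (HcC a))
| hc_linX a x x' : hc_eq (HcX (a *: x + x')) (HcAdd (HcMul (HcC a) (HcX x)) (HcX x'))
| hc_linY a y y' : hc_eq (HcY (a *: y + y')) (HcAdd (HcMul (HcC a) (HcY y)) (HcY y'))
| hc_group1 : hc_eq (HcW 1%g) (HcC 1)
| hc_groupM w w' : hc_eq (HcW (w * w')%g) (HcMul (HcW w) (HcW w'))
| hc_WX w x : hc_eq (HcMul (HcW w) (HcX x)) (HcMul (HcX (act_dual (rep d) w x)) (HcW w))
| hc_WY w y : hc_eq (HcMul (HcW w) (HcY y)) (HcMul (HcY (act_h (rep d) w y)) (HcW w))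
| hc_XX x x' : hc_eq (HcMul (HcX x) (HcX x')) (HcMul (HcX x') (HcX x))
| hc_YY y y' : hc_eq (HcMul (HcY y) (HcY y')) (HcMul (HcY y') (HcY y))
| hc_YX y x :
    hc_eq (HcAdd (HcMul (HcY y) (HcX x)) (HcOpp (HcMul (HcX x) (HcY y))))
          (HcAdd (HcC (pairing y x))
             (HcOpp (\big[HcAdd/HcC 0]_(s in reflections (rep d))
                HcMul (HcC (param d s * pairing y (dual_root d s)
                                      * pairing (coroot d s) x))
                      (HcW s)))).

HB.instance Definition _ := gen_eqMixin hc_term.
HB.instance Definition _ := gen_choiceMixin hc_term.

Definition hc_eqb (t u : hc_term) : bool := `[< hc_eq t u >].

Lemma hc_eqb_refl : reflexive hc_eqb.
Proof. by move=> t; apply/asboolP; exact: hc_refl. Qed.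
Lemma hc_eqb_sym : ssrbool.symmetric hc_eqb.
Proof. by move=> t u; apply/asboolP/asboolP; exact: hc_sym. Qed.
Lemma hc_eqb_trans : transitive hc_eqb.
Proof.
by move=> u t v /asboolP tu /asboolP uv; apply/asboolP; exact: hc_trans tu uv.
Qed.

Canonical hc_equiv := EquivRel hc_eqb hc_eqb_refl hc_eqb_sym hc_eqb_trans.

Definition Hc : Type := {eq_quot hc_equiv}.
HB.instance Definition _ := Choice.on Hc.
HB.instance Definition _ := Quotient.on Hc.

Definition hc_class (t : hc_term) : Hc := \pi_Hc t.

Lemma hc_classP t u : hc_eq t u <-> hc_class t = hc_class u.
Proof.
split; first by move=> tu; apply/eqmodP/asboolP.
by move/eqmodP/asboolP.
Qed.

Lemma hc_reprK (a : Hc) : hc_class (repr a) = a.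
Proof. exact: reprK. Qed.

Lemma hc_repr_class t : hc_eq (repr (hc_class t)) t.
Proof. by apply/hc_classP; rewrite hc_reprK. Qed.

Definition hc_add (a b : Hc) : Hc := hc_class (HcAdd (repr a) (repr b)).
Definition hc_mul (a b : Hc) : Hc := hc_class (HcMul (repr a) (repr b)).
Definition hc_opp (a : Hc) : Hc := hc_class (HcOpp (repr a)).

Lemma hc_addE t u : hc_add (hc_class t) (hc_class u) = hc_class (HcAdd t u).
Proof. by apply/hc_classP; apply: hc_congD; exact: hc_repr_class. Qed.
Lemma hc_mulE t u : hc_mul (hc_class t) (hc_class u) = hc_class (HcMul t u).
Proof. by apply/hc_classP; apply: hc_congM; exact: hc_repr_class. Qed.
Lemma hc_oppE t : hc_opp (hc_class t) = hc_class (HcOpp t).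
Proof.
by apply/hc_classP; apply: hc_congM; [exact: hc_refl | exact: hc_repr_class].
Qed.

Lemma hc_ind (P : Hc -> Prop) : (forall t, P (hc_class t)) -> forall a, P a.
Proof. by move=> Pt a; rewrite -(hc_reprK a). Qed.

Fact hc_addrA : associative hc_add.
Proof.
elim/hc_ind=> t; elim/hc_ind=> u; elim/hc_ind=> v.
by rewrite !hc_addE; apply/hc_classP; exact: hc_addA.
Qed.
Fact hc_addrC : commutative hc_add.
Proof.
elim/hc_ind=> t; elim/hc_ind=> u.
by rewrite !hc_addE; apply/hc_classP; exact: hc_addC.
Qed.
Fact hc_add0r : left_id (hc_class (HcC 0)) hc_add.
Proof.
by elim/hc_ind=> t; rewrite hc_addE; apply/hc_classP; exact: hc_add0.
Qed.
Fact hc_addNr : left_inverse (hc_class (HcC 0)) hc_opp hc_add.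
Proof.
by elim/hc_ind=> t; rewrite hc_oppE hc_addE; apply/hc_classP; exact: hc_addN.
Qed.
HB.instance Definition _ :=
  GRing.isZmodule.Build Hc hc_addrA hc_addrC hc_add0r hc_addNr.

Fact hc_mulrA : associative hc_mul.
Proof.
elim/hc_ind=> t; elim/hc_ind=> u; elim/hc_ind=> v.
by rewrite !hc_mulE; apply/hc_classP; exact: hc_mulA.
Qed.
Fact hc_mul1r_ : left_id (hc_class (HcC 1)) hc_mul.
Proof.
by elim/hc_ind=> t; rewrite hc_mulE; apply/hc_classP; exact: hc_mul1l.
Qed.
Fact hc_mulr1_ : right_id (hc_class (HcC 1)) hc_mul.
Proof.
by elim/hc_ind=> t; rewrite hc_mulE; apply/hc_classP; exact: hc_mul1r.
Qed.
Fact hc_mulrDl : left_distributive hc_mul +%R.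
Proof.
elim/hc_ind=> t; elim/hc_ind=> u; elim/hc_ind=> v.
rewrite /GRing.add /= !(hc_mulE, hc_addE); apply/hc_classP; exact: hc_mulDl.
Qed.
Fact hc_mulrDr : right_distributive hc_mul +%R.
Proof.
elim/hc_ind=> t; elim/hc_ind=> u; elim/hc_ind=> v.
rewrite /GRing.add /= !(hc_mulE, hc_addE); apply/hc_classP; exact: hc_mulDr.
Qed.
HB.instance Definition _ := GRing.Zmodule_isPzRing.Build Hc
  hc_mulrA hc_mul1r_ hc_mulr1_ hc_mulrDl hc_mulrDr.

Definition hX (x : 'rV[C]_n) : Hc := hc_class (HcX x).
Definition hY (y : 'cV[C]_n) : Hc := hc_class (HcY y).
Definition hW (w : W) : Hc := hc_class (HcW w).
Definition hC (a : C) : Hc := hc_class (HcC a).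

Lemma hc_classD t u : hc_class (HcAdd t u) = hc_class t + hc_class u.
Proof. by rewrite -hc_addE. Qed.
Lemma hc_classM t u : hc_class (HcMul t u) = hc_class t * hc_class u.
Proof. by rewrite -hc_mulE. Qed.
Lemma hc_classN t : hc_class (HcOpp t) = - hc_class t.
Proof. by rewrite -hc_oppE. Qed.

Lemma hY_hX_commutator y x :
  hY y * hX x - hX x * hY y =
  hC (pairing y x)
  - \sum_(s in reflections (rep d))
      hC (param d s * pairing y (dual_root d s) * pairing (coroot d s) x) * hW s.
Proof.
have /hc_classP := hc_YX y x; rewrite !(hc_classD, hc_classN, hc_classM) => ->.
congr (_ - _); rewrite (big_morph hc_class hc_classD (erefl _)).
by apply: eq_bigr => s _; rewrite hc_classM.
Qed.

(* C[h] is {mpoly C[n]}, the i-th variable being the i-th coordinate function; *)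
(* this is the map C[h] -> H_c.                                                *)
Definition hPoly (p : {mpoly C[n]}) : Hc :=
  \sum_(m <- msupp p) hC p@_m * \prod_(i < n) hX (delta_mx 0 i) ^+ m i.

End CherednikAlgebra.

Section ModuleCategories.
Variable H : pzRingType.

Definition fin_gen (M : lmodType H) : Prop :=
  exists (k : nat) (g : 'I_k -> M),
    forall m : M, exists a : 'I_k -> H, m = \sum_i a i *: g i.

Definition submodule (M : lmodType H) (N : M -> Prop) : Prop :=
  [/\ N 0, forall m m', N m -> N m' -> N (m + m')
    & forall (a : H) m, N m -> N (a *: m)].

Definition irreducible_module (M : lmodType H) : Prop :=
  (exists m : M, m <> 0) /\
  forall N : M -> Prop, submodule N ->
    (forall m, N m -> m = 0) \/ (forall m, N m).

Definition short_exact (M1 M2 M3 : lmodType H)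
    (f : {linear M1 -> M2}) (g : {linear M2 -> M3}) : Prop :=
  [/\ injective f, forall m, g m = 0 <-> (exists m1, m = f m1)
    & forall m3, exists m, m3 = g m].

(* A and B are full subcategories of the category of H-modules.                *)
Definition serre_subcategory (A B : lmodType H -> Prop) : Prop :=
  [/\ forall M, A M -> B M,
      forall M : lmodType H, (forall m : M, m = 0) -> A M
    & forall (M1 M2 M3 : lmodType H)
             (f : {linear M1 -> M2}) (g : {linear M2 -> M3}),
        B M1 -> B M2 -> B M3 -> short_exact f g ->
        (A M2 <-> A M1 /\ A M3)].

End ModuleCategories.

Section CherednikModules.
Variables (R : realType) (n : nat) (W : finGroupType).
Local Notation C := R[i].
Variable d : cherednik_datum R n W.

Definition coh (M : lmodType (Hc d)) : Prop :=
  exists (k : nat) (g : 'I_k -> M), forall m : M,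
    exists p : 'I_k -> {mpoly C[n]}, m = \sum_i hPoly d (p i) *: g i.

Definition h_locally_nilpotent (M : lmodType (Hc d)) : Prop :=
  forall m : M, exists N : nat, forall y : 'I_N -> 'cV[C]_n,
    (\prod_(i < N) hY d (y i)) *: m = 0.

Definition category_O (M : lmodType (Hc d)) : Prop :=
  fin_gen M /\ h_locally_nilpotent M.

(* The points of h at which the stalk of the sheaf of M is nonzero.            *)
Definition sheaf_support (M : lmodType (Hc d)) (v : 'cV[C]_n) : Prop :=
  exists m : M, forall p : {mpoly C[n]},
    p.@[fun i => v i 0] != 0 -> hPoly d p *: m <> 0.

End CherednikModules.

Section Zariski.
Variables (R : realType) (n : nat).
Local Notation C := R[i].
Implicit Types X Z : 'cV[C]_n -> Prop.

Definition zariski_closed Z : Prop :=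
  exists I : {mpoly C[n]} -> Prop,
    forall v, Z v <-> (forall p, I p -> p.@[fun i => v i 0] = 0).

Definition irreducible_set Z : Prop :=
  (exists v, Z v) /\
  forall Z1 Z2, zariski_closed Z1 -> zariski_closed Z2 ->
    (forall v, Z v -> Z1 v \/ Z2 v) ->
    (forall v, Z v -> Z1 v) \/ (forall v, Z v -> Z2 v).

Definition irreducible_component X Z : Prop :=
  [/\ irreducible_set Z, forall v, Z v -> X v
    & forall Z', irreducible_set Z' -> (forall v, Z' v -> X v) ->
        (forall v, Z v -> Z' v) -> forall v, Z' v -> Z v].

End Zariski.

(* B (x)_{C[h]} M, for a commutative C-algebra B and a morphism Spec B -> h    *)
(* given by the B-point f of h, i.e. the global sections of the pullback of    *)
(* Sh(M) along f. It is presented as the B-module generated by the symbols     *)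
(* 1 (x) m.                                                                    *)
Section BaseChange.
Variables (R : realType) (n : nat) (W : finGroupType).
Local Notation C := R[i].
Variable d : cherednik_datum R n W.
Variables (B : comNzRingType) (iota : {rmorphism C -> B}) (f : 'cV[B]_n).
Variable M : lmodType (Hc d).

Inductive bc_term : Type :=
| BcTen of M
| BcZero
| BcAdd of bc_term & bc_term
| BcScale of B & bc_term.

Definition BcOpp t := BcScale (-1) t.

Inductive bc_eq : bc_term -> bc_term -> Prop :=
| bc_refl t : bc_eq t t
| bc_sym t u : bc_eq t u -> bc_eq u t
| bc_trans t u v : bc_eq t u -> bc_eq u v -> bc_eq t v
| bc_congD t t' u u' :
    bc_eq t t' -> bc_eq u u' -> bc_eq (BcAdd t u) (BcAdd t' u')
| bc_congZ b t t' : bc_eq t t' -> bc_eq (BcScale b t) (BcScale b t')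
| bc_addA t u v : bc_eq (BcAdd t (BcAdd u v)) (BcAdd (BcAdd t u) v)
| bc_addC t u : bc_eq (BcAdd t u) (BcAdd u t)
| bc_add0 t : bc_eq (BcAdd BcZero t) t
| bc_addN t : bc_eq (BcAdd (BcOpp t) t) BcZero
| bc_scaleA a b t : bc_eq (BcScale a (BcScale b t)) (BcScale (a * b) t)
| bc_scale1 t : bc_eq (BcScale 1 t) t
| bc_scaleDr a t u :
    bc_eq (BcScale a (BcAdd t u)) (BcAdd (BcScale a t) (BcScale a u))
| bc_scaleDl a b t :
    bc_eq (BcScale (a + b) t) (BcAdd (BcScale a t) (BcScale b t))
| bc_tenD m m' : bc_eq (BcTen (m + m')) (BcAdd (BcTen m) (BcTen m'))
| bc_balanced (p : {mpoly C[n]}) m :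
    bc_eq (BcTen (hPoly d p *: m))
          (BcScale (mmap iota (fun i => f i 0) p) (BcTen m)).

HB.instance Definition _ := gen_eqMixin bc_term.
HB.instance Definition _ := gen_choiceMixin bc_term.

Definition bc_eqb (t u : bc_term) : bool := `[< bc_eq t u >].

Lemma bc_eqb_refl : reflexive bc_eqb.
Proof. by move=> t; apply/asboolP; exact: bc_refl. Qed.
Lemma bc_eqb_sym : ssrbool.symmetric bc_eqb.
Proof. by move=> t u; apply/asboolP/asboolP; exact: bc_sym. Qed.
Lemma bc_eqb_trans : transitive bc_eqb.
Proof.
by move=> u t v /asboolP tu /asboolP uv; apply/asboolP; exact: bc_trans tu uv.
Qed.

Canonical bc_equiv := EquivRel bc_eqb bc_eqb_refl bc_eqb_sym bc_eqb_trans.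

Definition base_change : Type := {eq_quot bc_equiv}.
HB.instance Definition _ := Choice.on base_change.
HB.instance Definition _ := Quotient.on base_change.

Definition bc_class (t : bc_term) : base_change := \pi_base_change t.

Lemma bc_classP t u : bc_eq t u <-> bc_class t = bc_class u.
Proof.
split; first by move=> tu; apply/eqmodP/asboolP.
by move/eqmodP/asboolP.
Qed.

Lemma bc_reprK (a : base_change) : bc_class (repr a) = a.
Proof. exact: reprK. Qed.

Lemma bc_repr_class t : bc_eq (repr (bc_class t)) t.
Proof. by apply/bc_classP; rewrite bc_reprK. Qed.

Definition bc_add (a b : base_change) := bc_class (BcAdd (repr a) (repr b)).
Definition bc_scale (b : B) (a : base_change) := bc_class (BcScale b (repr a)).
Definition bc_opp (a : base_change) := bc_class (BcOpp (repr a)).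

Lemma bc_addE t u : bc_add (bc_class t) (bc_class u) = bc_class (BcAdd t u).
Proof. by apply/bc_classP; apply: bc_congD; exact: bc_repr_class. Qed.
Lemma bc_scaleE b t : bc_scale b (bc_class t) = bc_class (BcScale b t).
Proof. by apply/bc_classP; apply: bc_congZ; exact: bc_repr_class. Qed.
Lemma bc_oppE t : bc_opp (bc_class t) = bc_class (BcOpp t).
Proof. by apply/bc_classP; apply: bc_congZ; exact: bc_repr_class. Qed.

Lemma bc_ind (P : base_change -> Prop) :
  (forall t, P (bc_class t)) -> forall a, P a.
Proof. by move=> Pt a; rewrite -(bc_reprK a). Qed.

Fact bc_addrA : associative bc_add.
Proof.
elim/bc_ind=> t; elim/bc_ind=> u; elim/bc_ind=> v.
by rewrite !bc_addE; apply/bc_classP; exact: bc_addA.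
Qed.
Fact bc_addrC : commutative bc_add.
Proof.
elim/bc_ind=> t; elim/bc_ind=> u.
by rewrite !bc_addE; apply/bc_classP; exact: bc_addC.
Qed.
Fact bc_add0r : left_id (bc_class BcZero) bc_add.
Proof.
by elim/bc_ind=> t; rewrite bc_addE; apply/bc_classP; exact: bc_add0.
Qed.
Fact bc_addNr : left_inverse (bc_class BcZero) bc_opp bc_add.
Proof.
by elim/bc_ind=> t; rewrite bc_oppE bc_addE; apply/bc_classP; exact: bc_addN.
Qed.
HB.instance Definition _ :=
  GRing.isZmodule.Build base_change bc_addrA bc_addrC bc_add0r bc_addNr.

Fact bc_scalerA a b v : bc_scale a (bc_scale b v) = bc_scale (a * b) v.
Proof.
elim/bc_ind: v => t; rewrite !bc_scaleE; apply/bc_classP; exact: bc_scaleA.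
Qed.
Fact bc_scale1r : left_id 1 bc_scale.
Proof.
by elim/bc_ind=> t; rewrite !bc_scaleE; apply/bc_classP; exact: bc_scale1.
Qed.
Fact bc_scalerDr : right_distributive bc_scale +%R.
Proof.
move=> a; elim/bc_ind=> t; elim/bc_ind=> u; rewrite /GRing.add /=.
by rewrite !(bc_addE, bc_scaleE); apply/bc_classP; exact: bc_scaleDr.
Qed.
Fact bc_scalerDl v : {morph bc_scale^~ v : a b / a + b >-> a + b}.
Proof.
move=> a b; elim/bc_ind: v => t; rewrite [RHS]/GRing.add /=.
by rewrite !(bc_addE, bc_scaleE); apply/bc_classP; exact: bc_scaleDl.
Qed.
HB.instance Definition _ := GRing.Zmodule_isLmodule.Build B base_change
  bc_scalerA bc_scale1r bc_scalerDr bc_scalerDl.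

Definition ten (m : M) : base_change := bc_class (BcTen m).

End BaseChange.

(* Smooth connected affine curves Spec A over C (A is a C-algebra through      *)
(* iota), their closed points, and immersions of such curves into h.           *)
Section Curves.
Variables (R : realType) (A : idomainType) (iota : {rmorphism R[i] -> A}).
Local Notation C := R[i].

Definition finite_type : Prop :=
  exists (k : nat) (a : 'I_k -> A),
    forall b : A, exists p : {mpoly C[k]}, b = mmap iota a p.

Definition is_point (ev : {rmorphism A -> C}) : Prop :=
  forall a : C, ev (iota a) = a.

(* The square of the maximal ideal of the point ev.                            *)
Definition point_ideal_sq (ev : {rmorphism A -> C}) (a : A) : Prop :=
  exists s : seq (A * A),
    (forall u, u \in s -> ev u.1 = 0 /\ ev u.2 = 0) /\
    a = \sum_(u <- s) u.1 * u.2.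

(* The cotangent space at every closed point is a line. For a domain A of      *)
(* finite type this says that Spec A is smooth of dimension 1: the dimension   *)
(* of A is at most 1 by Krull, and dimension 0 would force A = C.              *)
Definition cotangent_lines : Prop :=
  forall ev : {rmorphism A -> C}, is_point ev ->
    exists t : A, [/\ ev t = 0, ~ point_ideal_sq ev t
      & forall a, ev a = 0 -> exists k : C, point_ideal_sq ev (a - iota k * t)].

Definition smooth_affine_curve : Prop := finite_type /\ cotangent_lines.

(* The differential of f : Spec A -> h is injective at every closed point,     *)
(* i.e. the cotangent map at that point is nonzero.                            *)
Definition immersion (n : nat) (f : 'cV[A]_n) : Prop :=
  forall ev : {rmorphism A -> C}, is_point ev ->
    exists i : 'I_n, ~ point_ideal_sq ev (f i 0 - iota (ev (f i 0))).

End Curves.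

(* Y as a locally closed subvariety of h; a morphism from a reduced variety    *)
(* factors through it as soon as it does so on closed points.                  *)
Definition stratum (R : realType) (n : nat) (W : finGroupType)
    (d : cherednik_datum R n W) (W' : {group W}) (v : 'cV[R[i]]_n) : Prop :=
  stabiliser (rep d) v = W'.

Definition morphism_to_stratum (R : realType) (n : nat) (W : finGroupType)
    (d : cherednik_datum R n W) (W' : {group W})
    (A : idomainType) (iota : {rmorphism R[i] -> A}) (f : 'cV[A]_n) : Prop :=
  forall ev : {rmorphism A -> R[i]}, is_point iota ev ->
    stratum d W' (map_mx ev f).

(* Connections on a B-module E, for a commutative C-algebra B.                 *)
Section Connections.
Variables (R : realType) (B : comUnitRingType) (iota : {rmorphism R[i] -> B}).

Definition derivation (D : B -> B) : Prop :=
  [/\ forall a b, D (a + b) = D a + D b,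
      forall a b, D (a * b) = a * D b + D a * b
    & forall a, D (iota a) = 0].

(* nabla D is only meaningful when D is a C-derivation of B.                   *)
Definition flat_connection (E : lmodType B) (nabla : (B -> B) -> E -> E) : Prop :=
  [/\ forall D, derivation D ->
        forall u v, nabla D (u + v) = nabla D u + nabla D v,
      forall D, derivation D ->
        forall a v, nabla D (a *: v) = D a *: v + a *: nabla D v,
      forall D D', derivation D -> derivation D' ->
        forall a v, nabla (fun z => a * D z + D' z) v
                    = a *: nabla D v + nabla D' v
    & forall D D', derivation D -> derivation D' ->
        forall v, nabla (fun z => D (D' z) - D' (D z)) v
                  = nabla D (nabla D' v) - nabla D' (nabla D v)].

End Connections.

(* Regularity of a connection over a function field K/C at a place of K/C, in  *)
(* terms of lattices (Deligne, Katz).                                          *)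
Section RegularSingularities.
Variables (R : realType) (K : fieldType) (iota : {rmorphism R[i] -> K}).
Variable E : lmodType K.

(* O is the valuation ring of a place of K/C.                                  *)
Definition place (O : K -> Prop) : Prop :=
  [/\ forall a, O (iota a),
      forall a b, O a -> O b -> O (a - b) /\ O (a * b),
      forall z, O z \/ O z^-1
    & exists z, ~ O z].

Definition place_ideal (O : K -> Prop) (z : K) : Prop :=
  O z /\ (z = 0 \/ ~ O z^-1).

Definition basis_of_space (r : nat) (e : 'I_r -> E) : Prop :=
  forall v, exists! a : 'rV[K]_r, v = \sum_i a 0 i *: e i.

(* The O-span of e.                                                            *)
Definition lattice (O : K -> Prop) (r : nat) (e : 'I_r -> E) (v : E) : Prop :=
  exists a : 'I_r -> K, (forall i, O (a i)) /\ v = \sum_i a i *: e i.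

Definition regular_at (O : K -> Prop) (nabla : (K -> K) -> E -> E) : Prop :=
  exists (r : nat) (e : 'I_r -> E), basis_of_space e /\
    forall D, derivation iota D ->
      (forall z, place_ideal O z -> place_ideal O (D z)) ->
      forall v, lattice O e v -> lattice O e (nabla D v).

End RegularSingularities.

Section DunklConnection.
Variables (R : realType) (n : nat) (W : finGroupType).
Local Notation C := R[i].
Variables (d : cherednik_datum R n W) (W' : {group W}) (M : lmodType (Hc d)).

(* f is a B-point of Y, i.e. a morphism Spec B -> Y. In particular the scalars *)
(* pairing f (dual_root d s), s outside W', are units of B.                    *)
Section OverRing.
Variables (B : comUnitRingType) (iota : {rmorphism C -> B}) (f : 'cV[B]_n).
Local Notation ten := (@ten R n W d B iota f M).

(* The formula for nabla_y m, pulled back along f and extended B-linearly from *)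
(* y in h^{W'} to eta in B (x) h^{W'}.                                         *)
Definition nabla_formula (eta : 'cV[B]_n) (m : M) : base_change iota f M :=
  \sum_(i < n) eta i 0 *: ten (hY d (delta_mx i 0) *: m)
  - \sum_(s in reflections (rep d) :\: W')
      (iota (param d s) * pairing eta (map_mx iota (dual_root d s))
       * iota (2 / (1 - eigen d s))
       * (pairing f (map_mx iota (dual_root d s)))^-1)
      *: ten ((hW d s - 1) *: m).

(* The pullback along f of the connection on i_Y^* Sh(M): the image under f of *)
(* the vector field D is the element D(f) of B (x) h^{W'}. When f is an affine *)
(* open chart of Y this is the connection itself on that chart. There is at    *)
(* most one such nabla on derivations, since the 1 (x) m generate.             *)
Definition dunkl_connection
    (nabla : (B -> B) -> base_change iota f M -> base_change iota f M) : Prop :=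
  flat_connection iota nabla /\
  forall D, derivation iota D -> forall m,
    nabla D (ten m) = nabla_formula (map_mx D f) m.

End OverRing.

(* For every smooth curve f : Spec A -> Y immersed in Y, the pullback of the   *)
(* connection is regular at every point at infinity of the curve, that is, at  *)
(* every place of its function field {fraction A} not centred on Spec A.       *)
(* Regularity at such a place only involves the generic stalk of the pullback. *)
(* Affine curves suffice: Y is quasi-affine, so contains no complete curve.    *)
Definition has_regular_singularities : Prop :=
  forall (A : idomainType) (iota : {rmorphism C -> A}) (f : 'cV[A]_n),
    smooth_affine_curve iota -> immersion iota f ->
    morphism_to_stratum d W' iota f ->
    let iotaK := (@tofrac A \o iota : {rmorphism C -> {fraction A}}) in
    exists nabla, dunkl_connection (iota := iotaK)
                    (f := map_mx (@tofrac A) f) nabla /\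
      forall O : {fraction A} -> Prop, place iotaK O ->
        (exists a : A, ~ O (tofrac a)) -> regular_at iotaK O nabla.

End DunklConnection.

(* Main.v *)
(* Forward direction: a module M in category O is generated over C[h] by the    *)
(* finitely many words y..y w g, and multiplying the words of length l by the   *)
(* l-th power of a common pole of the coordinates of a curve yields a lattice   *)
(* stable under the logarithmic derivations at a place at infinity.             *)
(*                                                                              *)
(* Converse: the Euler element eu = sum x_i y_i - sum_s 2 c_s / (1 - l_s) s     *)
(* satisfies [eu, x] = x, [eu, y] = - y and commutes with W. Up to an element   *)
(* of CW commuting with eu it acts on the restriction of M to the stratum as    *)
(* the covariant derivative along the Euler field. Regularity at infinity of    *)
(* the punctured lines C^* v bounds the degrees of its iterates on every line,  *)
(* hence uniformly, since C is uncountable; so some polynomial in eu kills a    *)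
(* given m generically on h^{W'}, modulo the ideal of h^{W'}. Multiplication    *)
(* by suitable products of linear forms, which only shifts eu, turns this into  *)
(* a nonzero vector whose image under a polynomial in eu has zero stalk along   *)
(* the W-orbit of a point of the support; as M is irreducible that image is     *)
(* zero. The eu-finite vectors form a submodule, so M is eu-finite, with        *)
(* eigenvalues in finitely many cosets s + N; as y lowers the eigenvalue by 1   *)
(* it acts locally nilpotently.                                                 *)
Require Import Defs.
From HB Require Import structures.
From mathcomp Require Import all_boot all_order all_algebra all_fingroup.
From mathcomp Require Import all_character reals complex.
From mathcomp Require Import generic_quotient boolp classical_sets mpoly.
From mathcomp Require Import ring ssrcomplements zify.

Set Implicit Arguments.
Unset Strict Implicit.
Unset Printing Implicit Defensive.
Import Order.TTheory GRing.Theory Num.Theory.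
Local Open Scope ring_scope.

(** * Generic points *)

(** A module in category O is generated over C[h] by finitely many words in the [y]'s applied to
    W-translates of its generators, because the Dunkl commutation rule [hY_hPoly] moves polynomials
    to the left ([words_stable], [words_generate]). Hence it is coherent; and in an extension the
    nilpotency orders can be bounded over the finitely many words of a given length
    ([category_O_serre]).

    Regularity of such a module: a logarithmic derivation D satisfies D z / z in the valuation ring
    ([log_derivative]), so differentiating the coordinates of a curve does not worsen their poles.
    If [g] is a common pole, each letter [y] is paid for by one factor [g], and the elements g^l (x)
    (word of length l) span a stable lattice ([category_O_regular_at]). Flatness is automatic on a
    curve, since the derivations of its function field are proportional ([smooth_curve_dependence],
    [derivations_proportional]).

    Conversely, [euler] grades H. On a line through a point of the stratum it is, up to an element
    of CW, the covariant derivative along t d/dt, and a stable lattice at infinity bounds the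
    degrees of all its iterates ([regular_on_line]). Avoiding countably many hypersurfaces makes
    this bound uniform ([degree_uniformly_bounded]), so some polynomial in [euler] sends a given
    vector to zero generically on the fixed space ([regular_euler_finite]). Multiplication by
    products of linear forms merely shifts [euler], and turns this into a nonzero vector whose image
    has zero stalks along a W-orbit in the support; irreducibility makes the image zero
    ([euler_finite_vector]). Then every vector is [euler]-finite, the eigenvalues are bounded below
    in finitely many cosets of the integers, and [y], which lowers them by 1, is locally nilpotent
    ([euler_finite_category_O]). *)

Section Avoidance.
Variable R : realType.
Local Notation C := R[i].

Lemma interval_avoid (a b u : R) :
  a < b -> exists ab : R * R, [/\ a <= ab.1, ab.1 < ab.2, ab.2 <= b &
    (u < ab.1) || (ab.2 < u)].
Proof.
(* Quarters, unlike halves, leave a strict gap between [u] and the chosen closed piece. *)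
move=> ab; pose h := (b - a) / 4.
have h0 : 0 < h by rewrite divr_gt0 ?subr_gt0 ?ltr0n.
have bE : b = a + h * 4 by rewrite /h; field.
case: (ltP u (a + h * 2)) => hu.
  exists (a + h * 3, b) => /=; rewrite bE; split.
  - by rewrite lerDl mulr_ge0 ?ltW.
  - by rewrite ltrD2l ltr_pM2l // ltr_nat.
  - by [].
  - by rewrite (lt_trans hu) // ltrD2l ltr_pM2l // ltr_nat.
exists (a, a + h) => /=; rewrite bE; split=> //.
- by rewrite ltrDl.
- by rewrite lerD2l ler_pMr // ler1n.
- by rewrite (lt_le_trans _ hu) ?orbT // ltrD2l ltr_pMr // ltr1n.
Qed.

(** Cantor's argument: step [k] of a nested sequence of intervals discards [u k], and the supremum
    of the left ends belongs to all of them. *)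
Lemma real_avoid (u : nat -> R) : exists x : R, forall k, x != u k.
Proof.
have /choice [F HF] : forall q : (R * R) * R, exists q' : R * R, q.1.1 < q.1.2 ->
    [/\ q.1.1 <= q'.1, q'.1 < q'.2, q'.2 <= q.1.2 & (q.2 < q'.1) || (q'.2 < q.2)].
  move=> [[a b] v] /=; case: (boolP (a < b)) => [/(interval_avoid v)[q ?]|_].
    by exists q.
  by exists (0, 0).
pose I := fix I k := if k is k'.+1 then F (I k', u k') else (0, 1).
have Ilt k : (I k).1 < (I k).2.
  by elim: k => [|k IH] /=; [exact: ltr01 | case: (HF (I k, u k) IH)].
have Istep k := HF (I k, u k) (Ilt k).
have Imono j k : (j <= k)%N -> (I j).1 <= (I k).1 /\ (I k).2 <= (I j).2.
  elim: k => [|k IH]; first by rewrite leqn0 => /eqP->.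
  rewrite leq_eqVlt ltnS => /orP[/eqP->//|/IH[h1 h2]].
  case: (Istep k) => /= h3 _ h4 _.
  by split; [exact: le_trans h1 h3 | exact: le_trans h4 h2].
pose A := [set (I k).1 | k in [set: nat]]%classic.
have ub k : ubound A (I k).2.
  move=> _ [j _ <-]; case: (leqP j k) => jk.
    by rewrite (le_trans (Imono _ _ jk).1) // ltW.
  by rewrite (le_trans (ltW (Ilt j))) // (Imono _ _ (ltnW jk)).2.
have hA : has_sup A.
  by split; [exists (I 0).1, 0 | exists (I 0).2; apply: ub].
exists (sup A) => k; apply/eqP => supE.
have h1 : (I k.+1).1 <= sup A by apply: sup_upper_bound => //; exists k.+1.
have h2 : sup A <= (I k.+1).2 by apply: sup_le_ub; [exact: hA.1 | exact: ub].
rewrite supE in h1 h2.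
by case: (Istep k) => /= _ _ _ /orP[]; apply/negP; rewrite -leNgt.
Qed.

(** All entries of all the lists are enumerated through [pickle]; a real number that avoids their
    real parts is enough. *)
Lemma complex_avoid (s : nat -> seq C) : exists x : C, forall k, x \notin s k.
Proof.
pose u m : R := if @unpickle (nat * nat)%type m is Some (k, j)
  then complex.Re (nth 0 (s k) j) else 0.
have [x xu] := real_avoid u; exists (x%:C)%C => k; apply/negP => xs.
have /eqP := xu (pickle (k, index (x%:C)%C (s k))); apply.
by rewrite /u pickleK nth_index.
Qed.

Lemma poly_avoid (p : nat -> {poly C}) : (forall k, p k != 0) ->
  exists x : C, forall k, (p k).[x] != 0.
Proof.
move=> p0; have /choice [s Hs] : forall k, exists s : seq C, forall x, root (p k) x -> x \in s.
  move=> k; have [s ps] := closed_field_poly_normal (p k).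
  exists s => x; rewrite ps rootZ ?lead_coef_eq0 //.
  by rewrite root_prod_XsubC.
have [x xs] := complex_avoid s; exists x => k; apply/negP => /(Hs k).
by rewrite (negbTE (xs k)).
Qed.

Lemma mmap_horner (n : nat) (g : 'I_n -> {poly C}) (p : {mpoly C[n]}) x :
  (mmap polyC g p).[x] = p.@[fun i => (g i).[x]].
Proof.
rewrite /mmap /meval /mmap horner_sum; apply: eq_bigr => m _.
rewrite hornerM hornerC; congr (_ * _); rewrite /mmap1 horner_prod.
by apply: eq_bigr => i _; rewrite horner_exp.
Qed.

(* The coordinates of the point are chosen one after the other: [v] is good for *)
(* the first [j] coordinates if each [p k] is nonzero at some point agreeing    *)
(* with [v] there.                                                              *)
Lemma mpoly_avoid_point (n : nat) (p : nat -> {mpoly C[n]}) :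
  (forall k, exists w : 'I_n -> C, (p k).@[w] != 0) ->
  exists v : 'I_n -> C, forall k, (p k).@[v] != 0.
Proof.
move=> p0.
suff [v Hv] : exists v : 'I_n -> C, forall k, exists w : 'I_n -> C,
    (forall i : 'I_n, (i < n)%N -> w i = v i) /\ (p k).@[w] != 0.
  exists v => k; have [w [wv]] := Hv k.
  by rewrite (@meval_eq _ _ _ v) // => i; apply: wv.
have : forall j, (j <= n)%N -> exists v : 'I_n -> C, forall k, exists w : 'I_n -> C,
    (forall i : 'I_n, (i < j)%N -> w i = v i) /\ (p k).@[w] != 0; last exact.
elim=> [_|j IH jn].
  by exists (fun _ => 0) => k; have [w ?] := p0 k; exists w.
have [v /choice [w Hw]] := IH (ltnW jn).
(* The coordinates of the witness [w k] are frozen, except the [j]-th, which becomes a variable; the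
   resulting polynomial is nonzero since [w k] is not a zero of [p k]. *)
pose g k (i : 'I_n) : {poly C} := if i == j :> nat then 'X else (w k i)%:P.
have gE k x i : (g k i).[x] = if i == j :> nat then x else w k i.
  by rewrite /g; case: eqP => _; rewrite ?hornerX ?hornerC.
have q0 k : mmap polyC (g k) (p k) != 0.
  apply/eqP => q0; have [_ /eqP] := Hw k; apply.
  have := mmap_horner (g k) (p k) (w k (Ordinal jn)); rewrite q0 horner0 => ->.
  apply: meval_eq => i; rewrite gE; case: eqP => // ij.
  by congr (w k _); apply: val_inj.
have [x Hx] := poly_avoid q0.
exists (fun i : 'I_n => if i == j :> nat then x else v i) => k.
exists (fun i : 'I_n => if i == j :> nat then x else w k i); split=> [i|].
  by rewrite ltnS leq_eqVlt; case: eqP => //= _ ij; apply: (Hw k).1.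
have := Hx k; rewrite mmap_horner; congr (_ != _).
by apply: meval_eq => i; rewrite gE.
Qed.

End Avoidance.

Lemma mpoly_alg_ind (n : nat) (K : nzRingType) (P : {mpoly K[n]} -> Prop) :
  (forall c, P c%:MP) -> (forall i, P 'X_i) ->
  (forall p q, P p -> P q -> P (p + q)) ->
  (forall p q, P p -> P q -> P (p * q)) -> forall p, P p.
Proof.
move=> PC PX PD PM; elim/mpolyind=> [|c m p _ _ Pp]; first by rewrite -mpolyC0.
apply: (PD) => //; rewrite -mul_mpolyC; apply: (PM) => //; rewrite mpolyXE_id.
elim/big_ind: _ => [||i _]; [by rewrite -mpolyC1 | exact: PM |].
by elim: (m i) => [|k IH]; rewrite ?expr0 -?mpolyC1 // exprS; apply: PM.
Qed.

Section ChainRule.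
Variables (R : realType) (B : comUnitRingType) (iota : {rmorphism R[i] -> B}).
Local Notation C := R[i].
Variable D : B -> B.
Hypothesis derD : derivation iota D.

Lemma derivationD a b : D (a + b) = D a + D b. Proof. by have [h _ _] := derD; apply: h. Qed.
Lemma derivationM a b : D (a * b) = a * D b + D a * b. Proof. by have [_ h _] := derD; apply: h. Qed.
Lemma derivationC a : D (iota a) = 0. Proof. by have [_ _ h] := derD; apply: h. Qed.
Lemma derivation0 : D 0 = 0. Proof. by rewrite -[X in D X](rmorph0 iota) derivationC. Qed.
Lemma derivation1 : D 1 = 0. Proof. by rewrite -(rmorph1 iota) derivationC. Qed.
Lemma derivationX a k : D (a ^+ k.+1) = a ^+ k * D a *+ k.+1.
Proof.
elim: k => [|k IH]; first by rewrite expr1 expr0 mul1r.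
rewrite exprS derivationM {}IH [RHS]mulrS addrC mulrnAr mulrA -exprS.
by rewrite [D a * _]mulrC.
Qed.
Lemma derivation_sum (J : Type) (r : seq J) (P : pred J) (F : J -> B) :
  D (\sum_(j <- r | P j) F j) = \sum_(j <- r | P j) D (F j).
Proof. exact: (big_morph D derivationD derivation0). Qed.

(** The chain rule; it serves both for d/dt on polynomials and for derivations of function
    fields. *)
Lemma derivation_mmap (n : nat) (f : 'I_n -> B) (p : {mpoly C[n]}) :
  D (mmap iota f p) = \sum_(i < n) mmap iota f p^`M(i) * D (f i).
Proof.
elim/mpoly_alg_ind: p => [c|j|p q IHp IHq|p q IHp IHq].
- rewrite mmapC derivationC big1 // => i _.
  by rewrite mderivC raddf0 mul0r.
- rewrite mmapX mmap1U (bigD1 j) //= big1 => [|i ij].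
    rewrite mderivX mnm1E eqxx scale1r addr0.
    have -> : (U_(j) - U_(j) = 0 :> 'X_{1..n})%MM.
      by apply/mnmP => k; rewrite mnmBE subnn mnm0E.
    by rewrite mpolyX0 rmorph1 mul1r.
  by rewrite mderivX mnm1E eq_sym (negbTE ij) scale0r raddf0 mul0r.
- rewrite raddfD derivationD IHp IHq -big_split /=; apply: eq_bigr => i _.
  by rewrite mderivD raddfD /= mulrDl.
rewrite rmorphM derivationM IHp IHq mulr_sumr mulr_suml -big_split /=.
apply: eq_bigr => i _; rewrite mderivM raddfD /= !rmorphM /=.
by ring.
Qed.

End ChainRule.

Section NonVanishing.
Variable R : realType.
Local Notation C := R[i].

Lemma derivation_deriv : @derivation R {poly C} (@polyC C) (@deriv C).
Proof.
split=> [a b|a b|a]; first exact: derivD; last exact: derivC.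
by rewrite derivM addrC.
Qed.

Lemma meval_at0 (n : nat) (p : {mpoly C[n]}) : p.@[fun _ => 0] = p@_0%MM.
Proof.
elim/mpoly_alg_ind: p => [c|j|p q IHp IHq|p q IHp IHq].
- by rewrite mevalC mpolyCK.
- by rewrite mevalXU mcoeffX mnm1_eq0.
- by rewrite mevalD IHp IHq mcoeffD.
- by rewrite mevalM IHp IHq [RHS]rmorphM.
Qed.

(* If [p] vanishes identically, so do its partial derivatives, by restriction  *)
(* to lines; at the origin these are the coefficients of [p] up to factorials. *)
Lemma mpoly_neq0_point (n : nat) (p : {mpoly C[n]}) :
  p != 0 -> exists v, p.@[v] != 0.
Proof.
move=> p0; apply: contrapT => h.
have {h} pv v : p.@[v] = 0.
  by apply/eqP; apply: contrapT => /negP ?; apply: h; exists v.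
have step (i : 'I_n) (q : {mpoly C[n]}) :
    (forall v, q.@[v] = 0) -> forall v, q^`M(i).@[v] = 0.
  move=> qv v; pose g j : {poly C} := (v j)%:P + (j == i)%:R *: 'X.
  have gE j x : (g j).[x] = v j + (j == i)%:R * x.
    by rewrite /g hornerD hornerC hornerZ hornerX.
  have q0 : mmap polyC g q = 0.
    apply/eqP; apply: contrapT => /negP q0.
    have [//|x /(_ 0%N) /eqP] := @poly_avoid R (fun _ => mmap polyC g q).
    by apply; rewrite mmap_horner qv.
  have := derivation_mmap derivation_deriv g q.
  rewrite q0 deriv0 (bigD1 i) //= big1 => [|j ji].
    rewrite addr0 {2}/g eqxx scale1r derivD derivC add0r derivX mulr1.
    move/(congr1 (fun r => r.[0])); rewrite horner0 mmap_horner => ->.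
    by apply: meval_eq => j; rewrite gE mulr0 addr0.
  by rewrite {2}/g (negbTE ji) scale0r addr0 derivC mulr0.
have pm (m : 'X_{1..n}) v : p^`M[m].@[v] = 0.
  rewrite mderivm_foldr; move: v; elim: (flatten _) => [|i s IH] //=.
  exact: step.
case/eqP: p0; apply/mpolyP => m; rewrite mcoeff0.
have := pm m (fun _ => 0); rewrite meval_at0 mcoeff_mderivm addm0 => /eqP.
rewrite mulrn_eq0 => /orP[|/eqP//].
by rewrite eqn0Ngt prodn_gt0 // => i; rewrite ffactnn fact_gt0.
Qed.

End NonVanishing.

(** * Points and tangent vectors of affine domains *)

(* Classical inverses turn a commutative ring without zero divisors into an     *)
(* [idomainType].                                                               *)
Section ClassicalDomain.
Variable T : comNzRingType.
Hypothesis T_integral : forall a b : T, a * b = 0 -> a = 0 \/ b = 0.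

Definition classical_domain of (forall a b : T, a * b = 0 -> a = 0 \/ b = 0) : Type := T.
Local Notation dom := (classical_domain T_integral).

HB.instance Definition _ := GRing.ComNzRing.on dom.

Let invertible (x : dom) : bool := `[< exists y : dom, y * x = 1 >].
Let inverse (x : dom) : dom := xget x [set y | y * x = 1]%classic.

Let inverse_left : {in invertible, left_inverse 1 inverse *%R}.
Proof.
move=> x /asboolP [y yx]; rewrite /inverse.
by case: xgetP => [_ _ //|/(_ y)]; rewrite /= yx.
Qed.
Let invertible_intro (x y : dom) : y * x = 1 -> invertible x.
Proof. by move=> yx; apply/asboolP; exists y. Qed.
Let inverse_out : {in [predC invertible], inverse =1 id}.
Proof.
move=> x /asboolP h; rewrite /inverse; case: xgetP => // y _ yx.
by case: h; exists y.
Qed.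

HB.instance Definition _ := GRing.ComNzRing_hasMulInverse.Build dom
  inverse_left invertible_intro inverse_out.

Let dom_integral : GRing.integral_domain_axiom dom.
Proof. by move=> a b /T_integral [] ->; rewrite eqxx ?orbT. Qed.

HB.instance Definition _ := GRing.ComUnitRing_isIntegral.Build dom dom_integral.
End ClassicalDomain.

Section SubDomain.
Variable K : idomainType.

Definition subring_pred (P : K -> Prop) : Prop :=
  [/\ P 1, forall a b, P a -> P b -> P (a - b) & forall a b, P a -> P b -> P (a * b)].

Definition subring_mem (P : K -> Prop) of subring_pred P : pred K :=
  fun x => `[< P x >].

Lemma subring_mem_closed P (hP : subring_pred P) : subring_closed (subring_mem hP).
Proof.
case: (hP) => h1 hB hM; split=> [|a b|a b]; rewrite /subring_mem !unfold_in.
- exact/asboolP.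
- by move=> /asboolP ? /asboolP ?; apply/asboolP; apply: hB.
- by move=> /asboolP ? /asboolP ?; apply/asboolP; apply: hM.
Qed.

HB.instance Definition _ P (hP : subring_pred P) :=
  GRing.isSubringClosed.Build K (subring_mem hP) (subring_mem_closed hP).

Record subdomain_ring P (hP : subring_pred P) := SubdomainElt {
  subdomain_val :> K; _ : subdomain_val \in subring_mem hP }.
HB.instance Definition _ P (hP : subring_pred P) := [isSub for @subdomain_val P hP].
HB.instance Definition _ P (hP : subring_pred P) := [Choice of subdomain_ring hP by <:].
HB.instance Definition _ P (hP : subring_pred P) :=
  [SubChoice_isSubComNzRing of subdomain_ring hP by <:].

Variables (P : K -> Prop) (hP : subring_pred P).

Lemma subdomain_integral (a b : subdomain_ring hP) : a * b = 0 -> a = 0 \/ b = 0.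
Proof.
move/(congr1 val); rewrite rmorphM rmorph0 => /eqP.
by rewrite mulf_eq0 => /orP[]/eqP h; [left|right]; apply: val_inj; rewrite rmorph0.
Qed.

(** An element of the subring may be invertible in [K] only, so inverses are redefined inside the
    subring. *)
Definition subdomain : idomainType := classical_domain subdomain_integral.
Definition subdomain_incl : {rmorphism subdomain -> K} :=
  (val : {rmorphism subdomain_ring hP -> K}).

Lemma subdomain_incl_inj : injective subdomain_incl.
Proof. exact: val_inj. Qed.

Lemma subdomain_inclP (a : subdomain) : P (subdomain_incl a).
Proof. by case: a => x /= /asboolP. Qed.

Definition subdomain_elt x (Px : P x) : subdomain := SubdomainElt (asboolT Px).

End SubDomain.

Lemma rmorphism_of_fun (A B : nzRingType) (f : A -> B) :
  {morph f : x y / x + y} -> {morph f : x y / x * y} -> f 1 = 1 ->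
  exists g : {rmorphism A -> B}, g =1 f.
Proof.
move=> fD fM f1.
have f0 : f 0 = 0 by apply: (addIr (f 0)); rewrite -fD !add0r.
have fB : zmod_morphism f.
  move=> x y; rewrite fD; congr (_ + _); apply: (addIr (f y)).
  by rewrite -fD !addNr.
pose g := HB.pack_for {rmorphism A -> B} f (GRing.isZmodMorphism.Build A B f fB)
  (GRing.isMonoidMorphism.Build A B f (conj f1 fM)).
by exists g.
Qed.

Section PolyEval.
Variables (T S : comNzRingType) (phi : {rmorphism T -> S}) (x : S).

Definition poly_eval (q : {poly T}) : S := (map_poly phi q).[x].

Lemma poly_evalM p q : poly_eval (p * q) = poly_eval p * poly_eval q.
Proof. by rewrite /poly_eval rmorphM hornerM. Qed.
Lemma poly_evalD p q : poly_eval (p + q) = poly_eval p + poly_eval q.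
Proof. by rewrite /poly_eval rmorphD hornerD. Qed.
Lemma poly_evalB p q : poly_eval (p - q) = poly_eval p - poly_eval q.
Proof. by rewrite /poly_eval rmorphB hornerD hornerN. Qed.
Lemma poly_evalC c : poly_eval c%:P = phi c.
Proof. by rewrite /poly_eval map_polyC hornerC. Qed.
Lemma poly_evalX : poly_eval 'X = x.
Proof. by rewrite /poly_eval map_polyX hornerX. Qed.
Lemma poly_eval0 : poly_eval 0 = 0.
Proof. by rewrite /poly_eval map_poly0 horner0. Qed.
End PolyEval.

Section Tangent.
Variables (R : realType) (T : comNzRingType) (j : {rmorphism R[i] -> T}).
Local Notation C := R[i].

(** A tangent vector of Spec [T] at the point [phi]. *)
Definition tangent (phi : {rmorphism T -> C}) (delta : T -> C) : Prop :=
  [/\ forall a b, delta (a + b) = delta a + delta b,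
      forall a b, delta (a * b) = phi a * delta b + delta a * phi b
    & forall c, delta (j c) = 0].

Variables (phi : {rmorphism T -> C}) (delta : T -> C).
Hypothesis hdelta : tangent phi delta.

Lemma tangentD a b : delta (a + b) = delta a + delta b.
Proof. by case: hdelta => h _ _; apply: h. Qed.
Lemma tangentM a b : delta (a * b) = phi a * delta b + delta a * phi b.
Proof. by case: hdelta => _ h _; apply: h. Qed.
Lemma tangentC c : delta (j c) = 0.
Proof. by case: hdelta => _ _ h; apply: h. Qed.
Lemma tangent0 : delta 0 = 0.
Proof. by rewrite -[X in delta X](rmorph0 j) tangentC. Qed.
Variables x y : C.
(** The tangent vector of Spec T[X] at the point ([phi], [x]) which extends [delta] and takes the
    value [y] on X. *)
Definition poly_tangent (q : {poly T}) : C :=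
  (map_poly delta q).[x] + (map_poly phi q)^`().[x] * y.

Local Notation poly_eval := (poly_eval phi x).

Let coef_delta q i : (map_poly delta q)`_i = delta q`_i.
Proof. by rewrite coef_map_id0 // tangent0. Qed.

Lemma poly_tangentD p q : poly_tangent (p + q) = poly_tangent p + poly_tangent q.
Proof.
rewrite /poly_tangent; have -> : map_poly delta (p + q) = map_poly delta p + map_poly delta q.
  by apply/polyP => i; rewrite coefD !coef_delta coefD tangentD.
by rewrite rmorphD derivD !hornerD mulrDl addrACA.
Qed.

Lemma poly_tangent0 : poly_tangent 0 = 0.
Proof. by rewrite /poly_tangent !map_poly0 deriv0 !horner0 mul0r addr0. Qed.

Lemma poly_tangentC c : poly_tangent c%:P = delta c.
Proof.
rewrite /poly_tangent map_polyC derivC horner0 mul0r addr0.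
have -> : map_poly delta c%:P = (delta c)%:P; last by rewrite hornerC.
apply/polyP => i; rewrite coef_delta !coefC; case: eqP => // _; exact: tangent0.
Qed.

Lemma poly_tangentCM c q :
  poly_tangent (c%:P * q) = phi c * poly_tangent q + delta c * poly_eval q.
Proof.
rewrite /poly_tangent; have -> : map_poly delta (c%:P * q) =
    (phi c)%:P * map_poly delta q + (delta c)%:P * map_poly phi q.
  apply/polyP => i; rewrite coefD !coefCM !coef_delta coef_map coefCM.
  exact: tangentM.
rewrite rmorphM /= map_polyC derivM derivC mul0r add0r.
by rewrite hornerD !hornerM !hornerC /poly_eval; ring.
Qed.

Lemma poly_tangentXM q :
  poly_tangent ('X * q) = x * poly_tangent q + y * poly_eval q.
Proof.
rewrite /poly_tangent; have -> : map_poly delta ('X * q) = 'X * map_poly delta q.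
  apply/polyP => i; rewrite coef_delta !coefXM; case: (i == 0)%N.
    exact: tangent0.
  by rewrite coef_delta.
rewrite rmorphM /= map_polyX derivM derivX mul1r.
by rewrite hornerD !hornerM !hornerX /poly_eval; ring.
Qed.

Lemma poly_tangentM p q :
  poly_tangent (p * q) = poly_eval p * poly_tangent q + poly_tangent p * poly_eval q.
Proof.
elim/poly_ind: p => [|p c IH].
  by rewrite mul0r poly_tangent0 poly_eval0 !mul0r addr0.
rewrite mulrDl [p * 'X]mulrC poly_tangentD -mulrA poly_tangentXM poly_tangentCM IH.
rewrite poly_tangentD poly_tangentXM poly_tangentC poly_evalD !poly_evalM poly_evalC.
by rewrite poly_evalX; ring.
Qed.

End Tangent.

Section LiftPoint.
Variables (R : realType) (K T : idomainType) (j : {rmorphism R[i] -> T}).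
Local Notation C := R[i].
Variables (e : {rmorphism T -> K}) (a : K).
Hypothesis e_inj : injective e.
Local Notation ev := (poly_eval e a).

(* Which points and tangent vectors of [T] extend to [T[a]], the extension      *)
(* sending [a] to [x] and having derivative [y] at [a].                         *)
Definition liftable (q : {poly T}) (t : T) : Prop :=
  t != 0 /\ forall phi : {rmorphism T -> C}, is_point j phi -> phi t != 0 ->
  exists x : C, [/\ forall p, ev p = 0 -> poly_eval phi x p = 0,
    poly_eval phi x q != 0
  & forall delta, tangent j phi delta -> exists y : C,
      forall p, ev p = 0 -> poly_tangent phi delta x y p = 0].

Lemma e_eq0 t : (e t == 0) = (t == 0).
Proof. by rewrite -(rmorph0 e) (inj_eq e_inj). Qed.

(** Here T[a] is a polynomial ring: any [x] off the roots of the specialised [q] gives a point, and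
    [y] is free. The leading coefficient of [q] keeps that specialisation nonzero. *)
Lemma liftable_transcendental q :
  (forall p, ev p = 0 -> p = 0) -> ev q != 0 -> exists t, liftable q t.
Proof.
move=> tr q0; have qn0 : q != 0 by apply: contraNneq q0 => ->; rewrite poly_eval0.
exists (lead_coef q); split; first by rewrite lead_coef_eq0.
move=> phi _ lq; have pq : map_poly phi q != 0.
  apply: contraNneq lq => /(congr1 (fun r : {poly C} => r`_(size q).-1)).
  by rewrite coef_map coef0 /lead_coef => ->.
have [x /(_ 0%N) hx] := @poly_avoid R (fun _ => map_poly phi q) (fun _ => pq).
exists x; split=> // [p /tr->|delta hd]; first exact: poly_eval0.
by exists 0 => p /tr->; exact: poly_tangent0.
Qed.

(** Let [P] have least degree among the nonzero polynomials killing [a]. In characteristic zero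
    P'(a) is nonzero, so [P] is coprime to q P'. Where the leading coefficient of [P] and the Bezout
    constant do not vanish, each root of the specialised [P] is simple and is not a root of [q];
    tangent vectors then extend by implicit differentiation. *)
Lemma liftable_algebraic q :
  (exists2 p, p != 0 & ev p = 0) -> ev q != 0 -> exists t, liftable q t.
Proof.
move=> alg qn0.
pose good n := `[< exists p : {poly T}, [/\ p != 0, ev p = 0 & size p = n] >].
have ex_good : exists n, good n.
  by case: alg => p p0 pa; exists (size p); apply/asboolP; exists p.
case: (ex_minnP ex_good) => m /asboolP [P [P0 Pa sP]] min_m.
have minP p : ev p = 0 -> (size p < size P)%N -> p = 0.
  move=> pa; rewrite sP ltnNge; apply: contraNeq => p0; apply: min_m.
  by apply/asboolP; exists p.
have sP1 : (1 < size P)%N.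
  rewrite ltnNge; apply/negP => /size1_polyC PE.
  move: Pa P0; rewrite PE poly_evalC => /eqP; rewrite e_eq0 polyC_eq0 => ->.
  by [].
have charT k : k.+1%:R != 0 :> T.
  by rewrite -(rmorph_nat j) fmorph_eq0 pnatr_eq0.
have dPa : ev P^`() != 0.
  apply/eqP => /minP; rewrite lt_size_deriv // => /(_ isT) /(congr1 (fun r : {poly T} => r`_(size P).-2)).
  rewrite coef_deriv coef0; case: (size P) sP1 (lead_coefE P) => [|[|k]] //= _ lP.
  move/eqP; rewrite -lP -mulr_natr mulf_eq0 lead_coef_eq0 (negbTE P0) /=.
  by rewrite (negbTE (charT _)).
pose g := q * P^`().
have ga : ev g != 0 by rewrite poly_evalM mulf_neq0.
have g0 : g != 0 by apply: contraNneq ga => ->; rewrite poly_eval0.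
(* The gcd divides [g] up to a constant, so it is nonzero at [a]; its cofactor in [P] therefore
   vanishes at [a], and minimality of [P] forces the gcd to be constant. *)
have cop : coprimep P g.
  rewrite /coprimep.
  have d0 : gcdp P g != 0 by rewrite gcdp_eq0 negb_and P0.
  have /Pdiv.Idomain.dvdpP [[c1 Q1] /= c1n0 E1] := dvdp_gcdl P g.
  have /Pdiv.Idomain.dvdpP [[c2 Q2] /= c2n0 E2] := dvdp_gcdr P g.
  have da : ev (gcdp P g) != 0.
    apply: contraNneq ga => da; have := congr1 ev E2.
    rewrite -mul_polyC !poly_evalM da mulr0 poly_evalC => /eqP.
    by rewrite mulf_eq0 e_eq0 (negbTE c2n0).
  have Q1a : ev Q1 = 0.
    have := congr1 ev E1; rewrite -mul_polyC !poly_evalM Pa mulr0 => /esym/eqP.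
    by rewrite mulf_eq0 (negbTE da) orbF => /eqP.
  have Q10 : Q1 != 0.
    apply: contraNneq P0 => Q10; have := E1; rewrite Q10 mul0r => /eqP.
    by rewrite -mul_polyC mulf_eq0 polyC_eq0 (negbTE c1n0).
  have : (size P <= size Q1)%N.
    by rewrite leqNgt; apply: contraNN Q10 => /(minP _ Q1a) ->.
  have := congr1 (fun r : {poly T} => size r) E1.
  rewrite size_scale // size_mul // => ->.
  have := d0; rewrite -size_poly_eq0.
  case: (size (gcdp P g)) => [|[|k]] //= _.
  by rewrite addnS /= addnS ltnNge leq_addr.
have /Bezout_coprimepP [[u v] /= /eqpP [[c1 c2] /= /andP[_ c2n0] bez]] := cop.
(* Pseudo-division by [P]: the remainder vanishes at [a] and is smaller than [P], hence is zero. *)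
have kerP p : ev p = 0 -> lead_coef P ^+ scalp p P *: p = (p %/ P) * P.
  move=> pa; have := Pdiv.Idomain.divp_eq p P.
  suff -> : p %% P = 0 by rewrite addr0.
  apply: minP; last by rewrite ltn_modp.
  have := congr1 ev (Pdiv.Idomain.divp_eq p P).
  by rewrite poly_evalD -mul_polyC !poly_evalM Pa pa !mulr0 add0r => <-.
exists (lead_coef P * c2); split.
  by rewrite mulf_neq0 // lead_coef_eq0.
move=> phi hphi; rewrite rmorphM mulf_eq0 negb_or => /andP[lP phic2].
have /closed_rootP [x /eqP Px] : size (map_poly phi P) != 1.
  by rewrite size_map_poly_id0 // gtn_eqF.
have gx : poly_eval phi x g != 0.
  have := congr1 (poly_eval phi x) bez.
  rewrite -!mul_polyC !(poly_evalM, poly_evalD) !poly_evalC [poly_eval phi x P]Px.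
  rewrite rmorph1 mulr1 mulr0 add0r => E.
  by apply: contraNneq phic2 => gx; rewrite -E gx !mulr0.
move: (gx); rewrite poly_evalM mulf_eq0 negb_or => /andP[qx dPx].
have lPk k : phi (lead_coef P ^+ k) != 0 by rewrite rmorphXn expf_neq0.
exists x; split=> // [p pa|delta hd].
  have := congr1 (poly_eval phi x) (kerP p pa).
  rewrite -mul_polyC !poly_evalM [poly_eval phi x P]Px mulr0 poly_evalC => /eqP.
  by rewrite mulf_eq0 (negbTE (lPk _)) => /eqP.
(* The value for which the extended tangent vector kills [P]. *)
pose y := - (map_poly delta P).[x] / poly_eval phi x P^`().
have Py : poly_tangent phi delta x y P = 0.
  rewrite /poly_tangent deriv_map -/(poly_eval phi x P^`()) /y.
  by rewrite mulrC divfK // addrN.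
exists y => p pa.
have px : poly_eval phi x p = 0.
  have := congr1 (poly_eval phi x) (kerP p pa).
  rewrite -mul_polyC !poly_evalM [poly_eval phi x P]Px mulr0 poly_evalC => /eqP.
  by rewrite mulf_eq0 (negbTE (lPk _)) => /eqP.
have := congr1 (poly_tangent phi delta x y) (kerP p pa).
rewrite -mul_polyC !(poly_tangentM hd) Py px [poly_eval phi x P]Px !mulr0 !addr0.
rewrite poly_evalC => /eqP.
by rewrite mulf_eq0 (negbTE (lPk _)) => /eqP.
Qed.

Lemma liftable_exists q : ev q != 0 -> exists t, liftable q t.
Proof.
case: (pselect (exists2 p, p != 0 & ev p = 0)); first exact: liftable_algebraic.
move=> tr; apply: liftable_transcendental => p pa.
by apply: contrapT => /eqP p0; apply: tr; exists p.
Qed.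

End LiftPoint.

Section PolyEvalMorphism.
Variables (T S : comNzRingType) (phi : {rmorphism T -> S}) (x : S).

Lemma poly_eval_morphism : exists g : {rmorphism {poly T} -> S}, g =1 poly_eval phi x.
Proof.
apply: rmorphism_of_fun; [exact: poly_evalD | exact: poly_evalM |].
by rewrite -polyC1 poly_evalC rmorph1.
Qed.
End PolyEvalMorphism.

Section Tower.
Variables (R : realType) (K : idomainType).
Local Notation C := R[i].

(* [T] embeds into an extension of [T] inside [K] containing [l], and almost   *)
(* every point of [T] lifts to it together with all the tangent vectors.       *)
Definition extends_points (T : idomainType) (j : {rmorphism C -> T})
    (e : {rmorphism T -> K}) (l : seq K) : Prop :=
  exists (T' : idomainType) (k : {rmorphism T -> T'}) (e' : {rmorphism T' -> K}),
  [/\ injective e', forall x, e' (k x) = e x, forall a, a \in l -> exists a', e' a' = a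
    & forall t', t' != 0 -> exists t, t != 0 /\
      forall phi : {rmorphism T -> C}, is_point j phi -> phi t != 0 ->
      exists phi' : {rmorphism T' -> C}, [/\ forall x, phi' (k x) = phi x, phi' t' != 0
      & forall delta, tangent j phi delta -> exists2 delta',
          tangent (k \o j) phi' delta' & forall x, delta' (k x) = delta x]].

(** The extension is T[a] inside [K]. Points and tangent vectors are computed on chosen polynomial
    representatives; the choice is immaterial because, by [liftable], both vanish on the relations
    of [a]. *)
Lemma extends_points1 (T : idomainType) (j : {rmorphism C -> T})
    (e : {rmorphism T -> K}) (a : K) : injective e -> extends_points j e [:: a].
Proof.
move=> e_inj; pose ev := poly_eval e a.
have hP : subring_pred (fun x => exists q, x = ev q).
  split=> [|_ _ [p ->] [q ->]|_ _ [p ->] [q ->]].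
  - by exists 1; rewrite -polyC1 /ev poly_evalC rmorph1.
  - by exists (p - q); rewrite /ev poly_evalB.
  - by exists (p * q); rewrite /ev poly_evalM.
pose T' := subdomain hP; pose e' := subdomain_incl hP.
have kP x : exists q, e x = ev q by exists x%:P; rewrite /ev poly_evalC.
have e'K x (Px : exists q, x = ev q) : e' (subdomain_elt hP Px) = x by [].
have e'_inj : injective e' by exact: subdomain_incl_inj.
have [k kE] : exists k : {rmorphism T -> T'}, k =1 fun x => subdomain_elt hP (kP x).
  apply: rmorphism_of_fun => [x y|x y|]; apply: e'_inj.
  - by rewrite [RHS]rmorphD; exact: (rmorphD e).
  - by rewrite [RHS]rmorphM; exact: (rmorphM e).
  - by rewrite [RHS]rmorph1; exact: (rmorph1 e).
have e'k x : e' (k x) = e x by rewrite kE e'K.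
have /choice [rep repE] : forall z : T', exists q, e' z = ev q.
  by move=> z; exact: (@subdomain_inclP K _ hP z).
exists T', k, e'; split=> // [b|t' t'0].
  rewrite inE => /eqP->; have Pa : exists q, a = ev q by exists 'X; rewrite /ev poly_evalX.
  by exists (subdomain_elt hP Pa).
have [|t [t0 tP]] := @liftable_exists R K T j e a e_inj (rep t').
  by rewrite -/ev -repE -(rmorph0 e') (inj_eq e'_inj).
exists t; split=> // phi hphi /(tP phi hphi) [x [x1 x2 x3]].
have phiE p q : ev p = ev q -> poly_eval phi x p = poly_eval phi x q.
  move=> pq; apply/eqP; rewrite -subr_eq0 -poly_evalB x1 //.
  by rewrite poly_evalB [poly_eval e a p]pq subrr.
have repD y z : ev (rep (y + z)) = ev (rep y + rep z).
  by rewrite -repE /ev poly_evalD -!/(ev _) -!repE rmorphD.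
have repM y z : ev (rep (y * z)) = ev (rep y * rep z).
  by rewrite -repE /ev poly_evalM -!/(ev _) -!repE rmorphM.
have repk y : ev (rep (k y)) = ev y%:P by rewrite -repE e'k /ev poly_evalC.
have [phi' phi'E] : exists phi' : {rmorphism T' -> C},
    phi' =1 fun z => poly_eval phi x (rep z).
  apply: rmorphism_of_fun => [y z|y z|].
  - by rewrite (phiE _ _ (repD y z)) poly_evalD.
  - by rewrite (phiE _ _ (repM y z)) poly_evalM.
  - by rewrite -[X in rep X](rmorph1 k) (phiE _ _ (repk 1)) poly_evalC rmorph1.
exists phi'; split=> [z||delta hd].
- by rewrite phi'E (phiE _ _ (repk z)) poly_evalC.
- by rewrite phi'E.
have [y yP] := x3 _ hd; pose L := poly_tangent phi delta x y.
have LE p q : ev p = ev q -> L p = L q.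
  move=> pq; rewrite -[p](subrK q) /L (poly_tangentD hd) yP ?add0r //.
  by rewrite poly_evalB [poly_eval e a p]pq subrr.
exists (L \o rep) => [|z] /=; last by rewrite (LE _ _ (repk z)) /L (poly_tangentC hd).
split=> [u v|u v|c] /=.
- by rewrite (LE _ _ (repD u v)) /L (poly_tangentD hd).
- by rewrite (LE _ _ (repM u v)) /L (poly_tangentM hd) !phi'E.
- by rewrite (LE _ _ (repk _)) /L (poly_tangentC hd) (tangentC hd).
Qed.

Lemma extends_points_seq (T : idomainType) (j : {rmorphism C -> T})
    (e : {rmorphism T -> K}) (l : seq K) : injective e -> extends_points j e l.
Proof.
elim: l T j e => [|a l IH] T j e e_inj.
  exists T, idfun, e; split=> // t t0; exists t; split=> // phi _ phit.
  by exists phi; split=> // delta hd; exists delta.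
have [T1 [k1 [e1 [e1_inj e1k hl ht]]]] := extends_points1 j a e_inj.
have [T2 [k2 [e2 [e2_inj e2k hl2 ht2]]]] := IH T1 (k1 \o j) e1 e1_inj.
exists T2, (k2 \o k1), e2; split=> // [x|b|t2 t20] /=.
- by rewrite e2k e1k.
- rewrite inE => /orP[/eqP->|/hl2//].
  by have [a' <-] := hl a (mem_head _ _); exists (k2 a'); rewrite e2k.
have [t1 [t10 h1]] := ht2 _ t20; have [t [t0 h]] := ht _ t10.
exists t; split=> // phi hphi /(h phi hphi) [phi1 [p1 p2 p3]].
have hphi1 : is_point (k1 \o j) phi1 by move=> c /=; rewrite p1 hphi.
have [phi2 [q1 q2 q3]] := h1 phi1 hphi1 p2.
exists phi2; split=> // [x|delta /p3 [d1 hd1 d1E]] /=; first by rewrite q1 p1.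
have [d2 hd2 d2E] := q3 _ hd1; exists d2 => [|x] /=; last by rewrite d2E d1E.
by case: hd2 => a1 a2 a3; split.
Qed.

End Tower.

Lemma mmap_in_image (R : realType) (T K : comNzRingType) (e : {rmorphism T -> K})
    (j : {rmorphism R[i] -> T}) (n : nat) (a : 'I_n -> T) (p : {mpoly R[i][n]}) :
  mmap (e \o j) (e \o a) p = e (mmap j a p).
Proof.
rewrite /mmap rmorph_sum; apply: eq_bigr => m _.
rewrite rmorphM /mmap1 rmorph_prod; congr (_ * _).
by apply: eq_bigr => i _; rewrite rmorphXn.
Qed.

Section Points.
Variables (R : realType) (A : idomainType) (iota : {rmorphism R[i] -> A}).
Local Notation C := R[i].

(** The tower over C generated by the generators of [A] is all of [A], and the identity is a point
    of C at which every nonzero constant is nonzero; lift that point. *)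
Lemma finite_type_point : finite_type iota -> forall h : A, h != 0 ->
  exists2 ev : {rmorphism A -> C}, is_point iota ev & ev h != 0.
Proof.
move=> [n [a aP]] h h0.
have iota_inj : injective iota by exact: fmorph_inj.
have [T [k [e [e_inj ek hl ht]]]] :=
  extends_points_seq (idfun : {rmorphism C -> C}) (codom a) iota_inj.
have /choice [b bE] : forall i, exists b, e b = a i.
  by move=> i; apply: hl; exact: codom_f.
have /choice [s sK] : forall x : A, exists y, e y = x.
  move=> x; have [p ->] := aP x; exists (mmap k b p).
  rewrite -mmap_in_image; apply: eq_bigr => m _.
  rewrite /= ek; congr (_ * _); rewrite /mmap1.
  by apply: eq_bigr => i _; rewrite /= bE.
have sh0 : s h != 0 by rewrite -(inj_eq e_inj) sK rmorph0.
have [t [t0 /(_ idfun) []//]] := ht _ sh0.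
move=> phi [p1 p2 _].
have [ev evE] : exists ev : {rmorphism A -> C}, ev =1 phi \o s.
  have sE x y : e y = x -> s x = y by move=> <-; apply: e_inj; rewrite sK.
  apply: rmorphism_of_fun => [x y|x y|] /=.
  - by rewrite -rmorphD; congr (phi _); apply: sE; rewrite rmorphD !sK.
  - by rewrite -rmorphM; congr (phi _); apply: sE; rewrite rmorphM !sK.
  - by rewrite -(rmorph1 phi); congr (phi _); apply: sE; rewrite rmorph1.
exists ev; last by rewrite evE.
move=> c; rewrite evE /=.
by have -> : s (iota c) = k c; [apply: e_inj; rewrite sK ek | rewrite p1].
Qed.

End Points.

Local Open Scope quotient_scope.

Lemma fractionP (A : idomainType) (z : {fraction A}) :
  exists p q : A, q != 0 /\ z = tofrac p / tofrac q.
Proof.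
elim/quotW: z => x; exists x.1, x.2.
have x2 := denom_ratioP x; split=> //.
apply: (@mulIf _ (tofrac x.2)); first by rewrite tofrac_eq0.
rewrite divfK ?tofrac_eq0 // -[LHS]/(FracField.mul _ _).
unlock FracField.tofrac; rewrite !piE; apply/eqmodP.
by rewrite /= FracField.equivfE /FracField.mulf !numden_Ratio ?mulr1 ?oner_neq0 // mulrC.
Qed.

(** * Prime ideals and the Nullstellensatz *)

Section PrimeIdeals.
Variable T : comNzRingType.

Definition prime_ideal (P : T -> Prop) : Prop :=
  [/\ P 0, ~ P 1, forall a b, P a -> P b -> P (a - b), forall a b, P b -> P (a * b)
    & forall a b, P (a * b) -> P a \/ P b].

Definition prime_mem (P : T -> Prop) of prime_ideal P : pred T := fun x => `[< P x >].

Lemma prime_mem_closed P (hP : prime_ideal P) : idealr_closed (prime_mem hP).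
Proof.
have [h0 h1 hB hM _] := hP; split=> [||a u v]; rewrite /prime_mem !unfold_in.
- exact/asboolP.
- exact/asboolP.
move=> /asboolP hu /asboolP hv; apply/asboolP.
rewrite -[v]opprK; apply: (hB); first exact: hM.
by rewrite -[- v]add0r; apply: hB.
Qed.

HB.instance Definition _ P (hP : prime_ideal P) :=
  isIdealr.Build T (prime_mem hP) (prime_mem_closed hP).

Lemma prime_ideal_domain (P : T -> Prop) : prime_ideal P ->
  exists (A : idomainType) (g : {rmorphism T -> A}),
    (forall a, exists p, a = g p) /\ forall p, g p = 0 <-> P p.
Proof.
move=> hP; pose Q := {ideal_quot (prime_mem hP : idealr T)}.
have piP p : (\pi_Q p = 0) <-> P p.
  rewrite -(rmorph0 (\pi_Q : {rmorphism _ -> _})).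
  split=> [/eqP|Pp].
    by rewrite -Quotient.idealrBE subr0 => /asboolP.
  by apply/eqP; rewrite -Quotient.idealrBE subr0; apply/asboolP.
have Q_integral (a b : Q) : a * b = 0 -> a = 0 \/ b = 0.
  elim/quotW: a => p; elim/quotW: b => q.
  have [_ _ _ _ h] := hP; rewrite -rmorphM => /piP /h [] ?; [left|right]; exact/piP.
exists (classical_domain Q_integral), (\pi_Q : {rmorphism T -> Q}); split=> //.
by move=> a; exists (repr (a : Q)); apply: esym; exact: (reprK (a : Q)).
Qed.

End PrimeIdeals.

Section Nullstellensatz.
Variables (R : realType) (n : nat).
Local Notation C := R[i].

(** A point of the domain C[h]/P where [h] is nonzero is given by the images of the coordinates. *)
Lemma prime_ideal_zero (P : {mpoly C[n]} -> Prop) (h : {mpoly C[n]}) :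
  prime_ideal P -> ~ P h ->
  exists2 v : 'cV[C]_n, forall p, P p -> p.@[fun i => v i 0] = 0 & h.@[fun i => v i 0] != 0.
Proof.
move=> hP Ph; have [A [g [g_surj gP]]] := prime_ideal_domain hP.
pose iota : {rmorphism C -> A} := g \o @mpolyC n C.
have mmapE p : mmap iota (fun i => g 'X_i) p = g p.
  elim/mpoly_alg_ind: p => [c|i|p q IHp IHq|p q IHp IHq].
  - by rewrite mmapC.
  - by rewrite mmapX mmap1U.
  - by rewrite !rmorphD /= IHp IHq.
  - by rewrite !rmorphM /= IHp IHq.
have ft : finite_type iota.
  exists n, (fun i => g 'X_i) => b; have [p ->] := g_surj b.
  by exists p; rewrite mmapE.
have [|ev hev evh] := finite_type_point ft (h := g h).
  by apply/eqP => /gP.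
have evE p : ev (g p) = p.@[fun i => (\col_j ev (g 'X_j)) i 0].
  elim/mpoly_alg_ind: p => [c|i|p q IHp IHq|p q IHp IHq].
  - by rewrite mevalC; exact: hev.
  - by rewrite mevalXU mxE.
  - by rewrite !rmorphD /= IHp IHq.
  - by rewrite !rmorphM /= IHp IHq.
exists (\col_j ev (g 'X_j)) => [p /gP gp|]; last by rewrite -evE.
by rewrite -evE gp rmorph0.
Qed.

End Nullstellensatz.

(** * The function field of a smooth curve has transcendence degree at most one *)

Section CurveDependence.
Variables (R : realType) (A : idomainType) (iota : {rmorphism R[i] -> A}).
Local Notation C := R[i].
Local Notation K := {fraction A}.
Local Notation tofrac := (@tofrac A).
Let iotaK : {rmorphism C -> K} := tofrac \o iota.

Lemma tofrac_inj : injective tofrac.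
Proof. by move=> a b /eqP; rewrite tofrac_eq => /eqP. Qed.

(** If [z1] and [z2] were independent, a general point of the plane would lift, with both tangent
    directions, to a ring containing [A]. As the cotangent space of [A] at the image point is a
    line, some nonzero combination of the two directions kills [A], hence also the fractions [z1]
    and [z2], which are the coordinates of the plane. *)
Lemma smooth_curve_dependence (z1 z2 : K) : smooth_affine_curve iota ->
  exists2 q : {poly {poly C}}, q != 0 & (map_poly (poly_eval iotaK z1) q).[z2] = 0.
Proof.
move=> [[n [a aP]] cot]; apply: contrapT => indep.
have [e1 e1E] := poly_eval_morphism iotaK z1.
have [e eE] := poly_eval_morphism e1 z2.
have e_inj : injective e.
  move=> p q pq; apply/eqP; rewrite -subr_eq0; apply: contrapT => /negP pq0; apply: indep.
  exists (p - q) => //; rewrite -(eq_map_poly e1E) -/(poly_eval e1 z2 _) -eE.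
  by rewrite rmorphB pq subrr.
pose T : idomainType := {poly {poly C}}.
pose j : {rmorphism C -> T} := @polyC {poly C} \o @polyC C.
have ej c : e (j c) = iotaK c by rewrite eE /= poly_evalC e1E poly_evalC.
have [T' [k [e' [e'_inj e'k hl ht]]]] :=
  extends_points_seq j (codom (tofrac \o a)) (e_inj : injective (e : {rmorphism T -> K})).
have /choice [b bE] : forall i, exists b, e' b = tofrac (a i).
  by move=> i; apply: hl; exact: (codom_f (tofrac \o a)).
have /choice [s sK] : forall x : A, exists y, e' y = tofrac x.
  move=> x; have [p ->] := aP x; exists (mmap (k \o j) b p).
  rewrite -mmap_in_image -[RHS]mmap_in_image; apply: eq_bigr => m _.
  rewrite /= e'k ej; congr (_ * _); rewrite /mmap1.
  by apply: eq_bigr => i _; rewrite /= bE.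
have sE x y : e' y = tofrac x -> s x = y by move=> h; apply: e'_inj; rewrite sK h.
have [p1 [q1 [q10 z1E]]] := fractionP z1.
have [p2 [q2 [q20 z2E]]] := fractionP z2.
(* The denominators must survive at the lifted point, for the quotient rule in [vanish]. *)
have sq0 : s (q1 * q2) != 0.
  by rewrite -(inj_eq e'_inj) sK rmorph0 tofrac_eq0 mulf_neq0.
have [t [t0 tP]] := ht _ sq0.
(* A point of the plane off the zeros of [t]: [x1] avoids the roots of the leading coefficient, then
   [x2] those of the specialisation. *)
have [x1 /(_ 0%N) hx1] := @poly_avoid R (fun _ => lead_coef t)
  (fun _ => etrans (congr1 negb (lead_coef_eq0 t)) t0).
have [f1 f1E] := poly_eval_morphism (idfun : {rmorphism C -> C}) x1.
have f1lt : f1 (lead_coef t) != 0 by rewrite f1E /poly_eval map_poly_id.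
have [|x2 /(_ 0%N) hx2] := @poly_avoid R (fun _ => map_poly f1 t).
  move=> _; apply: contraNneq f1lt => /(congr1 (fun r : {poly C} => r`_(size t).-1)).
  by rewrite coef_map coef0 /lead_coef => ->.
have [f fE] := poly_eval_morphism f1 x2.
have fj : is_point j f by move=> c; rewrite fE poly_evalC f1E poly_evalC.
have [|phi [phik phi0 phid]] := tP f fj; first by rewrite fE.
have d0 : tangent (idfun : {rmorphism C -> C}) (idfun : {rmorphism C -> C}) (fun _ => 0).
  by split=> *; rewrite ?addr0 ?mulr0 ?mul0r ?addr0.
have tan y1 y2 : exists2 delta, tangent (k \o j) phi delta &
    delta (k 'X) = y2 /\ delta (k 'X%:P) = y1.
  pose d1 := poly_tangent (idfun : {rmorphism C -> C}) (fun _ => 0) x1 y1.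
  have hd1 : @tangent R {poly C} (@polyC C) f1 d1.
    split=> [u v|u v|c].
    - exact: (poly_tangentD d0).
    - by rewrite !f1E; exact: (poly_tangentM d0).
    - exact: (poly_tangentC d0).
  have hd2 : tangent j f (poly_tangent f1 d1 x2 y2).
    split=> [u v|u v|c].
    - exact: (poly_tangentD hd1).
    - by rewrite !fE; exact: (poly_tangentM hd1).
    - by rewrite /j /= (poly_tangentC hd1) (tangentC hd1).
  have [delta h1 h2] := phid _ hd2; exists delta => //; rewrite !h2; split.
    have := poly_tangentXM hd1 x2 y2 1; rewrite mulr1 => ->.
    by rewrite -polyC1 (poly_tangentC hd1) -polyC1 (tangentC hd1) poly_evalC rmorph1 mulr0 mulr1 add0r.
  rewrite (poly_tangentC hd1) /d1; have := poly_tangentXM d0 x1 y1 1; rewrite mulr1 => ->.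
  by rewrite -polyC1 (poly_tangentC d0) poly_evalC mulr0 mulr1 add0r.
have [d1 hd1 [d1X2 d1X1]] := tan 1 0.
have [d2 hd2 [d2X2 d2X1]] := tan 0 1.
have vanish d : tangent (k \o j) phi d -> (forall x, d (s x) = 0) ->
    d (k 'X) = 0 /\ d (k 'X%:P) = 0.
  move=> hd ds; move: phi0; rewrite (sE (q1 * q2) (s q1 * s q2)); last first.
    by rewrite !rmorphM !sK.
  rewrite rmorphM mulf_eq0 negb_or => /andP[ph1 ph2].
  have quot z p q : phi (s q) != 0 -> e' z = tofrac p / tofrac q -> d z = 0.
    move=> phq zE; have q0 : q != 0.
      by apply: contraNneq phq => ->; rewrite (sE _ 0) ?rmorph0.
    have : d (z * s q) = 0.
      rewrite -(sE p (z * s q)) ?ds //.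
      by rewrite rmorphM zE sK divfK // tofrac_eq0.
    rewrite (tangentM hd) ds mulr0 add0r => /eqP.
    by rewrite mulf_eq0 (negbTE phq) orbF => /eqP.
  split; [apply: (quot _ p2 q2) | apply: (quot _ p1 q1)] => //; rewrite e'k -?z1E -?z2E eE.
    by rewrite poly_evalX.
  by rewrite poly_evalC e1E poly_evalX.
have [ev evE] : exists ev : {rmorphism A -> C}, ev =1 phi \o s.
  apply: rmorphism_of_fun => [x y|x y|] /=.
  - by rewrite -rmorphD; congr (phi _); apply: sE; rewrite !rmorphD !sK.
  - by rewrite -rmorphM; congr (phi _); apply: sE; rewrite !rmorphM !sK.
  - by rewrite -(rmorph1 phi); congr (phi _); apply: sE; rewrite !rmorph1.
have si c : s (iota c) = k (j c) by apply: sE; rewrite e'k ej.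
have hev : is_point iota ev by move=> c; rewrite evE /= si phik fj.
have [tau [_ _ tauP]] := cot _ hev.
have sD x y : s (x + y) = s x + s y by apply: sE; rewrite !rmorphD !sK.
have sM x y : s (x * y) = s x * s y by apply: sE; rewrite !rmorphM !sK.
have line x : exists c, forall d, tangent (k \o j) phi d -> d (s x) = c * d (s tau).
  have [|c [u [uP /eqP]]] := tauP (x - iota (ev x)).
    by rewrite rmorphB /= hev subrr.
  rewrite !subr_eq => /eqP xE; exists c => d hd; rewrite xE !sD !(tangentD hd) sM.
  rewrite !si (tangentC hd) (tangentM hd) (tangentC hd) mul0r !addr0.
  rewrite phik fj; set S := \sum_(_ <- _) _.
  suff -> : d (s S) = 0 by rewrite add0r.
  rewrite /S; elim: u uP {xE S} => [|v u IH] uP.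
    by rewrite big_nil -(rmorph0 iota) si (tangentC hd).
  rewrite big_cons sD sM (tangentD hd) (tangentM hd) IH => [|w wu]; last first.
    by apply: uP; rewrite inE wu orbT.
  have [] := uP v (mem_head _ _); rewrite !evE /= => -> ->.
  by rewrite mulr0 mul0r !addr0.
(* By [line] this combination kills [A], hence the second coordinate, where its value is - d1(tau).
   So d1(tau) = 0 and [d1] itself kills [A], against its value 1 on the first coordinate. *)
pose d x := d2 (s tau) * d1 x - d1 (s tau) * d2 x.
have hd : tangent (k \o j) phi d.
  split=> [x y|x y|c]; rewrite /d.
  - by rewrite (tangentD hd1) (tangentD hd2); ring.
  - by rewrite (tangentM hd1) (tangentM hd2); ring.
  - by rewrite (tangentC hd1) (tangentC hd2) !mulr0 subrr.
have [|dX2 dX1] := vanish d hd.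
  by move=> x; have [c cP] := line x; rewrite /d (cP _ hd1) (cP _ hd2); ring.
have d1tau : d1 (s tau) = 0.
  by apply/eqP; rewrite -oppr_eq0 -dX2 /d d1X2 d2X2 mulr0 mulr1 sub0r.
have [|_] := vanish d1 hd1.
  by move=> x; have [c cP] := line x; rewrite (cP _ hd1) d1tau mulr0.
by rewrite d1X1 => /eqP; rewrite oner_eq0.
Qed.

End CurveDependence.

(** * The rational Cherednik algebra *)

Section LinearForms.
Variables (R : realType) (n : nat).
Local Notation C := R[i].

Definition linear_form (x : 'rV[C]_n) : {mpoly C[n]} := \sum_i x 0 i *: 'X_i.

Lemma linear_form_linear : linear linear_form.
Proof.
move=> a x x'; rewrite /linear_form scaler_sumr -big_split /=.
by apply: eq_bigr => i _; rewrite !mxE scalerDl scalerA.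
Qed.
HB.instance Definition _ := GRing.isLinear.Build C 'rV[C]_n {mpoly C[n]} _
  linear_form linear_form_linear.

Lemma linear_form_delta i : linear_form (delta_mx 0 i) = 'X_i.
Proof.
rewrite /linear_form (bigD1 i) //= big1 => [|j ji].
  by rewrite mxE !eqxx scale1r addr0.
by rewrite mxE (negbTE ji) andbF scale0r.
Qed.

Lemma mmap_linear_form (B : comNzRingType) (iota : {rmorphism C -> B}) (f : 'cV[B]_n) x :
  mmap iota (fun i => f i 0) (linear_form x) = pairing f (map_mx iota x).
Proof.
rewrite rmorph_sum /pairing mxE; apply: eq_bigr => i _ /=.
by rewrite mmapZ mmapX mmap1U mxE.
Qed.

Lemma meval_linear_form (v : 'cV[C]_n) x :
  (linear_form x).@[fun i => v i 0] = pairing v x.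
Proof.
rewrite /pairing mxE /linear_form raddf_sum /=.
by apply: eq_bigr => i _; rewrite mevalZ mevalXU.
Qed.

Definition directional (y : 'cV[C]_n) (p : {mpoly C[n]}) := \sum_i y i 0 *: p^`M(i).

Lemma directionalD y p q : directional y (p + q) = directional y p + directional y q.
Proof. by rewrite -big_split; apply: eq_bigr => i _; rewrite mderivD scalerDr. Qed.
Lemma directionalM y p q :
  directional y (p * q) = directional y p * q + p * directional y q.
Proof.
rewrite mulr_suml mulr_sumr -big_split; apply: eq_bigr => i _.
by rewrite mderivM scalerDr scalerAl scalerAr.
Qed.
Lemma directionalC y c : directional y c%:MP = 0.
Proof. by rewrite /directional big1 // => i _; rewrite mderivC scaler0. Qed.
Lemma mderiv_var (i j : 'I_n) : 'X_i^`M(j) = (i == j)%:R :> {mpoly C[n]}.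
Proof.
rewrite mderivX mnm1E; case: eqP => [->|_]; last by rewrite scale0r.
have -> : (U_(j) - U_(j) = 0 :> 'X_{1..n})%MM.
  by apply/mnmP => k; rewrite mnmBE subnn mnm0E.
by rewrite scale1r mpolyX0.
Qed.
Lemma directionalX y i : directional y 'X_i = (y i 0)%:MP.
Proof.
rewrite /directional (bigD1 i) //= mderiv_var eqxx big1 => [|j ji].
  by rewrite addr0 -mul_mpolyC mulr1.
by rewrite mderiv_var eq_sym (negbTE ji) scaler0.
Qed.

End LinearForms.

Section Algebra.
Variables (R : realType) (n : nat) (W : finGroupType).
Local Notation C := R[i].
Variable d : cherednik_datum R n W.
Local Notation H := (Hc d).
Local Notation rho := (rep d).
Local Notation hC := (hC d).
Local Notation hX := (hX d).
Local Notation hY := (hY d).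
Local Notation hW := (hW d).
Local Notation hPoly := (hPoly d).

Lemma hc_eq_class t u : hc_eq d t u -> hc_class d t = hc_class d u.
Proof. by move/hc_classP. Qed.

Lemma hCD a b : hC (a + b) = hC a + hC b.
Proof. by rewrite -hc_classD; apply: hc_eq_class; exact: hc_scalarD. Qed.
Lemma hCM a b : hC (a * b) = hC a * hC b.
Proof. by rewrite -hc_classM; apply: hc_eq_class; exact: hc_scalarM. Qed.
Lemma hC0 : hC 0 = 0. Proof. by []. Qed.
Lemma hC1 : hC 1 = 1. Proof. by []. Qed.
Lemma hCN a : hC (- a) = - hC a.
Proof. by apply: (addrI (hC a)); rewrite -hCD !subrr hC0. Qed.
Lemma hCB a b : hC (a - b) = hC a - hC b.
Proof. by rewrite hCD hCN. Qed.
Lemma hC_comm a (h : H) : hC a * h = h * hC a.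
Proof.
elim/hc_ind: h => t; rewrite -!hc_classM; apply: hc_eq_class.
exact: hc_scalar_central.
Qed.
Lemma hC_sum (J : Type) (r : seq J) (P : pred J) (F : J -> C) :
  hC (\sum_(j <- r | P j) F j) = \sum_(j <- r | P j) hC (F j).
Proof. exact: (big_morph hC hCD hC0). Qed.

Lemma hX_linear a x x' : hX (a *: x + x') = hC a * hX x + hX x'.
Proof. by rewrite -hc_classM -hc_classD; apply: hc_eq_class; exact: hc_linX. Qed.
Lemma hY_linear a y y' : hY (a *: y + y') = hC a * hY y + hY y'.
Proof. by rewrite -hc_classM -hc_classD; apply: hc_eq_class; exact: hc_linY. Qed.
Lemma hX0 : hX 0 = 0.
Proof.
have := hX_linear 1 0 0; rewrite scaler0 addr0 hC1 mul1r => /esym/eqP.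
by rewrite -subr_eq0 addrK => /eqP.
Qed.
Lemma hY0 : hY 0 = 0.
Proof.
have := hY_linear 1 0 0; rewrite scaler0 addr0 hC1 mul1r => /esym/eqP.
by rewrite -subr_eq0 addrK => /eqP.
Qed.
Lemma hXD x x' : hX (x + x') = hX x + hX x'.
Proof. by have := hX_linear 1 x x'; rewrite scale1r hC1 mul1r. Qed.
Lemma hYD y y' : hY (y + y') = hY y + hY y'.
Proof. by have := hY_linear 1 y y'; rewrite scale1r hC1 mul1r. Qed.
Lemma hXZ a x : hX (a *: x) = hC a * hX x.
Proof. by have := hX_linear a x 0; rewrite !addr0 hX0 addr0. Qed.
Lemma hYZ a y : hY (a *: y) = hC a * hY y.
Proof. by have := hY_linear a y 0; rewrite !addr0 hY0 addr0. Qed.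
Lemma hX_sum (F : 'I_n -> 'rV_n) : hX (\sum_i F i) = \sum_i hX (F i).
Proof. exact: (big_morph hX hXD hX0). Qed.
Lemma hY_sum (F : 'I_n -> 'cV_n) : hY (\sum_i F i) = \sum_i hY (F i).
Proof. exact: (big_morph hY hYD hY0). Qed.
Lemma hY_delta y : hY y = \sum_i hC (y i 0) * hY (delta_mx i 0).
Proof.
rewrite {1}[y](matrix_sum_delta y).
under eq_bigr do rewrite big_ord1.
by rewrite hY_sum; apply: eq_bigr => i _; rewrite hYZ.
Qed.
Lemma hX_delta x : hX x = \sum_i hC (x 0 i) * hX (delta_mx 0 i).
Proof.
rewrite {1}[x](matrix_sum_delta x) big_ord1.
by rewrite hX_sum; apply: eq_bigr => i _; rewrite hXZ.
Qed.

Lemma hW1 : hW 1%g = 1.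
Proof. by rewrite -hC1; apply: hc_eq_class; exact: hc_group1. Qed.
Lemma hWM w w' : hW (w * w')%g = hW w * hW w'.
Proof. by rewrite -hc_classM; apply: hc_eq_class; exact: hc_groupM. Qed.
Lemma hWV w : hW w * hW w^-1%g = 1.
Proof. by rewrite -hWM mulgV hW1. Qed.
Lemma hWX w x : hW w * hX x = hX (act_dual rho w x) * hW w.
Proof. by rewrite -!hc_classM; apply: hc_eq_class; exact: hc_WX. Qed.
Lemma hWY w y : hW w * hY y = hY (act_h rho w y) * hW w.
Proof. by rewrite -!hc_classM; apply: hc_eq_class; exact: hc_WY. Qed.
Lemma hXX x x' : hX x * hX x' = hX x' * hX x.
Proof. by rewrite -!hc_classM; apply: hc_eq_class; exact: hc_XX. Qed.
Lemma hYY y y' : hY y * hY y' = hY y' * hY y.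
Proof. by rewrite -!hc_classM; apply: hc_eq_class; exact: hc_YY. Qed.

(** Applied with [P h] saying that [h] preserves a given subset of a module. *)
Lemma hc_generated (P : H -> Prop) :
  (forall x, P (hX x)) -> (forall y, P (hY y)) -> (forall w, P (hW w)) ->
  (forall a, P (hC a)) -> (forall a b, P a -> P b -> P (a + b)) ->
  (forall a b, P a -> P b -> P (a * b)) -> forall h, P h.
Proof.
move=> PX PY PW PC PD PM; elim/hc_ind; elim=> [x|y|w|a|t Pt u Pu|t Pt u Pu] //.
- exact: PX.
- exact: PY.
- exact: PW.
- exact: PC.
- by rewrite hc_classD; apply: PD.
- by rewrite hc_classM; apply: PM.
Qed.

Let mon (m : 'X_{1..n}) : H := \prod_(i < n) hX (delta_mx 0 i) ^+ m i.

(** Over a fixed range of monomials the sum is additive term by term, whereas [msupp] varies with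
    the polynomial. *)
Lemma hPoly_bounded (p : {mpoly C[n]}) k : (msize p <= k)%N ->
  hPoly p = \sum_(m : 'X_{1..n < k}) hC p@_m * mon m.
Proof.
move=> le_pk; rewrite /hPoly; pose I : subFinType _ := 'X_{1..n < k}.
rewrite (big_mksub I) ?msupp_uniq //=; first last.
  by move=> x /msize_mdeg_lt /leq_trans; apply.
by rewrite big_rmcond //= => j /memN_msupp_eq0 ->; rewrite hC0 mul0r.
Qed.

Lemma hPolyD p q : hPoly (p + q) = hPoly p + hPoly q.
Proof.
pose k := maxn (msize (p + q)) (maxn (msize p) (msize q)).
rewrite !(@hPoly_bounded _ k) ?leq_max ?leqnn ?orbT // -big_split /=.
by apply: eq_bigr => m _; rewrite mcoeffD hCD mulrDl.
Qed.

Lemma hPolyZ a p : hPoly (a *: p) = hC a * hPoly p.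
Proof.
pose k := maxn (msize (a *: p)) (msize p).
rewrite !(@hPoly_bounded _ k) ?leq_max ?leqnn ?orbT // mulr_sumr.
by apply: eq_bigr => m _; rewrite mcoeffZ hCM mulrA.
Qed.

Lemma hPoly_mon m : hPoly 'X_[m] = mon m.
Proof. by rewrite /hPoly msuppX big_seq1 mcoeffX eqxx hC1 mul1r. Qed.

Lemma hPoly0 : hPoly 0 = 0.
Proof. by rewrite -(scale0r 0) hPolyZ hC0 mul0r. Qed.

Lemma mon_varM i m : mon (U_(i) + m) = hX (delta_mx 0 i) * mon m.
Proof.
rewrite /mon; move: (mem_index_enum i) (index_enum_uniq 'I_n).
elim: (index_enum _) => // j s IH; rewrite inE !big_cons.
case: (eqVneq i j) => [<- _ /= /andP[is_ _]|ij /= i_s /andP[_ us]].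
  rewrite mnmDE mnm1E eqxx add1n exprS mulrA; congr (_ * _).
  rewrite !big_seq; apply: eq_bigr => k ks; rewrite mnmDE mnm1E.
  by case: eqP => // ik; rewrite ik ks in is_.
rewrite mnmDE mnm1E (negbTE ij) add0n IH // !mulrA; congr (_ * _).
by elim: (m j) => [|l IHl]; rewrite ?expr0 ?mul1r ?mulr1 // exprS -mulrA IHl !mulrA hXX.
Qed.

Lemma hPolyC c : hPoly c%:MP = hC c.
Proof.
rewrite -[_%:MP]mulr1 mul_mpolyC hPolyZ -mpolyX0 hPoly_mon /mon big1 ?mulr1 //.
by move=> i _; rewrite mnm0E expr0.
Qed.

Lemma hPolyX i : hPoly 'X_i = hX (delta_mx 0 i).
Proof.
rewrite hPoly_mon -[U_(i)%MM]addm0 mon_varM -hPoly_mon mpolyX0.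
by rewrite -mpolyC1 hPolyC hC1 mulr1.
Qed.

Lemma hPolyM p q : hPoly (p * q) = hPoly p * hPoly q.
Proof.
elim/mpoly_alg_ind: p q => [c q|i q|p1 p2 IH1 IH2 q|p1 p2 IH1 IH2 q].
- by rewrite mul_mpolyC hPolyZ hPolyC.
- elim/mpolyind: q => [|c m q _ _ IH]; first by rewrite mulr0 hPoly0 mulr0.
  rewrite mulrDr !hPolyD IH mulrDr; congr (_ + _).
  by rewrite -scalerAr -mpolyXD !hPolyZ hPolyX !hPoly_mon mon_varM !mulrA hC_comm.
- by rewrite mulrDl !hPolyD IH1 IH2 mulrDl.
- by rewrite -mulrA !IH1 IH2 mulrA.
Qed.

Lemma hPolyN p : hPoly (- p) = - hPoly p.
Proof. by rewrite -scaleN1r hPolyZ hCN mulNr hC1 mul1r. Qed.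
Lemma hPolyB p q : hPoly (p - q) = hPoly p - hPoly q.
Proof. by rewrite hPolyD hPolyN. Qed.
Lemma hPoly1 : hPoly 1 = 1.
Proof. by rewrite -mpolyC1 hPolyC. Qed.
Lemma hPoly_sum (J : Type) (r : seq J) (P : pred J) (F : J -> {mpoly C[n]}) :
  hPoly (\sum_(j <- r | P j) F j) = \sum_(j <- r | P j) hPoly (F j).
Proof. exact: (big_morph hPoly hPolyD hPoly0). Qed.

Lemma hPoly_linear_form x : hPoly (linear_form x) = hX x.
Proof.
by rewrite hPoly_sum hX_delta; apply: eq_bigr => i _; rewrite hPolyZ hPolyX.
Qed.

Lemma hPoly_comm p q : hPoly p * hPoly q = hPoly q * hPoly p.
Proof. by rewrite -!hPolyM mulrC. Qed.

End Algebra.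

Lemma mmap_comp (n : nat) (K S : comNzRingType) (iota : {rmorphism K -> S})
    (g : 'I_n -> S) (h : 'I_n -> {mpoly K[n]}) p :
  mmap iota g (mmap (@mpolyC n K) h p) = mmap iota (fun i => mmap iota g (h i)) p.
Proof.
elim/mpoly_alg_ind: p => [c|i|p q IHp IHq|p q IHp IHq].
- by rewrite !mmapC.
- by rewrite !mmapX !mmap1U.
- by rewrite [mmap _ h (p + q)]raddfD [LHS]raddfD /= IHp IHq [RHS]raddfD.
- by rewrite [mmap _ h (p * q)]rmorphM [LHS]rmorphM /= IHp IHq [RHS]rmorphM.
Qed.

Lemma meval_comp (n : nat) (K : comNzRingType) (g : 'I_n -> {mpoly K[n]}) p u :
  (mmap (@mpolyC n K) g p).@[u] = p.@[fun i => (g i).@[u]].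
Proof. exact: mmap_comp. Qed.

Section Commutation.
Variables (R : realType) (n : nat) (W : finGroupType).
Local Notation C := R[i].
Variable d : cherednik_datum R n W.
Local Notation H := (Hc d).
Local Notation rho := (rep d).
Local Notation hC := (hC d).
Local Notation hX := (hX d).
Local Notation hY := (hY d).
Local Notation hW := (hW d).
Local Notation hPoly := (hPoly d).
Local Notation refl := (reflections rho).
Local Notation root := (dual_root d).
Local Notation coroot := (coroot d).
Local Notation lambda := (eigen d).

Lemma rho1 : rho 1%g = 1%:M. Proof. exact: repr_mx1. Qed.
Lemma rhoM v w : rho (v * w)%g = rho v *m rho w.
Proof. by rewrite repr_mxM ?inE. Qed.
Lemma rhoVK w : rho w^-1%g *m rho w = 1%:M.
Proof. by rewrite -rhoM mulVg rho1. Qed.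
Lemma rhoKV w : rho w *m rho w^-1%g = 1%:M.
Proof. by rewrite -rhoM mulgV rho1. Qed.

Lemma pairing_act w y (x : 'rV[C]_n) :
  pairing y (act_dual rho w x) = pairing (act_h rho w^-1%g y) x.
Proof. by rewrite /pairing /act_dual /act_h mulmxA. Qed.
Lemma pairing_delta y i : pairing y (delta_mx 0 i : 'rV[C]_n) = y i 0.
Proof. by rewrite /pairing -rowE mxE. Qed.
Lemma pairing_mx (y : 'cV[C]_n) (x : 'rV[C]_n) : x *m y = (pairing y x)%:M.
Proof. by rewrite [LHS]mx11_scalar. Qed.

Section Reflection.
Variable s : W.
Hypothesis hs : s \in refl.

Lemma one_sub_eigen_neq0 : 1 - lambda s != 0.
Proof. by rewrite subr_eq0 eq_sym eigen_neq1. Qed.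

Lemma eigen_neq0 : lambda s != 0.
Proof.
apply/eqP => l0; have := act_coroot hs; rewrite l0 invr0 scale0r => h.
have c0 : coroot s = 0.
  by rewrite -[coroot s]mul1mx -(rhoVK s) -mulmxA -/(act_h rho s _) h mulmx0.
have := pairing_root hs; rewrite c0 /pairing mulmx0 mxE => /eqP.
by rewrite eq_sym pnatr_eq0.
Qed.

Lemma act_coroot_inv : act_h rho s^-1%g (coroot s) = lambda s *: coroot s.
Proof.
rewrite -[in LHS](scale1r (coroot s)) -(divff eigen_neq0) -scalerA.
rewrite -(act_coroot hs) /act_h -scalemxAr mulmxA rhoVK mul1mx.
by [].
Qed.

(* [1 - s^-1] has rank one and [alpha_s] spans its row space.                   *)
Lemma reflection_mx :
  1%:M - rho s^-1%g = ((1 - lambda s) / 2) *: (coroot s *m root s).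
Proof.
set N := 1%:M - _; have l1 := one_sub_eigen_neq0.
have rN : (\rank N <= 1)%N.
  have -> : N = rho s^-1%g *m (rho s - 1%:M).
    by rewrite mulmxBr rhoVK mulmx1.
  have := hs; rewrite inE => /eqP <-; exact: mxrankM_maxr.
have aN : root s *m N = (1 - lambda s) *: root s.
  by rewrite mulmxBr mulmx1 -/(act_dual rho s _) act_dual_root // scalerBl scale1r.
have a0 : root s != 0.
  apply/eqP => r0; have := pairing_root hs.
  by rewrite r0 /pairing mul0mx mxE => /eqP; rewrite eq_sym pnatr_eq0.
have aleN : (root s <= N)%MS.
  apply/submxP; exists ((1 - lambda s)^-1 *: root s).
  by rewrite -scalemxAl aN scalerA mulVf // scale1r.
have /submxP[D ND] : (N <= root s)%MS.
  by rewrite -(geq_leqif (mxrank_leqif_sup aleN)) (leq_trans rN) // lt0n mxrank_eq0.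
have : N *m coroot s = (1 - lambda s) *: coroot s.
  by rewrite mulmxBl mul1mx -/(act_h rho _ _) act_coroot_inv scalerBl scale1r.
rewrite ND -mulmxA pairing_mx (pairing_root hs) mul_mx_scalar => h.
have -> : D = ((1 - lambda s) / 2) *: coroot s.
  by rewrite mulrC -scalerA -h scalerA mulVf ?scale1r ?pnatr_eq0.
by rewrite -scalemxAl.
Qed.

Lemma act_dual_reflection x : x - act_dual rho s x =
  ((1 - lambda s) / 2 * pairing (coroot s) x) *: root s.
Proof.
rewrite /act_dual -[X in X - _]mulmx1 -mulmxBr reflection_mx -scalemxAr mulmxA.
by rewrite pairing_mx mul_scalar_mx scalerA.
Qed.

Lemma act_reflection_inv y : y - act_h rho s^-1%g y =
  ((1 - lambda s) / 2 * pairing y (root s)) *: coroot s.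
Proof.
rewrite /act_h -[X in X - _]mul1mx -mulmxBl reflection_mx -scalemxAl -mulmxA.
by rewrite pairing_mx mul_mx_scalar scalerA.
Qed.

Lemma reflection_fixes v : act_h rho s v = v <-> pairing v (root s) = 0.
Proof.
have E := act_reflection_inv v; split=> [sv|pv].
  have sv' : act_h rho s^-1%g v = v by rewrite -[in LHS]sv /act_h mulmxA rhoVK mul1mx.
  have c0 : coroot s != 0.
    apply/eqP => r0; have := pairing_root hs.
    by rewrite r0 /pairing mulmx0 mxE => /eqP; rewrite eq_sym pnatr_eq0.
  move: E; rewrite sv' subrr => /esym/eqP; rewrite scaler_eq0 (negbTE c0) orbF.
  rewrite !mulf_eq0 invr_eq0 pnatr_eq0 (negbTE one_sub_eigen_neq0) /=.
  by move/eqP.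
move: E; rewrite pv mulr0 scale0r => /eqP; rewrite subr_eq0 => /eqP E.
by rewrite [in LHS]E /act_h mulmxA rhoKV mul1mx.
Qed.
End Reflection.

Definition poly_act (w : W) : {mpoly C[n]} -> {mpoly C[n]} :=
  mmap (@mpolyC n C) (fun i => linear_form (act_dual rho w (delta_mx 0 i))).
HB.instance Definition _ w := GRing.RMorphism.on (poly_act w).

Lemma poly_actD w p q : poly_act w (p + q) = poly_act w p + poly_act w q.
Proof. exact: rmorphD. Qed.
Lemma poly_actM w p q : poly_act w (p * q) = poly_act w p * poly_act w q.
Proof. exact: rmorphM. Qed.
Lemma poly_actXn w p k : poly_act w (p ^+ k) = poly_act w p ^+ k.
Proof. exact: rmorphXn. Qed.
Lemma poly_actC w c : poly_act w c%:MP = c%:MP.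
Proof. exact: mmapC. Qed.
Lemma poly_actX w i : poly_act w 'X_i = linear_form (act_dual rho w (delta_mx 0 i)).
Proof. by rewrite /poly_act mmapX mmap1U. Qed.

Lemma poly_act_linear_form w x :
  poly_act w (linear_form x) = linear_form (act_dual rho w x).
Proof.
rewrite [in LHS]/linear_form rmorph_sum /= {2}[x](matrix_sum_delta x) big_ord1.
rewrite /act_dual mulmx_suml linear_sum; apply: eq_bigr => i _.
rewrite -mul_mpolyC poly_actM poly_actC poly_actX mul_mpolyC.
by rewrite -scalemxAl linearZ.
Qed.

Lemma meval_poly_act w p (v : 'cV[C]_n) :
  (poly_act w p).@[fun i => v i 0] = p.@[fun i => act_h rho w^-1%g v i 0].
Proof.
rewrite meval_comp; apply: meval_eq => i.
by rewrite meval_linear_form pairing_act pairing_delta.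
Qed.

Lemma hW_hPoly w p : hW w * hPoly p = hPoly (poly_act w p) * hW w.
Proof.
elim/mpoly_alg_ind: p => [c|i|p q IHp IHq|p q IHp IHq].
- by rewrite poly_actC !hPolyC hC_comm.
- by rewrite poly_actX hPoly_linear_form hPolyX hWX.
- by rewrite poly_actD !hPolyD mulrDr IHp IHq mulrDl.
- by rewrite poly_actM !hPolyM mulrA IHp -!mulrA IHq.
Qed.

Definition dunkl_coef (s : W) (y : 'cV[C]_n) : C :=
  param d s * pairing y (root s) * (2 / (1 - lambda s)).

(** The Dunkl commutation rule: [q s] is the divided difference (p - s p) / alpha_s, the same for
    all [y]. It holds on generators and propagates by a twisted Leibniz rule. *)
Lemma hY_hPoly p : exists q : W -> {mpoly C[n]},
  (forall s, s \in refl -> linear_form (root s) * q s = p - poly_act s p) /\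
  forall y, hY y * hPoly p = hPoly p * hY y + hPoly (directional y p)
    - \sum_(s in refl) hC (dunkl_coef s y) * hPoly (q s) * hW s.
Proof.
elim/mpoly_alg_ind: p => [c|i|p p' [q [q1 q2]] [q' [q1' q2']]|p p' [q [q1 q2]] [q' [q1' q2']]].
- exists (fun _ => 0); split=> [s _|y]; first by rewrite poly_actC mulr0 subrr.
  rewrite big1 ?subr0 => [|s _]; last by rewrite hPoly0 mulr0 mul0r.
  by rewrite directionalC hPoly0 addr0 hPolyC hC_comm.
- exists (fun s => ((1 - lambda s) / 2 * pairing (coroot s) (delta_mx 0 i))%:MP); split=> [s hs|y].
    rewrite poly_actX -linear_form_delta -linearB /= act_dual_reflection // linearZ /=.
    by rewrite mulrC mul_mpolyC.
  apply/eqP; rewrite -addrA addrC -subr_eq hPolyX hY_hX_commutator; apply/eqP.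
  rewrite directionalX hPolyC pairing_delta; congr (_ - _).
  apply: eq_bigr => s hs; rewrite hPolyC -hCM; congr (hC _ * _).
  rewrite /dunkl_coef; field.
  exact: one_sub_eigen_neq0.
- exists (fun s => q s + q' s); split=> [s hs|y].
    by rewrite mulrDr q1 // q1' // poly_actD opprD addrACA.
  rewrite directionalD !hPolyD mulrDr q2 q2' mulrDl [LHS]addrACA -opprD.
  rewrite -big_split; congr (_ - _); first exact: addrACA.
  by apply: eq_bigr => s _; rewrite hPolyD mulrDr mulrDl.
(* From p p' - s(p) s(p') = p (p' - s(p')) + (p - s(p)) s(p'). *)
exists (fun s => p * q' s + q s * poly_act s p'); split=> [s hs|y].
  by rewrite mulrDr mulrCA q1' // mulrA q1 // poly_actM mulrBr mulrBl addrA subrK.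
set S := \sum_(_ in _) _; pose S1 := \sum_(s in refl) hC (dunkl_coef s y) * hPoly (q s) * hW s.
pose S2 := \sum_(s in refl) hC (dunkl_coef s y) * hPoly (q' s) * hW s.
have -> : S = hPoly p * S2 + S1 * hPoly p'.
  rewrite mulr_sumr mulr_suml -big_split; apply: eq_bigr => s _ /=.
  rewrite hPolyD !hPolyM mulrDr mulrDl; congr (_ + _).
    by rewrite !mulrA hC_comm.
  by rewrite -!mulrA hW_hPoly.
rewrite directionalM hPolyD !hPolyM mulrA q2 -/S1 mulrBl mulrDl -[_ * hY y * _]mulrA q2' -/S2.
rewrite mulrBr mulrDr -[hPoly p * hPoly p' * hY y]mulrA.
rewrite opprD !addrA; congr (_ - _); rewrite [LHS]addrAC; congr (_ - _).
exact: addrAC.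
Qed.

End Commutation.

(** * The Euler element and the grading it defines *)

Section Euler.
Variables (R : realType) (n : nat) (W : finGroupType).
Local Notation C := R[i].
Variable d : cherednik_datum R n W.
Local Notation H := (Hc d).
Local Notation rho := (rep d).
Local Notation hC := (hC d).
Local Notation hX := (hX d).
Local Notation hY := (hY d).
Local Notation hW := (hW d).
Local Notation hPoly := (hPoly d).
Local Notation refl := (reflections rho).
Local Notation root := (dual_root d).
Local Notation coroot := (coroot d).
Local Notation lambda := (eigen d).

Lemma rho_conj v w : rho (v ^ w)%g = rho w^-1%g *m rho v *m rho w.
Proof. by rewrite conjgE !rhoM mulmxA. Qed.

Lemma refl_conj s w : ((s ^ w)%g \in refl) = (s \in refl).
Proof.
have rk v u : (\rank (rho (v ^ u)%g - 1%:M)%R <= \rank (rho v - 1%:M)%R)%N.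
  have -> : rho (v ^ u)%g - 1%:M = rho u^-1%g *m (rho v - 1%:M) *m rho u.
    by rewrite mulmxBr mulmxBl -rho_conj mulmx1 rhoVK.
  by rewrite (leq_trans (mxrankM_maxl _ _)) ?mxrankM_maxr.
rewrite !inE; congr (_ == _); apply/eqP; rewrite eqn_leq rk /=.
by rewrite -{1}[s](conjgK w) rk.
Qed.

(** The trace expresses the eigenvalue through [rep] alone, so it is a class function although the
    eigenvectors are chosen separately for each reflection. *)
Lemma eigen_trace s : s \in refl -> 1 - lambda s = \tr (1%:M - rho s^-1%g).
Proof.
move=> hs; rewrite reflection_mx // mxtraceZ mxtrace_mulC pairing_mx pairing_root //.
by rewrite mxtrace_scalar mulr1n mulfVK ?pnatr_eq0.
Qed.

Lemma eigen_conj s w : s \in refl -> lambda (s ^ w)%g = lambda s.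
Proof.
move=> hs; apply/oppr_inj/(addrI 1); rewrite !eigen_trace ?refl_conj //.
rewrite !raddfB /=; congr (_ - _); rewrite -conjVg rho_conj mxtrace_mulC mulmxA.
by rewrite rhoKV mul1mx.
Qed.

Definition kappa s : C := - (2 * param d s / (1 - lambda s)).

Lemma kappa_conj s w : s \in refl -> kappa (s ^ w)%g = kappa s.
Proof. by move=> hs; rewrite /kappa eigen_conj // param_invariant. Qed.

Definition euler_vector : H := \sum_i hX (delta_mx 0 i) * hY (delta_mx i 0).
Definition euler : H := euler_vector + \sum_(s in refl) hC (kappa s) * hW s.

Lemma kappa_central w : hW w * (\sum_(s in refl) hC (kappa s) * hW s) =
  (\sum_(s in refl) hC (kappa s) * hW s) * hW w.
Proof.
rewrite mulr_sumr mulr_suml [RHS](reindex_inj (@conjg_inj _ w^-1%g)) /=.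
apply: eq_big => [s|s hs]; first by rewrite refl_conj.
rewrite kappa_conj // mulrA -hC_comm -!mulrA -!hWM; congr (_ * hW _).
by rewrite conjgE invgK !mulgA mulgKV.
Qed.

(** The canonical tensor of a pair of dual bases does not depend on the bases, hence is
    W-invariant. *)
Lemma euler_vector_comm w : hW w * euler_vector = euler_vector * hW w.
Proof.
have -> : hW w * euler_vector =
    (\sum_i hX (act_dual rho w (delta_mx 0 i)) * hY (act_h rho w (delta_mx i 0))) * hW w.
  rewrite mulr_sumr mulr_suml; apply: eq_bigr => i _.
  by rewrite mulrA hWX -mulrA hWY mulrA.
congr (_ * _); have E i :
    hX (act_dual rho w (delta_mx 0 i)) * hY (act_h rho w (delta_mx i 0)) =
    \sum_j \sum_k hC (rho w k i * rho w^-1%g i j) * (hX (delta_mx 0 j) * hY (delta_mx k 0)).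
  rewrite hX_delta hY_delta mulr_suml; apply: eq_bigr => j _.
  rewrite mulr_sumr; apply: eq_bigr => k _.
  rewrite /act_dual /act_h -rowE -colE !mxE mulrC hCM.
  by rewrite -!mulrA; congr (_ * _); rewrite !mulrA -hC_comm.
under eq_bigr do rewrite E.
rewrite exchange_big; apply: eq_bigr => j _ /=; rewrite exchange_big /= (bigD1 j) //=.
have S k : \sum_i hC (rho w k i * rho w^-1%g i j) * (hX (delta_mx 0 j) * hY (delta_mx k 0))
    = hC (k == j)%:R * (hX (delta_mx 0 j) * hY (delta_mx k 0)).
  rewrite -mulr_suml -hC_sum; congr (hC _ * _).
  by have := congr1 (fun A : 'M_n => A k j) (rhoKV d w); rewrite !mxE.
rewrite S eqxx hC1 mul1r big1 ?addr0 // => k /negbTE kj.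
by rewrite S kj hC0 mul0r.
Qed.

Lemma euler_hW w : euler * hW w = hW w * euler.
Proof. by rewrite /euler mulrDl mulrDr euler_vector_comm kappa_central. Qed.

Lemma kappa_half s : s \in refl -> kappa s * ((1 - lambda s) / 2) = - param d s.
Proof.
move=> hs; rewrite /kappa; field.
exact: one_sub_eigen_neq0.
Qed.

(** Moving [x] past [euler_vector] leaves reflection terms; [kappa] is normalised ([kappa_half]) so
    that moving [x] past the group part produces the opposite ones. *)
Lemma euler_hX x : euler * hX x = hX x * euler + hX x.
Proof.
rewrite /euler mulrDl mulrDr; set Z := \sum_(s in refl) _.
have hXY : euler_vector * hX x = hX x * euler_vector + hX x -
    \sum_(s in refl) hC (param d s * pairing (coroot s) x) * hX (root s) * hW s.
  rewrite mulr_suml mulr_sumr [X in _ + X - _]hX_delta.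
  under eq_bigr => i _.
    rewrite -mulrA (_ : hY _ * hX x = hX x * hY (delta_mx i 0) +
      (hY (delta_mx i 0) * hX x - hX x * hY (delta_mx i 0))); last by rewrite addrCA subrr addr0.
    rewrite hY_hX_commutator mulrDr mulrBr mulrA hXX -mulrA -hC_comm.
    have -> : pairing (delta_mx i 0) x = x 0 i by rewrite /pairing -colE mxE.
    over.
  rewrite big_split /= sumrB addrA; congr (_ + _ - _).
  rewrite (eq_bigr _ (fun i _ => mulr_sumr _ _ _ _)).
  rewrite exchange_big; apply: eq_bigr => s _ /=.
  rewrite [X in _ * X * _]hX_delta mulr_sumr mulr_suml; apply: eq_bigr => i _.
  have -> : pairing (delta_mx i 0) (root s) = root s 0 i by rewrite /pairing -colE mxE.
  rewrite mulrA -hC_comm !hCM -!mulrA; congr (_ * _).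
  by rewrite !mulrA -!hCM [root s 0 i * _]mulrC.
have hZ : Z * hX x = hX x * Z +
    \sum_(s in refl) hC (param d s * pairing (coroot s) x) * hX (root s) * hW s.
  rewrite mulr_suml mulr_sumr -big_split; apply: eq_bigr => s hs /=.
  have E : act_dual rho s x = x - ((1 - lambda s) / 2 * pairing (coroot s) x) *: root s.
    by rewrite -act_dual_reflection // opprB addrC subrK.
  rewrite -mulrA hWX E hXD -scaleNr hXZ mulrDl mulrDr; congr (_ + _).
    by rewrite mulrA hC_comm mulrA.
  by rewrite !mulrA -hCM mulrN mulrA kappa_half // mulNr opprK.
by rewrite hXY hZ addrACA addNr addr0 addrAC.
Qed.

Lemma euler_hY y : euler * hY y = hY y * euler - hY y.
Proof.
rewrite /euler mulrDl mulrDr; set Z := \sum_(s in refl) _.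
have hXY : euler_vector * hY y = hY y * euler_vector - hY y +
    \sum_(s in refl) hC (param d s * pairing y (root s)) * hW s * hY (coroot s).
  rewrite mulr_suml mulr_sumr [X in _ - X + _]hY_delta.
  under eq_bigr => i _.
    rewrite -mulrA hYY mulrA (_ : hX _ * hY y = hY y * hX (delta_mx 0 i) -
      (hY y * hX (delta_mx 0 i) - hX (delta_mx 0 i) * hY y)); last by rewrite opprB addrC subrK.
    rewrite hY_hX_commutator mulrBl mulrBl opprB addrA addrAC -mulrA pairing_delta.
    over.
  rewrite big_split sumrB /=; congr (_ + _).
  rewrite (eq_bigr _ (fun i _ => mulr_suml _ _ _ _)).
  rewrite exchange_big; apply: eq_bigr => s _ /=.
  rewrite [X in _ * _ * X]hY_delta mulr_sumr; apply: eq_bigr => i _.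
  rewrite pairing_delta hCM -!mulrA; congr (_ * _).
  by rewrite !mulrA -hC_comm.
have hZ : Z * hY y = hY y * Z -
    \sum_(s in refl) hC (param d s * pairing y (root s)) * hW s * hY (coroot s).
  rewrite mulr_suml mulr_sumr -sumrB; apply: eq_bigr => s hs /=.
  have E : hW s * hY y = hY y * hW s +
      hC ((1 - lambda s) / 2 * pairing y (root s)) * (hW s * hY (coroot s)).
    have E1 : y = act_h rho s^-1%g y +
      ((1 - lambda s) / 2 * pairing y (root s)) *: coroot s.
      by rewrite -act_reflection_inv // addrC subrK.
    rewrite {1}E1 hYD hYZ mulrDr mulrA -hC_comm -mulrA; congr (_ + _).
    by rewrite hWY /act_h mulmxA rhoKV mul1mx.
  rewrite -mulrA E mulrDr; congr (_ + _); first by rewrite !mulrA hC_comm.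
  by rewrite !mulrA -hCM mulrA kappa_half // mulNr hCN !mulNr.
by rewrite hXY hZ addrACA subrr addr0 addrAC.
Qed.

End Euler.

(** * Category O and the Serre property *)

Section Words.
Variables (R : realType) (n : nat) (W : finGroupType).
Local Notation C := R[i].
Variable d : cherednik_datum R n W.
Local Notation H := (Hc d).
Local Notation hC := (hC d).
Local Notation hX := (hX d).
Local Notation hY := (hY d).
Local Notation hW := (hW d).
Local Notation hPoly := (hPoly d).

Definition hY_word (s : seq 'I_n) : H := \prod_(i <- s) hY (delta_mx i 0).

Lemma hY_word_cons i s : hY_word (i :: s) = hY (delta_mx i 0) * hY_word s.
Proof. by rewrite /hY_word big_cons. Qed.
Lemma hY_word_cat s t : hY_word (s ++ t) = hY_word s * hY_word t.
Proof. by rewrite /hY_word big_cat. Qed.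

Section Module.
Variable M : lmodType H.

(** Spans over C[h], and over C below, are inductive, so that stability under an operator is an
    induction on membership. *)
Inductive pspan (S : M -> Prop) : M -> Prop :=
| pspan0 : pspan S 0
| pspanD m m' : pspan S m -> pspan S m' -> pspan S (m + m')
| pspan_gen p v : S v -> pspan S (hPoly p *: v).

Inductive cspan (S : M -> Prop) : M -> Prop :=
| cspan0 : cspan S 0
| cspanD m m' : cspan S m -> cspan S m' -> cspan S (m + m')
| cspan_gen a v : S v -> cspan S (hC a *: v).

Lemma cspan_sum S (J : Type) (r : seq J) (P : pred J) (F : J -> M) :
  (forall j, P j -> cspan S (F j)) -> cspan S (\sum_(j <- r | P j) F j).
Proof. by move=> h; elim/big_ind: _ => //; [exact: cspan0 | move=> *; exact: cspanD]. Qed.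
Lemma pspan_sum S (J : Type) (r : seq J) (P : pred J) (F : J -> M) :
  (forall j, P j -> pspan S (F j)) -> pspan S (\sum_(j <- r | P j) F j).
Proof. by move=> h; elim/big_ind: _ => //; [exact: pspan0 | move=> *; exact: pspanD]. Qed.

Lemma cspanZ S a m : cspan S m -> cspan S (hC a *: m).
Proof.
elim=> [|x y _ hx _ hy|b v Sv]; first by rewrite scaler0; exact: cspan0.
  by rewrite scalerDr; exact: cspanD.
by rewrite scalerA -hCM; exact: cspan_gen.
Qed.
Lemma cspan_id (S : M -> Prop) v : S v -> cspan S v.
Proof. by move=> Sv; rewrite -[v]scale1r -(hC1 d); exact: cspan_gen. Qed.
Lemma pspan_id (S : M -> Prop) v : S v -> pspan S v.
Proof. by move=> Sv; rewrite -[v]scale1r -(hPoly1 d); exact: pspan_gen. Qed.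
Lemma pspan_hPoly S p m : pspan S m -> pspan S (hPoly p *: m).
Proof.
elim=> [|x y _ hx _ hy|b v Sv]; first by rewrite scaler0; exact: pspan0.
  by rewrite scalerDr; exact: pspanD.
by rewrite scalerA -hPolyM; exact: pspan_gen.
Qed.
Lemma pspanN S m : pspan S m -> pspan S (- m).
Proof. by move/(pspan_hPoly (-1)); rewrite hPolyN hPoly1 scaleN1r. Qed.
Lemma cspanN S m : cspan S m -> cspan S (- m).
Proof. by move/(cspanZ (-1)); rewrite hCN hC1 scaleN1r. Qed.

Lemma pspan_trans (S S' : M -> Prop) m :
  (forall v, S v -> pspan S' v) -> pspan S m -> pspan S' m.
Proof.
move=> h; elim=> [|x y _ hx _ hy|p v /h]; [exact: pspan0|exact: pspanD|].
exact: pspan_hPoly.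
Qed.

Lemma pspan_finite (J : finType) (f : J -> M) m :
  pspan (fun v => exists j, v = f j) m -> exists p : J -> {mpoly C[n]}, m = \sum_j hPoly (p j) *: f j.
Proof.
elim=> [|x y _ [p ->] _ [q ->]|p _ [j ->]].
- by exists (fun _ => 0); rewrite big1 // => j _; rewrite hPoly0 scale0r.
- exists (fun j => p j + q j); rewrite -big_split.
  by apply: eq_bigr => j _; rewrite hPolyD scalerDl.
- exists (fun i => if i == j then p else 0).
  rewrite (bigD1 j) //= eqxx big1 ?addr0 // => i /negbTE ->.
  by rewrite hPoly0 scale0r.
Qed.

Lemma coh_pspan : coh M <-> exists (J : finType) (f : J -> M),
  forall m, pspan (fun v => exists j, v = f j) m.
Proof.
split=> [[k [g gP]]|[J [f fP]]].
  exists 'I_k, g => m; have [p ->] := gP m; apply: pspan_sum => j _.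
  by apply: pspan_gen; exists j.
exists #|J|, (fun i => f (enum_val i)) => m; have [p ->] := pspan_finite (fP m).
exists (fun i => p (enum_val i)); rewrite (reindex (@enum_val _ J)) //=.
by apply: onW_bij; exact: enum_val_bij.
Qed.

Lemma hY_prod_word N (m : M) : (forall s, size s = N -> hY_word s *: m = 0) ->
  forall y : 'I_N -> 'cV[C]_n, (\prod_(i < N) hY (y i)) *: m = 0.
Proof.
elim: N m => [|N IH] m h y.
  by rewrite big_ord0; have := h [::] erefl; rewrite /hY_word big_nil.
rewrite big_ord_recr /= -scalerA; apply: IH => s sN.
rewrite scalerA hY_delta mulr_sumr scaler_suml big1 // => j _.
rewrite mulrA -hC_comm -mulrA.
have -> : hY_word s * hY (delta_mx j 0) = hY_word (s ++ [:: j]).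
  by rewrite hY_word_cat hY_word_cons /hY_word big_nil mulr1.
by rewrite -scalerA h ?scaler0 // size_cat sN addn1.
Qed.

Lemma hY_word_prod N (m : M) :
  (forall y : 'I_N -> 'cV[C]_n, (\prod_(i < N) hY (y i)) *: m = 0) ->
  forall s, (N <= size s)%N -> hY_word s *: m = 0.
Proof.
move=> h s Ns; rewrite -(cat_take_drop (size s - N) s) hY_word_cat -scalerA.
have : size (drop (size s - N) s) = N by rewrite size_drop subKn.
set t := drop _ _ => tN; suff -> : hY_word t *: m = 0 by rewrite scaler0.
move: h; rewrite -tN => h; case: {tN} t h => [|i t] h.
  by have := h (fun _ => 0); rewrite big_ord0 /hY_word big_nil.
have := h (fun k => delta_mx (nth i (i :: t) k) 0).
by rewrite /hY_word (big_nth i) big_mkord.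
Qed.

Variables (k : nat) (g : 'I_k -> M).

(** W-translates of the generators are included to make the span of each level W-stable. *)
Definition word_level (l : nat) (v : M) : Prop :=
  exists s w j, size s = l /\ v = hY_word s *: (hW w *: g j).

Lemma word_level_hY l y v : cspan (word_level l) v -> cspan (word_level l.+1) (hY y *: v).
Proof.
elim=> [|x x' _ hx _ hx'|a _ [s [w [j [sl ->]]]]]; first by rewrite scaler0; exact: cspan0.
  by rewrite scalerDr; exact: cspanD.
rewrite scalerA -hC_comm -scalerA; apply: cspanZ.
rewrite hY_delta scaler_suml; apply: cspan_sum => i _; rewrite -scalerA; apply: cspan_gen.
exists (i :: s), w, j; split; first by rewrite /= sl.
by rewrite hY_word_cons scalerA.
Qed.

Lemma word_level_hW l w v : cspan (word_level l) v -> cspan (word_level l) (hW w *: v).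
Proof.
elim=> [|x x' _ hx _ hx'|a _ [s [w' [j [sl ->]]]]]; first by rewrite scaler0; exact: cspan0.
  by rewrite scalerDr; exact: cspanD.
rewrite scalerA -hC_comm -scalerA; apply: cspanZ => {a v}.
elim: l s sl => [|l IH] [|i s] //= => [_|[sl]].
  apply: cspan_id; exists [::], (w * w')%g, j; split=> //.
  by rewrite /hY_word big_nil !scale1r scalerA hWM.
rewrite hY_word_cons -scalerA scalerA hWY -scalerA.
by apply: word_level_hY; exact: IH.
Qed.

Let words v := exists l, cspan (word_level l) v.

(** The spanning half of the PBW decomposition: [y] passes to the right of a polynomial at the cost
    of a derivative and of reflections, none of which raises the level. *)
Lemma words_stable (h : H) m : pspan words m -> pspan words (h *: m).
Proof.
move: h m; apply: (@hc_generated R n W d (fun h => forall m, pspan words m -> pspan words (h *: m))).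
- by move=> x m; rewrite -hPoly_linear_form; exact: pspan_hPoly.
- move=> y m; elim=> [|x x' _ hx _ hx'|p v [l lv]]; first by rewrite scaler0; exact: pspan0.
    by rewrite scalerDr; exact: pspanD.
  have [q [_ qE]] := hY_hPoly d p; rewrite scalerA qE scalerBl scalerDl -scalerA.
  apply: pspanD; [apply: pspanD|apply: pspanN].
  + by apply: pspan_gen; exists l.+1; exact: word_level_hY.
  + by apply: pspan_gen; exists l.
  rewrite scaler_suml; apply: pspan_sum => s _; rewrite -hPolyC -hPolyM -scalerA.
  by apply: pspan_gen; exists l; exact: word_level_hW.
- move=> w m; elim=> [|x x' _ hx _ hx'|p v [l lv]]; first by rewrite scaler0; exact: pspan0.
    by rewrite scalerDr; exact: pspanD.
  rewrite scalerA hW_hPoly -scalerA.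
  by apply: pspan_gen; exists l; exact: word_level_hW.
- by move=> a m; rewrite -hPolyC; exact: pspan_hPoly.
- by move=> a b ha hb m hm; rewrite scalerDl; apply: pspanD; [exact: ha|exact: hb].
- by move=> a b ha hb m hm; rewrite -scalerA; apply: ha; exact: hb.
Qed.

Lemma words_generate N :
  (forall m, exists a : 'I_k -> H, m = \sum_i a i *: g i) ->
  (forall s w j, (N <= size s)%N -> hY_word s *: (hW w *: g j) = 0) ->
  forall m, pspan (fun v => exists j : N.-bseq 'I_n * W * 'I_k,
    v = hY_word j.1.1 *: (hW j.1.2 *: g j.2)) m.
Proof.
move=> gen nil m; have [a ->] := gen m; apply: pspan_sum => i _.
apply: (@pspan_trans words); last first.
  apply: words_stable; apply: pspan_id; exists 0%N; apply: cspan_id.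
  by exists [::], 1%g, i; split=> //; rewrite /hY_word big_nil hW1 !scale1r.
move=> v [l]; elim=> [|x x' _ hx _ hx'|c _ [s [w [j [sl ->]]]]]; [exact: pspan0|exact: pspanD|].
case: (leqP (size s) N) => [sN|/ltnW /nil -> ]; last by rewrite scaler0; exact: pspan0.
rewrite -hPolyC; apply: pspan_gen; exists (Bseq sN, w, j).
by [].
Qed.

End Module.

Lemma category_O_words (M : lmodType H) : category_O M ->
  exists (k : nat) (g : 'I_k -> M) (N : nat),
    (forall s w j, (N <= size s)%N -> hY_word s *: (hW w *: g j) = 0) /\
    forall m, pspan (fun v => exists j : N.-bseq 'I_n * W * 'I_k,
      v = hY_word j.1.1 *: (hW j.1.2 *: g j.2)) m.
Proof.
move=> [[k [g gen]] nil]; exists k, g.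
have /choice [f fP] : forall wj : W * 'I_k, exists N, forall y : 'I_N -> 'cV[C]_n,
    (\prod_(i < N) hY (y i)) *: (hW wj.1 *: g wj.2) = 0.
  by move=> [w j]; exact: nil.
have nilN s w j : (\max_wj f wj <= size s)%N -> hY_word s *: (hW w *: g j) = 0.
  by move=> le; apply: (hY_word_prod (fP (w, j))); exact: (leq_trans (leq_bigmax (w, j)) le).
by exists (\max_wj f wj)%N; split=> //; exact: words_generate.
Qed.

Lemma category_O_coh (M : lmodType H) : category_O M -> coh M.
Proof.
move=> /category_O_words [k [g [N [_ gen]]]]; apply/coh_pspan.
by eexists; eexists; exact: gen.
Qed.

Lemma coh_fin_gen (M : lmodType H) : coh M -> fin_gen M.
Proof.
move=> [k [g gP]]; exists k, g => m; have [p ->] := gP m.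
by exists (fun i => hPoly (p i)).
Qed.

Lemma category_O_serre : serre_subcategory (@category_O R n W d) (@coh R n W d).
Proof.
split=> [M|M M0|M1 M2 M3 f g coh1 coh2 coh3 [f_inj exact_fg g_surj]].
- exact: category_O_coh.
- split; last by move=> m; exists 0%N => y; exact: M0.
  by exists 0%N, (fun _ => 0) => m; exists (fun _ => 0); rewrite big_ord0; exact: M0.
split=> [[_ nil2]|[[_ nil1] [_ nil3]]].
  split; split; try exact: coh_fin_gen.
    move=> m; have [N nilN] := nil2 (f m); exists N => y; apply: f_inj.
    by rewrite linearZ_LR nilN linear0.
  move=> m3; have [m ->] := g_surj m3; have [N nilN] := nil2 m; exists N => y.
  by rewrite -linearZ_LR nilN linear0.
split=> [|m]; first exact: coh_fin_gen.
have [N nilN] := nil3 (g m).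
(* Words of length [N] send [m] into the submodule; as they are finitely many, one length kills all
   the images. *)
have /choice [p pE] : forall s : N.-tuple 'I_n, exists m1, hY_word s *: m = f m1.
  move=> s; apply/exact_fg; rewrite linearZ_LR (hY_word_prod nilN) //.
  by rewrite size_tuple.
have /choice [q qE] : forall s : N.-tuple 'I_n, exists K, forall y : 'I_K -> 'cV[C]_n,
    (\prod_(i < K) hY (y i)) *: p s = 0.
  by move=> s; exact: nil1.
exists (\max_s q s + N)%N; apply: hY_prod_word => s sN.
have sz : size (drop (\max_s q s) s) == N by rewrite size_drop sN addKn.
rewrite -(cat_take_drop (\max_s q s) s) hY_word_cat -scalerA.
rewrite (pE (Tuple sz)) -linearZ_LR (hY_word_prod (qE (Tuple sz))) ?linear0 //.
rewrite size_takel ?sN ?leq_addr //.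
exact: (leq_bigmax (Tuple sz)).
Qed.

End Words.

(** * Base change *)

Section BaseChangeTheory.
Variables (R : realType) (n : nat) (W : finGroupType).
Local Notation C := R[i].
Variable d : cherednik_datum R n W.
Variables (B : comNzRingType) (iota : {rmorphism C -> B}) (f : 'cV[B]_n).
Variable M : lmodType (Hc d).
Local Notation E := (base_change iota f M).
Local Notation ten := (@ten R n W d B iota f M).
Local Notation cls := (@bc_class R n W d B iota f M).
Local Notation "p .[f]" := (mmap iota (fun i => f i 0) p) (at level 2, format "p .[f]").

Lemma bc_eq_class t u : bc_eq iota f t u -> cls t = cls u.
Proof. by move/bc_classP. Qed.
Lemma bc_classD t u : cls (BcAdd t u) = cls t + cls u.
Proof. by rewrite -bc_addE. Qed.
Lemma bc_classZ b t : cls (BcScale b t) = b *: cls t.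
Proof. by rewrite -bc_scaleE. Qed.
Lemma tenD m m' : ten (m + m') = ten m + ten m'.
Proof. by rewrite -bc_classD; apply: bc_eq_class; exact: bc_tenD. Qed.
Lemma ten_hPoly p m : ten (hPoly d p *: m) = p.[f] *: ten m.
Proof. by rewrite -bc_classZ; apply: bc_eq_class; exact: bc_balanced. Qed.
Lemma ten_hC a m : ten (hC d a *: m) = iota a *: ten m.
Proof. by rewrite -hPolyC ten_hPoly mmapC. Qed.
Lemma ten0 : ten 0 = 0.
Proof. by rewrite -(scaler0 _ (hC d 0)) ten_hC rmorph0 scale0r. Qed.
Lemma tenN m : ten (- m) = - ten m.
Proof. by apply: (addrI (ten m)); rewrite -tenD !subrr ten0. Qed.
Lemma tenB m m' : ten (m - m') = ten m - ten m'.
Proof. by rewrite tenD tenN. Qed.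
Lemma ten_sum (J : Type) (r : seq J) (P : pred J) (F : J -> M) :
  ten (\sum_(j <- r | P j) F j) = \sum_(j <- r | P j) ten (F j).
Proof. exact: (big_morph ten tenD ten0). Qed.

Lemma base_change_ind (P : E -> Prop) : P 0 -> (forall m, P (ten m)) ->
  (forall x y, P x -> P y -> P (x + y)) -> (forall b x, P x -> P (b *: x)) -> forall x, P x.
Proof.
move=> P0 Pt PD PZ; elim/bc_ind; elim=> [m||t Pt' u Pu|b t Pt'].
- exact: Pt.
- exact: P0.
- by rewrite bc_classD; apply: PD.
- by rewrite bc_classZ; apply: PZ.
Qed.

Lemma base_change_span (J : finType) (g : J -> M) :
  (forall m, exists p : J -> {mpoly C[n]}, m = \sum_j hPoly d (p j) *: g j) ->
  forall x : E, exists b : J -> B, x = \sum_j b j *: ten (g j).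
Proof.
move=> gen; elim/base_change_ind=> [|m|x y [b ->] [c ->]|a x [b ->]].
- by exists (fun _ => 0); rewrite big1 // => j _; rewrite scale0r.
- have [p ->] := gen m; exists (fun j => (p j).[f]); rewrite ten_sum.
  by apply: eq_bigr => j _; rewrite ten_hPoly.
- exists (fun j => b j + c j); rewrite -big_split.
  by apply: eq_bigr => j _; rewrite scalerDl.
- exists (fun j => a * b j); rewrite scaler_sumr.
  by apply: eq_bigr => j _; rewrite scalerA.
Qed.

Section Lift.
Variables (V : lmodType B) (D : B -> B) (phi : M -> V) (psi : E -> V).
Hypotheses (DD : forall a b, D (a + b) = D a + D b)
           (DM : forall a b, D (a * b) = a * D b + D a * b) (D1 : D 1 = 0).
Hypotheses (psiD : {morph psi : x y / x + y}) (psiZ : forall b x, psi (b *: x) = b *: psi x).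
Hypothesis phiD : {morph phi : m m' / m + m'}.
Hypothesis phi_hPoly : forall p m,
  phi (hPoly d p *: m) = D p.[f] *: psi (ten m) + p.[f] *: phi m.

(* The value on [1 (x) m] of an operator satisfying the Leibniz rule for [D]    *)
(* determines it; for [D = 0] this is the universal property of base change.    *)
Fixpoint bc_lift (t : bc_term B M) : V :=
  match t with
  | BcTen m => phi m
  | BcZero => 0
  | BcAdd t u => bc_lift t + bc_lift u
  | BcScale b t => D b *: psi (cls t) + b *: bc_lift t
  end.

Let D0 : D 0 = 0. Proof. by apply: (addrI (D 0)); rewrite -DD !addr0. Qed.
Let DN a : D (- a) = - D a.
Proof. by apply: (addrI (D a)); rewrite -DD !subrr D0. Qed.

Lemma bc_lift_eq t u : bc_eq iota f t u -> bc_lift t = bc_lift u.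
Proof.
elim=> //= {t u}.
- by move=> t u v _ -> _ ->.
- by move=> t t' u u' _ -> _ ->.
- by move=> b t t' /bc_eq_class -> ->.
- by move=> t u v; rewrite addrA.
- by move=> t u; rewrite addrC.
- by move=> t; rewrite add0r.
- by move=> t; rewrite DN D1 oppr0 scale0r add0r scaleN1r addNr.
- move=> a b t; rewrite bc_classZ psiZ DM scalerDr scalerDl !scalerA.
  by rewrite [D a * b]mulrC addrA -[RHS]addrA [in RHS]addrCA [b * D a]mulrC addrA.
- by move=> t; rewrite D1 scale0r add0r scale1r.
- by move=> a t u; rewrite bc_classD psiD !scalerDr addrACA.
- by move=> a b t; rewrite DD !scalerDl addrACA.
Qed.

Lemma base_change_lift : exists L : E -> V, [/\ {morph L : x y / x + y},
  forall b x, L (b *: x) = D b *: psi x + b *: L x & forall m, L (ten m) = phi m].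
Proof.
pose L (x : E) := bc_lift (repr x).
have LE t : L (cls t) = bc_lift t by apply: bc_lift_eq; exact: bc_repr_class.
exists L; split=> [|b|m]; last by rewrite LE.
  elim/bc_ind=> t; elim/bc_ind=> u; by rewrite -bc_classD !LE.
by elim/bc_ind=> t; rewrite -bc_classZ !LE.
Qed.
End Lift.

Lemma base_change_universal (V : lmodType B) (phi : M -> V) :
  {morph phi : m m' / m + m'} -> (forall p m, phi (hPoly d p *: m) = p.[f] *: phi m) ->
  exists L : E -> V, [/\ {morph L : x y / x + y},
    forall b x, L (b *: x) = b *: L x & forall m, L (ten m) = phi m].
Proof.
move=> phiD phiP.
have [|||||//|//|L [LD LZ Lt]] := @base_change_lift V (fun _ => 0) phi (fun _ => 0).
- by move=> *; rewrite addr0.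
- by move=> *; rewrite mulr0 mul0r addr0.
- by [].
- by move=> x y; rewrite addr0.
- by move=> *; rewrite scaler0.
- by move=> p m; rewrite phiP scaler0 add0r.
by exists L; split=> // b x; rewrite LZ scaler0 add0r.
Qed.

End BaseChangeTheory.

(** * Places and lattices *)

Section DerivationsOfField.
Variables (R : realType) (K : fieldType) (iota : {rmorphism R[i] -> K}).
Local Notation C := R[i].

Lemma derivation_horner (D : K -> K) (r : {poly K}) z : derivation iota D ->
  D r.[z] = (map_poly D r).[z] + r^`().[z] * D z.
Proof.
move=> hD; have cD (p : {poly K}) i : (map_poly D p)`_i = D p`_i.
  by rewrite coef_map_id0 // (derivation0 hD).
elim/poly_ind: r => [|p c IH].
  by rewrite map_poly0 deriv0 !horner0 (derivation0 hD) mul0r addr0.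
have -> : map_poly D (p * 'X + c%:P) = map_poly D p * 'X + (D c)%:P.
  apply/polyP => i; rewrite cD !coefD !coefMX !coefC cD (derivationD hD).
  by case: i => [|i] /=; rewrite ?(derivation0 hD) ?add0r ?addr0.
rewrite derivD derivC addr0 derivM derivX mulr1 !hornerE (derivationD hD).
by rewrite (derivationM hD) IH; ring.
Qed.

Hypothesis dependent : forall z1 z2 : K,
  exists2 q : {poly {poly C}}, q != 0 & (map_poly (poly_eval iota z1) q).[z2] = 0.

Lemma poly_size_min (T : nzRingType) (P : {poly T} -> Prop) p : P p ->
  exists2 q, P q & forall q', P q' -> (size q <= size q')%N.
Proof.
move=> Pp; pose good n := `[< exists2 q, P q & size q = n >].
have ex : exists n, good n by exists (size p); apply/asboolP; exists p.
case: (ex_minnP ex) => m /asboolP[q Pq <-] min_m; exists q => // q' Pq'.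
by apply: min_m; apply/asboolP; exists q'.
Qed.

(** Differentiating p(t) = 0 gives p'(t) D t = 0, so p' is a relation of smaller degree and is zero
    by induction; a constant relation is zero. *)
Lemma derivation_transcendental (D : K -> K) t : derivation iota D -> D t != 0 ->
  forall p : {poly C}, poly_eval iota t p = 0 -> p = 0.
Proof.
move=> hD Dt p; have [n] := ubnP (size p); elim: n p => // n IH p; rewrite ltnS => sp pt.
apply/eqP; apply: contrapT => /negP p0.
have : D (poly_eval iota t p) = poly_eval iota t p^`() * D t.
  rewrite /poly_eval (derivation_horner _ _ hD) -deriv_map.
  suff -> : map_poly D (map_poly iota p) = 0 by rewrite horner0 add0r.
  apply/polyP => i; rewrite coef0 coef_map_id0 ?(derivation0 hD) //.
  by rewrite coef_map (derivationC hD).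
rewrite pt (derivation0 hD) => /esym/eqP; rewrite mulf_eq0 (negbTE Dt) orbF => /eqP.
move/IH; rewrite (leq_trans (lt_size_deriv p0)) // => /(_ isT) dp0.
have : (size p <= 1)%N.
  rewrite leqNgt; apply/negP => sp1.
  have := congr1 (fun r : {poly C} => r`_(size p).-2) dp0; rewrite coef_deriv coef0.
  have := p0; rewrite -lead_coef_eq0 lead_coefE.
  case: (size p) sp1 => [|[|k]] //= _ lp /eqP.
  by rewrite mulrn_eq0 (negbTE lp).
move/size1_polyC => pE; move: pt p0; rewrite pE poly_evalC => /eqP.
by rewrite fmorph_eq0 => /eqP ->; rewrite eqxx.
Qed.

(** If D t is nonzero, [t] is transcendental and every [z] is algebraic over C(t), so a derivation
    is determined by its value at [t]. *)
Lemma derivations_proportional (D D' : K -> K) : derivation iota D -> derivation iota D' ->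
  (forall z, D z = 0) \/ exists c, forall z, D' z = c * D z.
Proof.
move=> hD hD'; case: (pselect (forall z, D z = 0)) => [|h]; first by left.
right; have {h} [t Dt] : exists t, D t != 0.
  by apply: contrapT => h'; apply: h => z; apply/eqP; apply: contrapT => /negP ?; apply: h'; exists z.
exists (D' t / D t) => z.
have tr := derivation_transcendental hD Dt.
have [e eE] : exists e : {rmorphism {poly C} -> K}, e =1 poly_eval iota t.
  apply: rmorphism_of_fun; [exact: poly_evalD | exact: poly_evalM |].
  by rewrite -polyC1 poly_evalC rmorph1.
have e_eq0 p : (e p == 0) = (p == 0).
  apply/eqP/eqP => [|->]; last exact: rmorph0.
  by rewrite eE; exact: tr.
have [q0 q00 q0z] := dependent t z.
have [q [qn0 qz] qmin] := @poly_size_min {poly C}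
  (fun q => q != 0 /\ (map_poly e q).[z] = 0) q0 (conj q00 (etrans (congr1 (horner^~ z) (eq_map_poly eE q0)) q0z)).
have dq : (map_poly e q^`()).[z] != 0.
  apply/eqP => dqz; have sq1 : (1 < size q)%N.
    rewrite ltnNge; apply/negP => /size1_polyC qE.
    move: qz qn0; rewrite qE map_polyC hornerC => /eqP.
    by rewrite e_eq0 polyC_eq0 => /eqP ->; rewrite eqxx.
  have dq0 : q^`() != 0.
    apply/eqP => /(congr1 (fun r : {poly {poly C}} => r`_(size q).-2)); rewrite coef_deriv coef0.
    have := qn0; rewrite -lead_coef_eq0 lead_coefE.
    case: (size q) sq1 => [|[|k]] //= _ lq /eqP.
    by rewrite -mulr_natr mulf_eq0 (negbTE lq) -(rmorph_nat (@polyC C)) polyC_eq0 pnatr_eq0.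
  by have := qmin _ (conj dq0 dqz); rewrite leqNgt lt_size_deriv.
(* The partial derivative in [t] of the minimal relation q(t, z) = 0; differentiating that relation
   gives [key]. *)
pose Q := map_poly (fun p => e p^`()) q.
have key D1 : derivation iota D1 -> D1 t * Q.[z] + (map_poly e q^`()).[z] * D1 z = 0.
  move=> h1; rewrite -(derivation0 h1) -[in RHS]qz (derivation_horner _ _ h1) deriv_map.
  rewrite -hornerZ; congr (_.[z] + _); apply/polyP => i.
  rewrite coefZ !coef_map_id0 ?(derivation0 h1) ?deriv0 ?rmorph0 //= !eE.
  rewrite [RHS](derivation_horner _ _ h1) deriv_map mulrC.
  suff -> : map_poly D1 (map_poly iota q`_i) = 0 by rewrite horner0 add0r.
  apply/polyP => k; rewrite coef0 coef_map_id0 ?(derivation0 h1) // coef_map.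
  exact: (derivationC h1).
apply: (mulfI dq); rewrite mulrCA.
have /eqP := key _ hD; rewrite addrC addr_eq0 => /eqP ->.
have /eqP := key _ hD'; rewrite addrC addr_eq0 => /eqP ->.
by rewrite mulrN mulrA divfK.
Qed.

Section Place.
Variable O : K -> Prop.
Hypothesis hO : place iota O.
Local Notation m := (place_ideal O).

Lemma placeC c : O (iota c). Proof. by have [h _ _ _] := hO; apply: h. Qed.
Lemma place0 : O 0. Proof. by rewrite -(rmorph0 iota); exact: placeC. Qed.
Lemma place1 : O 1. Proof. by rewrite -(rmorph1 iota); exact: placeC. Qed.
Lemma placeB a b : O a -> O b -> O (a - b).
Proof. by have [_ h _ _] := hO => ha hb; case: (h a b ha hb). Qed.
Lemma placeM a b : O a -> O b -> O (a * b).
Proof. by have [_ h _ _] := hO => ha hb; case: (h a b ha hb). Qed.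
Lemma placeN a : O a -> O (- a).
Proof. by move=> ha; rewrite -[- a]add0r; apply: placeB => //; exact: place0. Qed.
Lemma placeD a b : O a -> O b -> O (a + b).
Proof. by move=> ha hb; rewrite -[b]opprK; apply: placeB => //; exact: placeN. Qed.
Lemma placeV z : O z \/ O z^-1. Proof. by have [_ _ h _] := hO. Qed.
Lemma placeX a k : O a -> O (a ^+ k).
Proof.
by move=> ha; elim: k => [|k IH]; rewrite ?expr0 ?exprS; [exact: place1|exact: placeM].
Qed.
Lemma place_sum (J : Type) (r : seq J) (P : pred J) (F : J -> K) :
  (forall j, P j -> O (F j)) -> O (\sum_(j <- r | P j) F j).
Proof. by move=> h; elim/big_ind: _ => //; [exact: place0|exact: placeD]. Qed.
Lemma place_horner (p : {poly K}) x : (forall i, O p`_i) -> O x -> O p.[x].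
Proof.
move=> hp hx; rewrite horner_coef; apply: place_sum => i _.
by apply: placeM => //; exact: placeX.
Qed.

Lemma ideal_place z : m z -> O z. Proof. by case. Qed.
Lemma ideal0 : m 0. Proof. by split; [exact: place0|left]. Qed.
Lemma ideal1 : ~ m 1.
Proof. by case=> _ [/eqP|]; rewrite ?oner_eq0 // invr1 => /(_ place1). Qed.
Lemma ideal_inv z : ~ O z -> m z^-1.
Proof.
move=> nz; split; last by right; rewrite invrK.
by case: (placeV z).
Qed.
Lemma place_cases z : O z -> m z \/ (z != 0 /\ O z^-1).
Proof.
move=> Oz; case: (eqVneq z 0) => [->|z0]; first by left; exact: ideal0.
case: (pselect (O z^-1)) => h; first by right.
by left; split => //; right.
Qed.
Lemma idealM a b : O a -> m b -> m (a * b).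
Proof.
move=> ha [hb [->|hb']]; first by rewrite mulr0; exact: ideal0.
split; first exact: placeM.
case: (eqVneq (a * b) 0) => [|ab0]; [by left | right => h; apply: hb'].
have [a0 b0] : a != 0 /\ b != 0 by move: ab0; rewrite mulf_eq0 negb_or => /andP.
by rewrite -[b^-1](mulVKf a0) -invfM; exact: placeM.
Qed.
Lemma idealN a : m a -> m (- a).
Proof.
by move=> ma; rewrite -mulN1r; apply: idealM => //; apply: placeN; exact: place1.
Qed.
Lemma idealD a b : m a -> m b -> m (a + b).
Proof.
move=> ma mb; case: (eqVneq b 0) => [->|b0]; first by rewrite addr0.
case: (eqVneq a 0) => [->|a0]; first by rewrite add0r.
case: (placeV (a / b)) => h.
  have -> : a + b = (a / b + 1) * b by rewrite mulrDl divfK // mul1r.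
  by apply: idealM => //; apply: placeD => //; exact: place1.
have -> : a + b = (1 + b / a) * a by rewrite mulrDl divfK // mul1r.
by apply: idealM => //; apply: placeD; [exact: place1 | rewrite -invf_div].
Qed.
Lemma idealB a b : m a -> m b -> m (a - b).
Proof. by move=> ma mb; apply: idealD => //; exact: idealN. Qed.
Lemma ideal_one_sub x : m x -> 1 - x != 0 /\ O (1 - x)^-1.
Proof.
move=> mx; have : O (1 - x) by apply: placeB; [exact: place1|exact: ideal_place].
case/place_cases => // h; case: ideal1.
by rewrite -[1](subrK x); apply: idealD.
Qed.
Lemma placeC_unit c : c != 0 -> ~ m (iota c).
Proof.
move=> c0 h; apply: ideal1; have -> : 1 = iota c^-1 * iota c by rewrite -rmorphM mulVf ?rmorph1.
by apply: idealM => //; exact: placeC.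
Qed.

Lemma poly_evalO w (p : {poly C}) : O w -> O (poly_eval iota w p).
Proof. by apply: place_horner => i; rewrite coef_map; exact: placeC. Qed.

(** Splitting off the largest power of X leaves a polynomial with nonzero constant term, whose value
    at [w] is a unit. *)
Lemma poly_eval_ideal w (p : {poly C}) : m w -> p != 0 ->
  exists k u, [/\ poly_eval iota w p = w ^+ k * u, u != 0 & O u^-1].
Proof.
move=> mw p0; have [k [q /implyP /(_ p0) q0 pE]] := multiplicity_XsubC p 0.
have nmq : ~ m (poly_eval iota w q).
  elim/poly_ind: q q0 {pE} => [|q c _]; first by rewrite root0.
  rewrite rootE !hornerE => c0; rewrite poly_evalD poly_evalM poly_evalX poly_evalC => h.
  apply: (placeC_unit c0); rewrite -[iota c](addKr (poly_eval iota w q * w)) addrC.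
  by apply: idealB => //; apply: idealM => //; apply: poly_evalO; exact: ideal_place.
have [//|[u0 uV]] := place_cases (poly_evalO q (ideal_place mw)).
exists k, (poly_eval iota w q); split=> //.
rewrite pE subr0 poly_evalM mulrC; congr (_ * _).
by rewrite /poly_eval map_polyXn hornerXn.
Qed.

(* The value group has rank one.                                                *)
Lemma place_archimedean w z : m w -> z != 0 -> exists k o, O o /\ w ^+ k = z * o.
Proof.
move=> mw z0; case: (placeV z) => [Oz|Oz]; last first.
  by exists 0%N, z^-1; rewrite divff ?expr0.
case: (eqVneq w 0) => [->|w0].
  by exists 1%N, 0; split; [exact: place0 | rewrite mulr0 expr1].
have [q q0 qz] := dependent w z.
(* Without its factors ['X] the relation has a nonzero constant term [c]; so c(w) is a multiple of
   [z], while it is a power of [w] up to a unit. *)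
have [k [r /implyP /(_ q0) r0 qE]] := multiplicity_XsubC q 0.
have [e eE] : exists e : {rmorphism {poly C} -> K}, e =1 poly_eval iota w.
  apply: rmorphism_of_fun; [exact: poly_evalD | exact: poly_evalM |].
  by rewrite -polyC1 poly_evalC rmorph1.
have : (map_poly e r).[z] = 0.
  move: qz; rewrite -(eq_map_poly eE) qE polyC0 subr0 rmorphM rmorphXn /= map_polyX hornerM hornerXn => /eqP.
  by rewrite mulf_eq0 (expf_eq0 z) (negbTE z0) andbF orbF => /eqP.
have Oe (p : {poly {poly C}}) : O (map_poly e p).[z].
  by apply: place_horner => // i; rewrite coef_map /= eE; apply: poly_evalO; exact: ideal_place.
elim/poly_ind: r r0 {qE} => [|r c _]; first by rewrite root0.
rewrite rootE !hornerE => c0; rewrite rmorphD rmorphM /= map_polyX map_polyC !hornerE => /eqP.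
rewrite addrC addr_eq0 /= eE; have [j [u [-> u0 uV]]] := poly_eval_ideal mw c0.
move=> /eqP h; exists j, (- (map_poly e r).[z] * u^-1); split.
  by apply: placeM => //; apply: placeN.
by rewrite mulrA mulrN [z * _]mulrC -h mulfK.
Qed.

Section LogDerivative.
Variable D : K -> K.
Hypotheses (hD : derivation iota D) (mD : forall z, m z -> m (D z)).

(** If D z were not in [O], then h = 1 / D z would lie in the ideal, and D (z h) = z D h + 1 would
    put 1 there too. *)
Lemma placeDer z : O z -> O (D z).
Proof.
move=> Oz; apply: contrapT => nDz; have mh := ideal_inv nDz.
have Dz0 : D z != 0 by apply/eqP => h; apply: nDz; rewrite h; exact: place0.
apply: ideal1; have := mD (idealM Oz mh); rewrite (derivationM hD) divff // => h.
by rewrite -[1](addKr (z * D (D z)^-1)) addrC; apply: idealB => //; apply: idealM => //; exact: mD.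
Qed.

(** Otherwise w = z / D z lies in the ideal. As D (z / w^k) is z / w^(k+1) times the unit 1 - k D w,
    all z / w^k lie in the ideal, although [place_archimedean] makes some power of [w] a multiple of
    [z]. *)
Lemma log_derivative_ideal z : m z -> O (D z / z).
Proof.
move=> mz; apply: contrapT => nO.
have z0 : z != 0 by apply/eqP => h; apply: nO; rewrite h invr0 mulr0; exact: place0.
have Dz0 : D z != 0 by apply/eqP => h; apply: nO; rewrite h mul0r; exact: place0.
have mw : m (z / D z) by rewrite -invf_div; exact: ideal_inv.
set w := z / D z in mw; have w0 : w != 0 by rewrite mulf_neq0 ?invr_eq0.
have DzE : D z = z / w by rewrite /w invf_div mulrCA divff ?mulr1.
have xk k : m (z / w ^+ k).
  elim: k => [|k IH]; first by rewrite expr0 invr1 mulr1.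
  have kE : D (w ^+ k) * w = w ^+ k * D w *+ k.
    case: k {IH} => [|k]; first by rewrite expr0 (derivation1 hD) mul0r mulr0n.
    by rewrite (derivationX hD) mulrnAl mulrAC -exprSr.
  have E : D (z / w ^+ k) = z / w ^+ k.+1 * (1 - D w *+ k).
    apply: (@mulIf _ (w ^+ k * w)); first by rewrite mulf_neq0 // expf_neq0.
    have : D (z / w ^+ k * w ^+ k) * w = z by rewrite divfK ?expf_neq0 // DzE divfK.
    rewrite (derivationM hD) mulrDl -[_ * D (w ^+ k) * w]mulrA kE => E.
    rewrite mulrA [_ * (w ^+ k * w)]mulrAC -exprSr divfK ?expf_neq0 //.
    rewrite -mulrnAr mulrA divfK ?expf_neq0 // in E.
    by rewrite mulrBr mulr1 -[X in _ = X - _]E addrAC subrr add0r mulrA.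
  have [] := @ideal_one_sub (D w *+ k).
    by elim: (k) => [|j IHj]; rewrite ?mulr0n ?mulrS; [exact: ideal0|apply: idealD => //; exact: mD].
  move=> u0 Ou. have -> : z / w ^+ k.+1 = (1 - D w *+ k)^-1 * D (z / w ^+ k).
    by rewrite E [RHS]mulrC mulfK.
  by apply: idealM => //; exact: mD.
have [k [o [Oo wE]]] := place_archimedean mw z0.
apply: ideal1; have -> : 1 = o * (z / w ^+ k); last exact: idealM.
by rewrite mulrA [o * z]mulrC -wE divff // expf_neq0.
Qed.

Lemma log_derivative z : z != 0 -> O (D z / z).
Proof.
move=> z0; case: (pselect (O z)) => [Oz|/ideal_inv /log_derivative_ideal].
  case: (place_cases Oz) => [/log_derivative_ideal//|[_ Ozi]].
  by apply: placeM => //; exact: placeDer.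
suff -> : D z^-1 / z^-1 = - (D z / z) by move/placeN; rewrite opprK.
have := derivationM hD z z^-1; rewrite divff // (derivation1 hD) => /esym/eqP.
by rewrite invrK addr_eq0 mulrC => /eqP.
Qed.

End LogDerivative.

Section Lattice.
Variable E : lmodType K.

(* Gaussian elimination over the valuation ring: in a dependent family, the     *)
(* vector whose coefficient has the largest pole is redundant.                  *)
Lemma lattice_basis (J : finType) (g : J -> E) :
  (forall x, exists b : J -> K, x = \sum_j b j *: g j) ->
  exists (r : nat) (e : 'I_r -> E), [/\ basis_of_space e,
    forall i, exists j, e i = g j & forall j, lattice O e (g j)].
Proof.
move=> span.
pose good (X : {set J}) := `[< forall j, exists a : J -> K,
  (forall i, i \in X -> O (a i)) /\ g j = \sum_(i in X) a i *: g i >].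
have goodT : good [set: J]%SET.
  apply/asboolP => j; exists (fun i => (i == j)%:R); split.
    by move=> i _; case: (i == j); [exact: place1|exact: place0].
  rewrite (bigD1 j) ?inE //= eqxx scale1r big1 ?addr0 // => i /andP[_ /negbTE ->].
  by rewrite scale0r.
case: (minset_exists goodT) => X /minsetP [/asboolP goodX minX] _.
have indep (a : J -> K) : \sum_(i in X) a i *: g i = 0 -> forall i, i \in X -> a i = 0.
  move=> a0 i0 i0X; apply/eqP; apply: contrapT => /negP ai0.
  have [j0 [j0X aj0 jmax]] : exists j0, [/\ j0 \in X, a j0 != 0
      & forall i, i \in X -> O (a i / a j0)].
    have [j0 [h1 h2 h3]] : exists j0, [/\ j0 \in X, a j0 != 0
        & forall i, i \in enum X -> O (a i / a j0)].
      have : {subset enum X <= X} by move=> i; rewrite mem_enum.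
      elim: (enum X) => [|i s IH] sX; first by exists i0.
      have [|j0 [h1 h2 h3]] := IH; first by move=> k ks; apply: sX; rewrite inE ks orbT.
      case: (placeV (a i / a j0)) => h.
        by exists j0; split=> // k; rewrite inE => /orP[/eqP->//|/h3].
      case: (eqVneq (a i) 0) => [ai|ai].
        exists j0; split=> // k; rewrite inE => /orP[/eqP->|/h3//].
        by rewrite ai mul0r; exact: place0.
      exists i; split=> //; first by apply: sX; rewrite mem_head.
      move=> k; rewrite inE => /orP[/eqP->|/h3 hk]; first by rewrite divff //; exact: place1.
      rewrite -[a k / a i](_ : a k / a j0 * (a i / a j0)^-1 = _); first exact: placeM.
      by rewrite invf_div mulrA divfK.
    by exists j0; split=> // i iX; apply: h3; rewrite mem_enum.
  have goodX0 : good (X :\ j0).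
    apply/asboolP => j; have [b [Ob ->]] := goodX j.
    exists (fun i => b i - b j0 * (a i / a j0)); split.
      move=> i /setD1P[_ iX]; apply: placeB; first exact: Ob.
      by apply: placeM; [exact: Ob|exact: jmax].
    have gj0 : g j0 = - \sum_(i in X :\ j0) (a i / a j0) *: g i.
      move: a0; rewrite (big_setD1 j0) //= => /eqP; rewrite addr_eq0 => /eqP a0.
      rewrite -[g j0](scalerK aj0) a0 scalerN scaler_sumr; congr (- _).
      by apply: eq_bigr => i _; rewrite scalerA mulrC.
    rewrite (big_setD1 j0) //= gj0 scalerN scaler_sumr addrC -sumrB.
    by apply: eq_bigr => i _; rewrite scalerBl scalerA.
  have := minX _ goodX0 (subD1set _ _) => XE.
  by move: j0X; rewrite -XE !inE eqxx.
have goodE j : exists a : J -> K, (forall i, i \in X -> O (a i)) /\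
    g j = \sum_(i < #|X|) a (enum_val i) *: g (enum_val i).
  have [a [Oa ->]] := goodX j; exists a; split=> //.
  by rewrite big_enum_val.
exists #|X|, (fun i => g (enum_val i)); split.
- have free (v : 'I_#|X| -> K) : \sum_(i < #|X|) v i *: g (enum_val i) = 0 -> forall i, v i = 0.
    move=> v0 i; pose c j := \sum_(k < #|X|) (if enum_val k == j then v k else 0).
    have cE k : c (enum_val k) = v k.
      rewrite /c (bigD1 k) //= eqxx big1 ?addr0 // => k' k'k.
      by rewrite (inj_eq enum_val_inj) (negbTE k'k).
    rewrite -cE; apply: indep; last exact: enum_valP.
    by rewrite big_enum_val; apply: etrans v0; apply: eq_bigr => k _; rewrite cE.
  move=> x; have [b ->] := span x; have /choice [A HA] := goodE.
  have E1 : \sum_j b j *: g j = \sum_(i < #|X|) (\sum_j b j * A j (enum_val i)) *: g (enum_val i).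
    apply: esym; rewrite (eq_bigr _ (fun i _ => scaler_suml _ _ _ _)).
    rewrite exchange_big; apply: eq_bigr => j _ /=.
    have [_ gE] := HA j; rewrite [in RHS]gE scaler_sumr; apply: eq_bigr => i _.
    by rewrite scalerA.
  exists (\row_i \sum_j b j * A j (enum_val i)); split.
    by rewrite E1; apply: eq_bigr => i _; rewrite mxE.
  move=> v vE; apply/rowP => i; rewrite mxE; apply/eqP; rewrite -subr_eq0; apply/eqP.
  apply: (free (fun i => \sum_j b j * A j (enum_val i) - v 0 i)).
  under eq_bigr do rewrite scalerBl.
  by rewrite sumrB -E1 vE subrr.
- by move=> i; exists (enum_val i).
move=> j; have [a [Oa gE]] := goodE j; exists (fun i => a (enum_val i)); split=> // i.
by apply: Oa; exact: enum_valP.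
Qed.
End Lattice.

End Place.
End DerivationsOfField.

(** * Regularity of the modules in category O *)

Section Nabla.
Variables (R : realType) (n : nat) (W : finGroupType).
Local Notation C := R[i].
Variables (d : cherednik_datum R n W) (W' : {group W}) (M : lmodType (Hc d)).
Variables (K : fieldType) (iota : {rmorphism C -> K}) (f : 'cV[K]_n).
Local Notation E := (base_change iota f M).
Local Notation ten := (@ten R n W d K iota f M).
Local Notation refl := (reflections (rep d)).
Local Notation alpha s := (map_mx iota (dual_root d s)).
Local Notation formula := (@nabla_formula R n W d W' M K iota f).
Local Notation "p .[f]" := (mmap iota (fun i => f i 0) p) (at level 2, format "p .[f]").

Lemma pairing_linear (a : K) (y y' : 'cV[K]_n) x :
  pairing (a *: y + y') x = a * pairing y x + pairing y' x.
Proof. by rewrite /pairing mulmxDr -scalemxAr !mxE. Qed.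

Lemma pairing_map (y : 'cV[K]_n) (x : 'rV[C]_n) :
  pairing y (map_mx iota x) = \sum_i y i 0 * iota (x 0 i).
Proof. by rewrite /pairing mxE; apply: eq_bigr => i _; rewrite mxE mulrC. Qed.

Lemma formulaD eta : {morph formula eta : m m' / m + m'}.
Proof.
move=> m m'; rewrite /nabla_formula addrACA -opprD -!big_split; congr (_ - _).
  by apply: eq_bigr => i _; rewrite scalerDr tenD scalerDr.
by apply: eq_bigr => s _; rewrite scalerDr tenD scalerDr.
Qed.

Lemma formula_linear a eta eta' m :
  formula (a *: eta + eta') m = a *: formula eta m + formula eta' m.
Proof.
rewrite /nabla_formula scalerBr addrACA -opprD !scaler_sumr -!big_split; congr (_ - _).
  by apply: eq_bigr => i _; rewrite !mxE scalerDl scalerA.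
apply: eq_bigr => s _ /=; rewrite scalerA -scalerDl; congr (_ *: _).
by rewrite pairing_linear; ring.
Qed.

Variable D : K -> K.
Hypothesis hD : derivation iota D.

Lemma derivation_pairing (x : 'rV[C]_n) :
  pairing (map_mx D f) (map_mx iota x) = D (pairing f (map_mx iota x)).
Proof.
rewrite !pairing_map (derivation_sum hD); apply: eq_bigr => i _.
by rewrite mxE (derivationM hD) (derivationC hD) mulr0 add0r.
Qed.

Hypothesis f_in : forall s, s \in refl -> s \in W' -> pairing f (alpha s) = 0.
Hypothesis f_out : forall s, s \in refl -> s \notin W' -> pairing f (alpha s) != 0.

(** For [s] outside W', the reflection terms of [hY_hPoly] combine with the correction terms of the
    formula into [p] times those for [m]; for [s] in W' they vanish, since <D f, alpha_s> = D <f,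
    alpha_s> = 0. What remains is the derivative of p(f). *)
Lemma formula_leibniz p m : formula (map_mx D f) (hPoly d p *: m) =
  D p.[f] *: ten m + p.[f] *: formula (map_mx D f) m.
Proof.
have [q [qE qY]] := hY_hPoly d p.
set eta := map_mx D f.
pose c s : K := iota (param d s) * pairing eta (alpha s) * iota (2 / (1 - eigen d s)).
have cE s : \sum_i eta i 0 * iota (dunkl_coef d s (delta_mx i 0)) = c s.
  rewrite /c pairing_map mulr_sumr mulr_suml; apply: eq_bigr => i _.
  rewrite /dunkl_coef !rmorphM.
  have -> : pairing (delta_mx i 0) (dual_root d s) = dual_root d s 0 i.
    by rewrite /pairing -colE mxE.
  by ring.
have E1 : \sum_i eta i 0 *: ten (hY d (delta_mx i 0) *: (hPoly d p *: m)) =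
    p.[f] *: (\sum_i eta i 0 *: ten (hY d (delta_mx i 0) *: m)) + D p.[f] *: ten m
    - \sum_(s in refl) (c s * (q s).[f]) *: ten (hW d s *: m).
  have -> : D p.[f] *: ten m = \sum_i (p^`M(i).[f] * eta i 0) *: ten m.
    rewrite (derivation_mmap hD) scaler_suml; apply: eq_bigr => i _.
    by rewrite mxE.
  have -> : \sum_(s in refl) (c s * (q s).[f]) *: ten (hW d s *: m) = \sum_i \sum_(s in refl)
      (eta i 0 * iota (dunkl_coef d s (delta_mx i 0)) * (q s).[f]) *: ten (hW d s *: m).
    rewrite exchange_big; apply: eq_bigr => s _ /=.
    by rewrite -scaler_suml -mulr_suml cE.
  rewrite scaler_sumr -[X in X - _]big_split -sumrB; apply: eq_bigr => i _ /=.
  rewrite scalerA qY scalerBl scalerDl tenB tenD -scalerA !ten_hPoly scalerBr scalerDr.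
  congr (_ + _ - _).
  - by rewrite -[(_ * _) *: m]scalerA ten_hPoly !scalerA mulrC.
  - rewrite !scalerA mulrC; congr ((_ * _) *: _).
    rewrite /directional raddf_sum (bigD1 i) //= big1 => [|j ji].
      by rewrite mxE !eqxx scale1r addr0.
    by rewrite mxE (negbTE ji) scale0r raddf0.
  - rewrite scaler_suml ten_sum scaler_sumr; apply: eq_bigr => s _.
    by rewrite -hPolyC -hPolyM -[(_ * hW d s) *: m]scalerA ten_hPoly rmorphM /= mmapC scalerA mulrA.
have c0 s : s \in refl -> s \in W' -> c s = 0.
  by move=> h1 h2; rewrite /c derivation_pairing f_in // (derivation0 hD) mulr0 mul0r.
have splitE (F : W -> E) : \sum_(s in refl) F s =
    \sum_(s in refl :&: W') F s + \sum_(s in refl :\: W') F s.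
  exact: big_setID.
rewrite /nabla_formula -/eta E1 splitE [X in _ - (X + _)]big1 ?add0r => [|s]; last first.
  by rewrite inE => /andP[h1 h2]; rewrite c0 // mul0r scale0r.
rewrite -addrA -opprD; pose T' := \sum_(s in refl :\: W') (c s / pairing f (alpha s)) *: ten ((hW d s - 1) *: m).
suff -> : \sum_(s in refl :\: W') (c s * (q s).[f]) *: ten (hW d s *: m) +
    \sum_(s in refl :\: W') (c s / pairing f (alpha s)) *:
      ten ((hW d s - 1) *: (hPoly d p *: m)) = p.[f] *: T'.
  by rewrite scalerBr [RHS]addrCA addrA.
rewrite -big_split scaler_sumr; apply: eq_bigr => s /=.
rewrite inE => /andP[sW' hs]; rewrite -/(c s).
have qf : (q s).[f] = (p.[f] - (poly_act d s p).[f]) / pairing f (alpha s).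
  apply: (@mulfI _ (pairing f (alpha s))); first exact: f_out.
  rewrite mulrCA divff ?mulr1 ?f_out // -raddfB /= -qE // rmorphM /=.
  by rewrite mmap_linear_form.
rewrite qf -/(c s) !(scalerBl, scale1r) !tenB scalerA hW_hPoly.
rewrite -[(hPoly d _ * _) *: m]scalerA !ten_hPoly.
rewrite !scalerBr !scalerA addrA -scalerDl; congr (_ *: _ - _ *: _); last by ring.
by ring.
Qed.

End Nabla.

Section NablaExists.
Variables (R : realType) (n : nat) (W : finGroupType).
Local Notation C := R[i].
Variables (d : cherednik_datum R n W) (W' : {group W}) (M : lmodType (Hc d)).
Variables (K : fieldType) (iota : {rmorphism C -> K}) (f : 'cV[K]_n).
Local Notation refl := (reflections (rep d)).
Local Notation alpha s := (map_mx iota (dual_root d s)).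

Hypothesis f_in : forall s, s \in refl -> s \in W' -> pairing f (alpha s) = 0.
Hypothesis f_out : forall s, s \in refl -> s \notin W' -> pairing f (alpha s) != 0.
Hypothesis proportional : forall D D' : K -> K, derivation iota D -> derivation iota D' ->
  (forall z, D z = 0) \/ exists c, forall z, D' z = c * D z.

(** Each derivation acts through the lifting property of base change. As derivations are multiples
    of a single one and curvature is alternating, flatness follows. *)
Lemma dunkl_connection_exists :
  exists nabla, dunkl_connection W' (iota := iota) (f := f) (M := M) nabla.
Proof.
have ex (D : K -> K) : exists N : base_change iota f M -> base_change iota f M, derivation iota D ->
    [/\ {morph N : x y / x + y}, forall b x, N (b *: x) = D b *: x + b *: N x
      & forall m, N (ten iota f m) = nabla_formula W' iota f (map_mx D f) m].
  case: (pselect (derivation iota D)) => [hD|]; last by exists id.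
  have [//|||//|//|||N [h1 h2 h3]] := @base_change_lift R n W d K iota f M _ D
    (nabla_formula W' iota f (map_mx D f)) id.
  - exact: derivationD hD.
  - exact: derivationM hD.
  - exact: derivation1 hD.
  - exact: formulaD.
  - by move=> p m; exact: (formula_leibniz hD f_in f_out).
  by exists N => _; split.
have {ex} [nabla nablaP] := choice ex; exists nabla.
have nD D : derivation iota D -> {morph nabla D : x y / x + y}.
  by move=> hD; case: (nablaP D hD).
have nL D : derivation iota D -> forall b x, nabla D (b *: x) = D b *: x + b *: nabla D x.
  by move=> hD; case: (nablaP D hD).
have nT D : derivation iota D -> forall m,
    nabla D (ten iota f m) = nabla_formula W' iota f (map_mx D f) m.
  by move=> hD; case: (nablaP D hD).
have n0 D : derivation iota D -> nabla D 0 = 0.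
  by move=> hD; rewrite -[X in nabla D X](scale0r 0) nL // scaler0 scale0r addr0.
have lin D D' a : derivation iota D -> derivation iota D' -> forall v,
    nabla (fun z => a * D z + D' z) v = a *: nabla D v + nabla D' v.
  move=> hD hD'; have hDD : derivation iota (fun z => a * D z + D' z).
    split=> [x y|x y|c].
    - by rewrite (derivationD hD) (derivationD hD'); ring.
    - by rewrite (derivationM hD) (derivationM hD'); ring.
    - by rewrite (derivationC hD) (derivationC hD') mulr0 addr0.
  elim/base_change_ind => [|m|x y hx hy|b x hx].
  - by rewrite !n0 // scaler0 addr0.
  - rewrite !nT // -formula_linear; congr (nabla_formula _ _ _ _ _).
    by apply/colP => i; rewrite !mxE.
  - by rewrite !nD // hx hy scalerDr addrACA.
  - rewrite !nL // hx !scalerDl !scalerDr !scalerA addrACA; congr (_ + _).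
    by rewrite [b * a]mulrC.
split; last by move=> D hD m; exact: nT.
split=> [D hD u v|D hD a v|D D' hD hD' a v|D D' hD hD' v]; first exact: nD.
- exact: nL.
- exact: lin.
have h0 : derivation iota (fun _ : K => 0).
  by split=> *; rewrite ?addr0 ?mulr0 ?mul0r ?addr0.
have nabla0 (D1 : K -> K) : (forall z, D1 z = 0) -> forall u, nabla D1 u = 0.
  move=> z0 u; have -> : D1 = fun z => (-1) * (0 : K) + 0.
    by apply: funext => z; rewrite z0 mulr0 addr0.
  by rewrite (lin (fun _ => 0) (fun _ => 0)) // scaleN1r addNr.
case: (proportional hD hD') => [D0|[c cE]].
  rewrite !(nabla0 D) // n0 // subrr; apply: nabla0 => z.
  by rewrite D0 (_ : D z = 0) // (derivation0 hD') subrr.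
have D'E : D' = fun z => c * D z + 0 by apply: funext => z; rewrite cE addr0.
have nD' u : nabla D' u = c *: nabla D u.
  by rewrite D'E lin // (nabla0 (fun _ => 0)) // addr0.
rewrite !nD' nL // addrK.
have -> : (fun z => D (D' z) - D' (D z)) = fun z => D c * D z + 0.
  by apply: funext => z; rewrite !cE (derivationM hD) addr0; ring.
by rewrite lin // (nabla0 (fun _ => 0)) // addr0.
Qed.

End NablaExists.

Section LatticeStability.
Variables (R : realType) (n : nat) (W : finGroupType).
Local Notation C := R[i].
Variables (d : cherednik_datum R n W) (W' : {group W}) (M : lmodType (Hc d)).
Variables (K : fieldType) (iota : {rmorphism C -> K}) (f : 'cV[K]_n).
Local Notation E := (base_change iota f M).
Local Notation ten := (@ten R n W d K iota f M).
Local Notation refl := (reflections (rep d)).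
Local Notation alpha s := (map_mx iota (dual_root d s)).
Variable nabla : (K -> K) -> E -> E.
Hypothesis dunkl : dunkl_connection W' nabla.
Hypothesis f_out : forall s, s \in refl -> s \notin W' -> pairing f (alpha s) != 0.
Hypothesis dependent : forall z1 z2 : K,
  exists2 q : {poly {poly C}}, q != 0 & (map_poly (poly_eval iota z1) q).[z2] = 0.
Variables (O : K -> Prop) (hO : place iota O).

(** Divisibility in a valuation ring is a total order, so one of 1 and the elements of [s] has the
    worst pole. *)
Lemma common_pole (s : seq K) : exists2 g, g != 0 & forall x, x \in s -> O (x / g).
Proof.
elim: s => [|x s [g g0 gP]]; first by exists 1 => //; exact: oner_neq0.
case: (pselect (O (x / g))) => [Ox|nOx].
  by exists g => // y; rewrite inE => /orP[/eqP->//|/gP].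
have x0 : x != 0.
  by apply/eqP => x0; apply: nOx; rewrite x0 mul0r; exact: (place0 hO).
exists x => // y; rewrite inE => /orP[/eqP->|/gP Oy].
  by rewrite divff //; exact: (place1 hO).
have Ogx : O (g / x) by rewrite -invf_div; exact: (ideal_place (ideal_inv hO nOx)).
have -> : y / x = y / g * (g / x) by rewrite mulrA divfK.
exact: (placeM hO).
Qed.

(* With [g] a common pole of the coordinates, the lattice is spanned by the     *)
(* [g^l (x) v] for words [v] of length [l]; applying [y] lowers the filtration  *)
(* and thereby compensates the pole of [D f].                                   *)
Lemma category_O_regular_at : category_O M -> regular_at iota O nabla.
Proof.
move=> /category_O_words [k [u [N [nil gen]]]].
have [flat nablaT] := dunkl.
have [g g0 gP] := common_pole (codom (fun i => f i 0)).
pose J : finType := (N.-bseq 'I_n * W * 'I_k)%type.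
pose v (j : J) : M := hY_word d j.1.1 *: (hW d j.1.2 *: u j.2).
pose b (j : J) : E := g ^+ size j.1.1 *: ten (v j).
have gX l : g ^+ l != 0 by rewrite expf_neq0.
have [|r [e [e_basis e_gen b_lattice]]] := lattice_basis hO (J := J) (g := b).
  move=> x; have [m|c ->] := base_change_span (g := v) _ x.
    exact: pspan_finite (gen m).
  exists (fun j => c j / g ^+ size j.1.1); apply: eq_bigr => j _.
  by rewrite /b scalerA divfK.
exists r, e; split=> // D hD mD.
have LD x y : lattice O e x -> lattice O e y -> lattice O e (x + y).
  move=> [a [Oa ->]] [a' [Oa' ->]]; exists (fun i => a i + a' i); split.
    by move=> i; apply: (placeD hO).
  by rewrite -big_split; apply: eq_bigr => i _; rewrite scalerDl.
have LZ a x : O a -> lattice O e x -> lattice O e (a *: x).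
  move=> Oa [c [Oc ->]]; exists (fun i => a * c i); split.
    by move=> i; apply: (placeM hO).
  by rewrite scaler_sumr; apply: eq_bigr => i _; rewrite scalerA.
have L0 : lattice O e 0.
  exists (fun _ => 0); split=> [_|]; first exact: (place0 hO).
  by rewrite big1 // => i _; rewrite scale0r.
have LN x : lattice O e x -> lattice O e (- x).
  by move=> Lx; rewrite -scaleN1r; apply: (LZ) => //; apply: (placeN hO); exact: (place1 hO).
have Lsum (I : finType) (P : pred I) (F : I -> E) :
    (forall i, P i -> lattice O e (F i)) -> lattice O e (\sum_(i | P i) F i).
  by move=> h; elim/big_ind: _ => //.
have Lword l w : (l <= N)%N -> cspan (word_level u l) w -> lattice O e (g ^+ l *: ten w).
  move=> lN; elim=> [|x y _ hx _ hy|a _ [s [w' [j [sl ->]]]]].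
  - by rewrite ten0 scaler0.
  - by rewrite tenD scalerDr; exact: LD.
  rewrite ten_hC [g ^+ l *: _]scalerA [g ^+ l * _]mulrC -[_ *: ten _]scalerA; apply: (LZ); first exact: (placeC hO).
  have sN : (size s <= N)%N by rewrite sl.
  by have := b_lattice (Bseq sN, w', j); rewrite /b /= sl.
have log z : z != 0 -> O (D z / z) by exact: (log_derivative dependent hO hD mD).
(* As D z / z lies in [O], differentiating a coordinate does not worsen its pole. *)
have Df i : O (D (f i 0) / g).
  case: (eqVneq (f i 0) 0) => [->|fi0].
    by rewrite (derivation0 hD) mul0r; exact: (place0 hO).
  have -> : D (f i 0) / g = D (f i 0) / f i 0 * (f i 0 / g) by rewrite mulrA divfK.
  by apply: (placeM hO); [exact: log | apply: gP; exact: (codom_f (fun i => f i 0))].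
have [nD nL _ _] := flat.
have Lb j : lattice O e (nabla D (b j)).
  set l := size j.1.1; have lN : (l <= N)%N by exact: size_bseq.
  have vl : cspan (word_level u l) (v j).
    by apply: cspan_id; exists j.1.1, j.1.2, j.2.
  rewrite /b nL // -/l; apply: (LD).
    rewrite -[D _](divfK (gX l)) -scalerA; apply: (LZ); first exact: log.
    exact: Lword.
  rewrite nablaT // scalerBr; apply: (LD).
    rewrite scaler_sumr; apply: (Lsum) => i _; rewrite mxE scalerA.
    (* A new letter raises the level by one, and the extra factor [g] absorbs the pole of D f; at
       level [N] the longer word is zero. *)
    case: (ltnP l N) => [lN'|Nl].
      have -> : g ^+ l * D (f i 0) = D (f i 0) / g * g ^+ l.+1.
        by rewrite exprS mulrA divfK // mulrC.
      by rewrite -scalerA; apply: (LZ) => //; apply: (Lword) => //; exact: word_level_hY.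
    rewrite /v scalerA -hY_word_cons nil ?ten0 ?scaler0 //.
    by rewrite (leq_trans Nl).
  apply: (LN); rewrite scaler_sumr; apply: (Lsum) => s; rewrite inE => /andP[sW' hs].
  rewrite scalerA mulrC -scalerA; apply: (LZ).
    rewrite (derivation_pairing _ hD) -!mulrA [iota (2 / _) * _]mulrC !mulrA -[_ * D _ / _]mulrA.
    apply: (placeM hO); last exact: (placeC hO).
    by apply: (placeM hO); [exact: (placeC hO) | apply: (log); exact: f_out].
  rewrite scalerBl scale1r tenB scalerBr; apply: (LD).
    by apply: (Lword) => //; exact: word_level_hW.
  by apply: (LN); exact: Lword.
move=> x [a [Oa ->]].
have nsum : nabla D (\sum_i a i *: e i) = \sum_i nabla D (a i *: e i).
  apply: (big_morph (nabla D) (nD _ hD)).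
  by rewrite -[X in nabla D X](scale0r 0) nL // scaler0 scale0r addr0.
rewrite nsum; apply: (Lsum) => i _; rewrite nL //.
have [j ->] := e_gen i; apply: (LD); apply: (LZ) => //.
by apply: (placeDer hO hD mD).
Qed.

End LatticeStability.

Section Forward.
Variables (R : realType) (n : nat) (W : finGroupType).
Local Notation C := R[i].
Variables (d : cherednik_datum R n W) (W' : {group W}) (M : lmodType (Hc d)).

Lemma pairing_map_mx (A B : comNzRingType) (g : {rmorphism A -> B}) (y : 'cV[A]_n) x :
  pairing (map_mx g y) (map_mx g x) = g (pairing y x).
Proof. by rewrite /pairing -map_mxM mxE. Qed.

(** Closed points decide, through [finite_type_point], which forms alpha_s vanish on the curve:
    exactly those with [s] in W'. This gives the connection, and the lattice works at every
    place. *)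
Lemma category_O_has_regular_singularities : category_O M -> has_regular_singularities W' M.
Proof.
move=> MO A iota f smooth imm str iotaK.
have dep := fun z1 z2 => smooth_curve_dependence z1 z2 smooth.
have ev_pairing (ev : {rmorphism A -> C}) s : is_point iota ev ->
    ev (pairing f (map_mx iota (dual_root d s))) = pairing (map_mx ev f) (dual_root d s).
  move=> hev; rewrite -pairing_map_mx -map_mx_comp; congr pairing.
  by apply/matrixP => i j; rewrite mxE /= hev.
have stab (ev : {rmorphism A -> C}) s : is_point iota ev -> s \in reflections (rep d) ->
    (s \in W') <-> pairing (map_mx ev f) (dual_root d s) = 0.
  move=> hev hs; rewrite -reflection_fixes //.
  have := str ev hev; rewrite /stratum => /setP /(_ s); rewrite inE => <-.
  by split=> /eqP.
have fK s : pairing (map_mx (@tofrac A) f) (map_mx iotaK (dual_root d s)) =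
    tofrac (pairing f (map_mx iota (dual_root d s))).
  by rewrite -pairing_map_mx -map_mx_comp.
have [ft _] := smooth.
have f_in s : s \in reflections (rep d) -> s \in W' ->
    pairing (map_mx (@tofrac A) f) (map_mx iotaK (dual_root d s)) = 0.
  move=> hs sW'; rewrite fK; apply/eqP; rewrite tofrac_eq0; apply: contrapT => /negP h.
  have [ev hev /eqP] := finite_type_point ft h; apply.
  by rewrite ev_pairing //; apply/stab.
have f_out s : s \in reflections (rep d) -> s \notin W' ->
    pairing (map_mx (@tofrac A) f) (map_mx iotaK (dual_root d s)) != 0.
  move=> hs sW'; rewrite fK tofrac_eq0.
  have [ev hev _] := finite_type_point ft (oner_neq0 A).
  apply: contraNneq sW' => h; apply/(stab ev s hev hs).
  by rewrite -ev_pairing // h rmorph0.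
have [|nabla hnabla] := @dunkl_connection_exists R n W d W' M _ iotaK _ f_in f_out.
  by move=> D D'; exact: derivations_proportional.
exists nabla; split=> // O hO _.
exact: (category_O_regular_at hnabla f_out dep hO MO).
Qed.

End Forward.

(** * Regularity along punctured lines *)

Section RationalFunctions.
Variables (R : realType) (K : fieldType) (tau : {rmorphism {poly R[i]} -> K}).
Local Notation C := R[i].
Hypothesis tau_inj : injective tau.
Hypothesis tau_quot : forall z : K, exists p q : {poly C}, q != 0 /\ z = tau p / tau q.
Let iota : {rmorphism C -> K} := tau \o @polyC C.

Lemma tau_eq0 p : (tau p == 0) = (p == 0).
Proof. by rewrite -(rmorph0 tau) (inj_eq tau_inj). Qed.

Lemma tau_ratio p q r s : q != 0 -> s != 0 -> tau p / tau q = tau r / tau s -> p * s = r * q.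
Proof.
move=> q0 s0 /eqP; rewrite eqr_div ?tau_eq0 // -!rmorphM => /eqP.
exact: tau_inj.
Qed.

(** The valuation ring at infinity of the projective line, [K] being the field of rational functions
    presented by [tau]. *)
Definition degree_place (z : K) : Prop :=
  exists p q : {poly C}, [/\ q != 0, (size p <= size q)%N & z = tau p / tau q].

Lemma degree_placeE p q : q != 0 -> degree_place (tau p / tau q) <-> (size p <= size q)%N.
Proof.
move=> q0; split=> [[r [s [s0 rs /(tau_ratio q0 s0) E]]]|pq]; last by exists p, q.
case: (eqVneq p 0) => [->|p0]; first by rewrite size_poly0.
have r0 : r != 0 by apply: contraNneq p0 => r0; move/eqP: E; rewrite r0 mul0r mulf_eq0 (negbTE s0) orbF.
have := congr1 (fun u : {poly C} => size u) E; rewrite !size_mul // => sE.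
have := size_poly_gt0 p; have := size_poly_gt0 s; have := size_poly_gt0 r; have := size_poly_gt0 q.
rewrite p0 s0 r0 q0; move: sE rs; move: (size p) (size q) (size r) (size s) => a b c e.
by lia.
Qed.

Lemma degree_ideal p q : q != 0 ->
  place_ideal degree_place (tau p / tau q) <-> (size p < size q)%N.
Proof.
move=> q0; rewrite /place_ideal degree_placeE //.
case: (eqVneq p 0) => [->|p0].
  rewrite size_poly0 rmorph0 mul0r size_poly_gt0 q0; split=> // _.
  by split=> //; left.
rewrite invf_div degree_placeE //; split=> [[_ [/eqP|/negP]]|].
- by rewrite mulf_eq0 invr_eq0 !tau_eq0 (negbTE p0) (negbTE q0).
- by rewrite -ltnNge.
by move=> pq; rewrite (ltnW pq); split=> //; right; apply/negP; rewrite -ltnNge.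
Qed.

Lemma degree_place_is_place : place iota degree_place.
Proof.
split=> [c|a b [p [q [q0 pq ->]]] [r [s [s0 rs ->]]]|z|].
- exists c%:P, 1; rewrite oner_neq0 rmorph1 divr1 size_poly1 size_polyC.
  by split=> //; case: (c == 0).
- split.
    exists (p * s - r * q), (q * s); rewrite mulf_neq0 //; split=> //; last first.
      rewrite rmorphB !rmorphM mulrBl; congr (_ - _); rewrite invfM.
        by rewrite mulrACA divff ?tau_eq0 // mulr1.
      by rewrite [_^-1 * _]mulrC mulrACA divff ?tau_eq0 // mulr1.
    rewrite (leq_trans (size_polyD _ _)) // size_polyN geq_max (size_mul q0 s0).
    have := size_polyMleq p s; have := size_polyMleq r q; move: pq rs.
    move: (size p) (size q) (size r) (size s) (size (p * s)) (size (r * q)) => a' b' c' e' x y.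
    by move=> *; apply/andP; split; lia.
  exists (p * r), (q * s); rewrite mulf_neq0 //; split=> //.
    have := size_polyMleq p r; rewrite (size_mul q0 s0); move: pq rs.
    by move: (size p) (size q) (size r) (size s) (size (p * r)) => a' b' c' e' x *; lia.
  by rewrite !rmorphM invfM mulrACA.
- have [p [q [q0 ->]]] := tau_quot z; rewrite invf_div degree_placeE //.
  case: (leqP (size p) (size q)) => pq; first by left.
  right; exists q, p; split=> //; last exact: ltnW.
  by rewrite -size_poly_gt0 (leq_ltn_trans _ pq).
exists (tau 'X); rewrite -[tau 'X]divr1 -(rmorph1 tau) degree_placeE ?oner_neq0 //.
by rewrite size_polyX size_poly1.
Qed.

Lemma tau_size p N o : degree_place o -> tau p = tau 'X^N * o -> (size p <= N.+1)%N.
Proof.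
move=> [r [s [s0 rs ->]]] E; have Es : p * s = 'X^N * r.
  by apply: tau_inj; rewrite !rmorphM E -mulrA divfK // tau_eq0.
case: (eqVneq p 0) => [->|p0]; first by rewrite size_poly0.
have r0 : r != 0 by apply: contraNneq p0 => r0; move/eqP: Es; rewrite r0 mulr0 mulf_eq0 (negbTE s0) orbF.
have := congr1 (fun u : {poly C} => size u) Es; rewrite /= (size_mul p0 s0) (size_mul (monic_neq0 (monicXn _ _)) r0) size_polyXn.
have := size_poly_gt0 p; have := size_poly_gt0 s; have := size_poly_gt0 r.
rewrite p0 s0 r0; move: rs; move: (size p) (size r) (size s) => a b c.
by lia.
Qed.

Lemma degree_bounded (J : finType) (a : J -> K) :
  exists N, forall j, exists2 o, degree_place o & a j = tau 'X^N * o.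
Proof.
have /choice [p /choice [q pq]] : forall j, exists p q : {poly C}, q != 0 /\ a j = tau p / tau q.
  by move=> j; exact: tau_quot.
exists (\max_j size (p j)) => j; have [q0 aE] := pq j.
have X0 N : ('X^N : {poly C}) != 0 by rewrite monic_neq0 ?monicXn.
exists (tau (p j) / tau ('X^(\max_j size (p j)) * q j)); last first.
  by rewrite rmorphM invfM aE mulrCA mulVKf // tau_eq0.
exists (p j), ('X^(\max_j size (p j)) * q j); split=> //.
  by rewrite mulf_neq0.
rewrite (size_mul (X0 _) q0) size_polyXn addSn /=.
by apply: leq_trans (leq_addr _ _); exact: (leq_bigmax (F := fun j => size (p j))).
Qed.

(** The quotient rule does not depend on the representing fraction; the derivatives enter as formal
    letters. *)
Lemma ratio_derivative (T : comNzRingType) (p q r s p' q' r' s' : T) :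
  p * s = r * q -> p' * s + p * s' = r' * q + r * q' ->
  (p' * q - p * q') * (s * s) = (r' * s - r * s') * (q * q).
Proof.
move=> E E'; have -> : (p' * q - p * q') * (s * s) =
  (p' * s + p * s') * (q * s) - (p * s) * (q * s') - (p * s) * (s * q') by ring.
by rewrite E' E; ring.
Qed.

(** This is t d/dt, extended by the quotient rule; it preserves the ideal at infinity because it
    does not raise degrees. *)
Lemma euler_derivation : exists D : K -> K, [/\ derivation iota D,
  forall p, D (tau p) = tau ('X * p^`())
  & forall z, place_ideal degree_place z -> place_ideal degree_place (D z)].
Proof.
have /choice [num /choice [den nd]] := tau_quot.
pose num2 p q : {poly C} := 'X * (p^`() * q - p * q^`()).
have key p q r s : q != 0 -> s != 0 -> tau p / tau q = tau r / tau s ->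
    tau (num2 p q) / tau (q * q) = tau (num2 r s) / tau (s * s).
  move=> q0 s0 /(tau_ratio q0 s0) E; apply/eqP; rewrite eqr_div ?tau_eq0 ?mulf_neq0 //.
  rewrite -!rmorphM /num2 -!['X * _ * _]mulrA (ratio_derivative (r' := r^`()) (s' := s^`()) E) //.
  by have := congr1 (fun u : {poly C} => u^`()) E; rewrite !derivM.
pose D z := tau (num2 (num z) (den z)) / tau (den z * den z).
have DE p q : q != 0 -> D (tau p / tau q) = tau (num2 p q) / tau (q * q).
  move=> q0; have [d0 E] := nd (tau p / tau q).
  by rewrite /D; apply: key => //; rewrite -E.
have Dtau p : D (tau p) = tau ('X * p^`()).
  rewrite -[tau p]divr1 -(rmorph1 tau) DE ?oner_neq0 // /num2 !mulr1 -polyC1 derivC.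
  by rewrite mulr0 subr0 rmorph1 divr1.
exists D; split=> // [|z].
  split=> [z w|z w|c].
  - have [p [q [q0 ->]]] := tau_quot z; have [r [s [s0 ->]]] := tau_quot w.
    have -> : tau p / tau q + tau r / tau s = tau (p * s + r * q) / tau (q * s).
      by rewrite addf_div ?tau_eq0 // rmorphD !rmorphM.
    rewrite !DE ?mulf_neq0 // /num2 !(derivM, derivD) !(rmorphM, rmorphB, rmorphD).
    have := q0; have := s0; rewrite -!tau_eq0.
    move: (tau p) (tau q) (tau r) (tau s) (tau p^`()) (tau q^`()) (tau r^`()) (tau s^`()) (tau 'X).
    by move=> a b c e a' b' c' e' x e0 b0; field; rewrite e0 b0.
  - have [p [q [q0 ->]]] := tau_quot z; have [r [s [s0 ->]]] := tau_quot w.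
    have -> : tau p / tau q * (tau r / tau s) = tau (p * r) / tau (q * s).
      by rewrite mulf_div !rmorphM.
    rewrite !DE ?mulf_neq0 // /num2 !(derivM, derivD) !(rmorphM, rmorphB, rmorphD).
    have := q0; have := s0; rewrite -!tau_eq0.
    move: (tau p) (tau q) (tau r) (tau s) (tau p^`()) (tau q^`()) (tau r^`()) (tau s^`()) (tau 'X).
    by move=> a b c e a' b' c' e' x e0 b0; field; rewrite e0 b0.
  - by rewrite /iota /= Dtau derivC mulr0 rmorph0.
have [p [q [q0 ->]]] := tau_quot z; rewrite DE // !degree_ideal ?mulf_neq0 // => pq.
rewrite (size_mul q0 q0) /num2 ['X * _]mulrC; case: (eqVneq p 0) => [->|p0].
  rewrite deriv0 !mul0r subr0 mul0r size_poly0.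
  by move: pq; case: (size q) => // k; rewrite addnS.
set u := p^`() * q - p * q^`(); case: (eqVneq u 0) => [->|u0].
  by rewrite mul0r size_poly0; move: pq; case: (size q) => // k; rewrite addnS.
rewrite size_mulX //.
have := size_polyD (p^`() * q) (- (p * q^`())); rewrite size_polyN -/u.
have := size_polyMleq p^`() q; have := size_polyMleq p q^`().
have := lt_size_deriv p0; have := lt_size_deriv q0; move: pq.
move: (size p) (size q) (size p^`()) (size q^`()) (size (p^`() * q)) (size (p * q^`())).
by move: (size u) => a b c e f g h *; lia.
Qed.

End RationalFunctions.

Section PuncturedLine.
Variable R : realType.
Local Notation C := R[i].

Lemma point_ideal_sqZ (A : idomainType) (ev : {rmorphism A -> C}) (b a : A) :
  point_ideal_sq ev a -> point_ideal_sq ev (b * a).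
Proof.
move=> [s [sP ->]]; exists [seq (b * u.1, u.2) | u <- s]; split.
  by move=> _ /mapP[u us ->] /=; have [h1 h2] := sP u us; rewrite rmorphM h1 mulr0 h2.
by rewrite big_map mulr_sumr; apply: eq_bigr => u _; rewrite mulrA.
Qed.

(* The curve [Spec C[t, t^-1]].                                                 *)
Lemma punctured_line : exists (A : idomainType) (iota : {rmorphism C -> A}) (t : A),
  [/\ smooth_affine_curve iota,
    forall ev : {rmorphism A -> C}, is_point iota ev -> ev t != 0,
    forall ev : {rmorphism A -> C}, is_point iota ev -> forall c, c != 0 ->
      ~ point_ideal_sq ev (iota c * t - iota (ev (iota c * t))),
    injective (poly_eval iota t)
    & forall a : A, exists p k, a * t ^+ k = poly_eval iota t p].
Proof.
pose F := {fraction {poly C}}; pose fr : {rmorphism {poly C} -> F} := @tofrac {poly C}.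
have fX k : fr 'X^k != 0 by rewrite tofrac_eq0 monic_neq0 ?monicXn.
pose P (z : F) := exists p k, z * fr 'X^k = fr p.
have hP : subring_pred P.
  split=> [|a b [p [k E]] [q [l E']]|a b [p [k E]] [q [l E']]].
  - by exists 1, 0%N; rewrite expr0 mul1r.
  - exists (p * 'X^l - q * 'X^k), (k + l)%N.
    by rewrite exprD rmorphB !rmorphM -E -E'; ring.
  - by exists (p * q), (k + l)%N; rewrite exprD !rmorphM -E -E'; ring.
pose A := subdomain hP; pose incl := subdomain_incl hP.
have incl_inj : injective incl by exact: subdomain_incl_inj.
have Pfr p : P (fr p) by exists p, 0%N; rewrite expr0 rmorph1 mulr1.
have [iota iotaE] : exists iota : {rmorphism C -> A},
    iota =1 fun c => subdomain_elt hP (Pfr c%:P).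
  apply: rmorphism_of_fun => [x y|x y|]; apply: incl_inj.
  - by rewrite [RHS]rmorphD -[LHS]/(fr _) rmorphD rmorphD.
  - by rewrite [RHS]rmorphM -[LHS]/(fr _) rmorphM rmorphM.
  - by rewrite [RHS]rmorph1 -[LHS]/(fr _) rmorph1.
have incli c : incl (iota c) = fr c%:P by rewrite iotaE.
pose t : A := subdomain_elt hP (Pfr 'X).
have PV : P (fr 'X)^-1.
  by exists 1, 1%N; rewrite expr1 mulVf ?rmorph1 // -['X]expr1.
pose tV : A := subdomain_elt hP PV.
have ttV : t * tV = 1.
  apply: incl_inj; rewrite rmorphM rmorph1 -[incl t]/(fr 'X) -[incl tV]/((fr 'X)^-1).
  by rewrite divff // -['X]expr1.
have inclp p : incl (poly_eval iota t p) = fr p.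
  elim/poly_ind: p => [|p c IH]; first by rewrite poly_eval0 !rmorph0.
  by rewrite poly_evalD poly_evalM poly_evalX poly_evalC !rmorphD !rmorphM IH incli.
have Aelt (a : A) : exists p k, a * t ^+ k = poly_eval iota t p.
  have [p [k E]] := subdomain_inclP a; exists p, k; apply: incl_inj.
  by rewrite inclp -E rmorphM rmorphXn [incl t ^+ k](_ : _ = fr 'X^k) ?rmorphXn.
have Aelt' (a : A) : exists p k, a = poly_eval iota t p * tV ^+ k.
  have [p [k E]] := Aelt a; exists p, k.
  by rewrite -E -mulrA -exprMn ttV expr1n mulr1.
have pinj : injective (poly_eval iota t).
  by move=> p q /(congr1 incl); rewrite !inclp => /eqP; rewrite tofrac_eq => /eqP.
have ev_t (ev : {rmorphism A -> C}) : is_point iota ev -> ev t != 0.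
  move=> _; apply/eqP => h; have := congr1 ev ttV.
  by rewrite rmorphM h mul0r rmorph1 => /eqP; rewrite eq_sym oner_eq0.
have ev_p (ev : {rmorphism A -> C}) p : is_point iota ev -> ev (poly_eval iota t p) = p.[ev t].
  move=> hev; elim/poly_ind: p => [|p c IH]; first by rewrite poly_eval0 rmorph0 horner0.
  by rewrite poly_evalD poly_evalM poly_evalX poly_evalC rmorphD rmorphM IH hev !hornerE.
(* Point ideals of C[t, 1/t] are generated by t - ev(t); hence [nsq], as that generator is not a
   multiple of its own square. *)
have divide (ev : {rmorphism A -> C}) a : is_point iota ev -> ev a = 0 ->
    exists b, a = (t - iota (ev t)) * b.
  move=> hev; have [p [k ->]] := Aelt' a; rewrite rmorphM ev_p // => /eqP.
  rewrite mulf_eq0 => /orP[|/eqP h]; last first.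
    have := congr1 (fun x => ev (x ^+ k)) ttV.
    by rewrite exprMn rmorphM h mulr0 expr1n rmorph1 => /eqP; rewrite eq_sym oner_eq0.
  move=> /factor_theorem [q ->]; exists (poly_eval iota t q * tV ^+ k).
  by rewrite poly_evalM poly_evalB poly_evalX poly_evalC; ring.
have nsq (ev : {rmorphism A -> C}) : is_point iota ev ->
    ~ point_ideal_sq ev (t - iota (ev t)).
  move=> hev [s [sP E]].
  have [w wE] : exists w, \sum_(u <- s) u.1 * u.2 = (t - iota (ev t)) * (t - iota (ev t)) * w.
    elim: s sP {E} => [|u s IH] sP; first by exists 0; rewrite big_nil mulr0.
    have [|w wE] := IH; first by move=> v vs; apply: sP; rewrite inE vs orbT.
    have [/(divide _ _ hev) [b1 E1] /(divide _ _ hev) [b2 E2]] := sP u (mem_head _ _).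
    by exists (b1 * b2 + w); rewrite big_cons wE E1 E2; ring.
  have t0 : t - iota (ev t) != 0.
    apply/eqP => /(congr1 incl); rewrite rmorphB incli rmorph0 -[incl t]/(fr 'X) -rmorphB => /eqP.
    by rewrite tofrac_eq0 polyXsubC_eq0.
  move: E; rewrite wE -mulrA -[X in X = _]mulr1 => /(mulfI t0) /(congr1 ev).
  by rewrite rmorph1 rmorphM rmorphB hev subrr mul0r => /eqP; rewrite oner_eq0.
exists A, iota, t; split=> //; last first.
  move=> ev hev c c0; rewrite [ev _]rmorphM hev [iota (c * _)]rmorphM -mulrBr.
  move=> /(point_ideal_sqZ (iota c^-1)); rewrite mulrA -rmorphM mulVf // rmorph1 mul1r.
  exact: nsq.
split.
  exists 2%N, (fun i => if i == 0 :> nat then t else tV) => a.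
  have [p [k ->]] := Aelt' a.
  pose X0 : {mpoly C[2]} := 'X_(inord 0); pose X1 : {mpoly C[2]} := 'X_(inord 1).
  exists ((map_poly (@mpolyC 2 C) p).[X0] * X1 ^+ k).
  rewrite rmorphM rmorphXn /= mmapX mmap1U inordK //=; congr (_ * _).
  elim/poly_ind: p => [|p c IH]; first by rewrite poly_eval0 map_poly0 horner0 raddf0.
  rewrite poly_evalD poly_evalM poly_evalX poly_evalC IH rmorphD rmorphM /= map_polyX map_polyC.
  by rewrite !hornerE raddfD /= rmorphM /= mmapC mmapX mmap1U inordK.
move=> ev hev; exists (t - iota (ev t)); split; first by rewrite rmorphB hev subrr.
  exact: nsq.
move=> a /(divide _ _ hev) [b ->]; exists (ev b).
exists [:: (t - iota (ev t), b - iota (ev b))]; split.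
  by move=> u; rewrite inE => /eqP-> /=; rewrite !rmorphB !hev !subrr.
by rewrite big_seq1 /= [RHS]mulrBr [iota (ev b) * _]mulrC.
Qed.

End PuncturedLine.

Section RegularLine.
Variables (R : realType) (n : nat) (W : finGroupType).
Local Notation C := R[i].
Variables (d : cherednik_datum R n W) (W' : {group W}) (M : lmodType (Hc d)).
Local Notation refl := (reflections (rep d)).

(* The operator inducing the covariant derivative along the Euler field.        *)
Definition euler_nabla : Hc d :=
  euler_vector d + \sum_(s in refl :\: W') hC d (kappa d s) * (hW d s - 1).

(** Regularity at infinity of the curve t |-> t v gives a lattice stable under t d/dt, which acts on
    1 (x) m as [euler_nabla]. All iterates of [m] stay in t^N times this lattice, and the functional
    induced by [kap] turns this into a bound on degrees. *)
Lemma regular_on_line (v : 'cV[C]_n) (kap : M -> {poly C}) :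
  has_regular_singularities W' M -> stabiliser (rep d) v = W' -> v != 0 ->
  {morph kap : m m' / m + m'} ->
  (forall p m, kap (hPoly d p *: m) = mmap (@polyC C) (fun i => v i 0 *: 'X) p * kap m) ->
  forall m, exists N, forall k, (size (kap (euler_nabla ^+ k *: m)) <= N)%N.
Proof.
move=> reg stv v0 kapD kapP m.
have [A [iota [t [smooth ev_t imm pinj Aelt]]]] := punctured_line R.
pose f : 'cV[A]_n := \col_i (iota (v i 0) * t).
have [pe peE] := poly_eval_morphism iota t.
have peC c : pe c%:P = iota c by rewrite peE poly_evalC.
have pe_inj : injective pe by move=> p q; rewrite !peE; exact: pinj.
pose tau : {rmorphism {poly C} -> {fraction A}} := @tofrac A \o pe.
have tau_inj : injective tau by move=> p q /(@tofrac_inj A)/pe_inj.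
have t0 : t != 0.
  rewrite -(poly_evalX iota t) -peE -(rmorph0 pe) (inj_eq pe_inj).
  by rewrite -size_poly_eq0 size_polyX.
have tau_quot z : exists p q : {poly C}, q != 0 /\ z = tau p / tau q.
  have [a [b [b0 ->]]] := fractionP z.
  have [p [k Ep]] := Aelt a; have [q [l Eq]] := Aelt b.
  have q0 : q != 0.
    apply: contraNneq b0 => q0; move/eqP: Eq; rewrite q0 poly_eval0 mulf_eq0 expf_eq0 (negbTE t0) andbF orbF.
    by [].
  exists (p * 'X^l), (q * 'X^k); split; first by rewrite mulf_neq0 // monic_neq0 ?monicXn.
  have tX : pe 'X = t by rewrite peE poly_evalX.
  have tk j : tofrac t ^+ j != 0 by rewrite expf_neq0 // tofrac_eq0.
  rewrite /tau /= !rmorphM !rmorphXn /= tX !peE -Ep -Eq !rmorphM !rmorphXn /=.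
  apply/eqP; rewrite eqr_div ?mulf_neq0 ?tofrac_eq0 ?tk //; apply/eqP.
  by ring.
pose K := {fraction A}.
pose iotaK : {rmorphism C -> K} := @tofrac A \o iota.
have iotaKE c : iotaK c = tau c%:P by rewrite /iotaK /= -peC.
have fi i : map_mx (@tofrac A) f i 0 = tau (v i 0 *: 'X).
  by rewrite !mxE /tau /= -mul_polyC [pe _]rmorphM peC [pe _]peE poly_evalX.
have stab (ev : {rmorphism A -> C}) : is_point iota ev -> map_mx ev f = ev t *: v.
  by move=> hev; apply/colP => i; rewrite !mxE rmorphM hev mulrC.
have imm_f : immersion iota f.
  move=> ev hev; have [i vi] : exists i, v i 0 != 0.
    apply: contrapT => h; case/eqP: v0; apply/colP => i; rewrite mxE.
    by apply/eqP; apply: contrapT => /negP ?; apply: h; exists i.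
  by exists i; rewrite mxE; exact: imm.
have str : morphism_to_stratum d W' iota f.
  move=> ev hev; rewrite /stratum stab // -stv; apply/setP => w; rewrite !inE /act_h -scalemxAr.
  by rewrite (inj_eq (scalerI (ev_t ev hev))).
have [nabla [[flat nablaT] regO]] := reg A iota f smooth imm_f str.
have placeO : place iotaK (degree_place tau).
  have [h1 h2 h3 h4] := degree_place_is_place tau_inj tau_quot.
  by split=> // c; rewrite iotaKE; exact: h1.
have [D [D_der Dtau Dm]] := euler_derivation tau_inj tau_quot.
have hD : derivation iotaK D.
  have [h1 h2 h3] := D_der; split=> // c.
  by rewrite iotaKE; exact: h3.
have [|r [e [e_basis stable]]] := regO _ placeO.
  exists t; rewrite -(poly_evalX iota t) -peE -[tofrac _]/(tau 'X) => -[p [q [q0 pq E]]].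
  have h : 'X * q = p :> {poly C}.
    by apply: (tau_inj); rewrite rmorphM E divfK // (tau_eq0 tau_inj).
  by move: pq; rewrite -h mulrC size_mulX // ltnn.
have {stable} stable := stable D hD Dm.
pose E := base_change iotaK (map_mx (@tofrac A) f) M.
pose tn : M -> E := @ten R n W d K iotaK (map_mx (@tofrac A) f) M.
have mmapK p : mmap iotaK (fun i => map_mx (@tofrac A) f i 0) p =
    tau (mmap (@polyC C) (fun i => v i 0 *: 'X) p).
  rewrite -mmap_in_image; apply: eq_bigr => m' _; rewrite iotaKE; congr (_ * _).
  by rewrite /mmap1; apply: eq_bigr => i _; rewrite fi.
have [L [LD LZ Lt]] : exists L : E -> K^o, [/\ {morph L : x y / x + y},
    forall b x, L (b *: x) = b *: L x & forall m, L (tn m) = tau (kap m)].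
  apply: base_change_universal => [x y|p x]; first by rewrite kapD rmorphD.
  by rewrite kapP rmorphM mmapK.
(* The parametrisation is homogeneous of degree one, so D f = f and the factors alpha_s(f) cancel in
   the formula. *)
have Df : map_mx D (map_mx (@tofrac A) f) = map_mx (@tofrac A) f.
  apply/colP => i; rewrite mxE fi Dtau -mul_polyC derivM derivC mul0r add0r derivX mulr1.
  by rewrite mulrC.
have nabla_euler x : nabla D (tn x) = tn (euler_nabla *: x).
  rewrite nablaT // Df /nabla_formula /euler_nabla scalerDl /euler_vector !scaler_suml.
  rewrite /tn tenD !ten_sum -sumrN; congr (_ + _).
    by apply: eq_bigr => i _; rewrite -scalerA -hPolyX ten_hPoly mmapX mmap1U.
  apply: eq_bigr => s; rewrite inE => /andP[sW' hs].
  rewrite -[(hC d _ * _) *: _]scalerA ten_hC -scaleNr; congr (_ *: _).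
  have -> : pairing (map_mx (@tofrac A) f) (map_mx iotaK (dual_root d s)) =
      tau (pairing v (dual_root d s) *: 'X).
    rewrite pairing_map /pairing mxE scaler_suml rmorph_sum; apply: eq_bigr => i _.
    by rewrite fi iotaKE -rmorphM /= -!mul_polyC mulrC mulrA -polyCM.
  have ps0 : pairing v (dual_root d s) != 0.
    apply: contraNneq sW' => /(reflection_fixes hs) h.
    by rewrite -stv inE; apply/eqP.
  rewrite mulrAC mulfK; last first.
    by rewrite (tau_eq0 tau_inj) scaler_eq0 negb_or ps0 -size_poly_eq0 size_polyX.
  rewrite -rmorphM -rmorphN; congr (iotaK _); rewrite /kappa.
  by rewrite mulrA [_ * 2]mulrC.
have [nD nL _ _] := flat.
(* Twisting by t^N only adds [N] to the operator, so t^N times the lattice is stable too. *)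
have nabla_lattice x N : lattice (degree_place tau) e x ->
    exists2 y, lattice (degree_place tau) e y & nabla D (tau 'X^N *: x) = tau 'X^N *: y.
  move=> Lx; exists (N%:R *: x + nabla D x); last first.
    rewrite nL // Dtau scalerDr scalerA; congr (_ *: _ + _).
    rewrite derivXn -mulr_natr mulrA rmorphM rmorph_nat.
    by case: (N) => [|N']; rewrite ?mulr0 // -exprS.
  have [a [Oa xE]] := Lx; have [b [Ob ->]] := stable x Lx; rewrite xE.
  exists (fun i => N%:R * a i + b i); split=> [i|].
    apply: (placeD placeO) => //; apply: (placeM placeO) => //.
    by rewrite -(rmorph_nat iotaK); exact: (placeC placeO).
  rewrite scaler_sumr -big_split; apply: eq_bigr => i _.
  by rewrite scalerDl scalerA.
have [a [mE _]] := e_basis (tn m).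
have [N NP] := degree_bounded tau_inj tau_quot (fun i => a 0 i).
have /choice [o oP] : forall i, exists o, degree_place tau o /\ a 0 i = tau 'X^N * o.
  by move=> i; have [o h1 h2] := NP i; exists o.
have powers k : exists2 x, lattice (degree_place tau) e x &
    tn (euler_nabla ^+ k *: m) = tau 'X^N *: x.
  elim: k => [|k [x Lx xE]].
    exists (\sum_i o i *: e i); first by exists o; split=> // i; case: (oP i).
    rewrite expr0 scale1r mE scaler_sumr; apply: eq_bigr => i _.
    by rewrite scalerA; case: (oP i) => _ ->.
  rewrite exprS -scalerA -nabla_euler xE.
  by have [y Ly yE] := nabla_lattice x N Lx; exists y.
have [N' N'P] := degree_bounded tau_inj tau_quot (fun i => L (e i) : K).
exists (N + N').+1 => k; have [x [b [Ob xE]] kE] := powers k.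
have L0 : L 0 = 0 by rewrite -(scale0r 0) LZ scale0r.
have [u Ou uE] : exists2 u, degree_place tau u & L x = tau 'X^N' * u.
  have /choice [w wP] : forall i, exists o, degree_place tau o /\ L (e i) = tau 'X^N' * o.
    by move=> i; have [w h1 h2] := N'P i; exists w.
  exists (\sum_i b i * w i).
    apply: (place_sum placeO) => i _; apply: (placeM placeO) => //.
    by case: (wP i).
  rewrite xE (big_morph L LD L0) mulr_sumr; apply: eq_bigr => i _.
  by rewrite LZ; case: (wP i) => _ ->; rewrite mulrCA.
apply: (tau_size tau_inj Ou); rewrite -Lt kE LZ uE exprD rmorphM.
by rewrite -mulrA.
Qed.

End RegularLine.

(** * Restriction to the fixed space *)

Section Projection.
Variables (R : realType) (n : nat) (W : finGroupType).
Local Notation C := R[i].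
Variables (d : cherednik_datum R n W) (W' : {group W}).
Local Notation rho := (rep d).
Local Notation fixed := (fixed_points rho W').

Definition average : 'M[C]_n := #|W'|%:R^-1 *: \sum_(w in W') rho w.

Lemma card_neq0 : #|W'|%:R != 0 :> C.
Proof. by rewrite pnatr_eq0 -lt0n cardG_gt0. Qed.

Lemma average_id v : fixed v -> average *m v = v.
Proof.
move=> fv; rewrite -scalemxAl mulmx_suml.
rewrite (eq_bigr (fun _ => v)) => [|w wW']; last exact: fv.
by rewrite sumr_const -[v *+ _]scaler_nat scalerA mulVf ?scale1r // card_neq0.
Qed.

Lemma average_fixed u : fixed (average *m u).
Proof.
move=> w wW'; rewrite /act_h mulmxA; congr (_ *m _).
rewrite -scalemxAr mulmx_sumr; congr (_ *: _).
rewrite [RHS](reindex_inj (mulgI w)) /=; apply: eq_big => [v|v _].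
  by rewrite groupMl.
by rewrite rhoM.
Qed.

Lemma averageK : average *m average = average.
Proof.
apply/row_matrixP => i; apply/trmx_inj/colP => j.
have := average_id (average_fixed (delta_mx j 0)).
by move=> /colP /(_ i); rewrite mulmxA -!colE !mxE.
Qed.

(* Restriction of polynomials to the fixed space, followed by pullback along    *)
(* the projection onto it.                                                      *)
Fact pull_key : unit. Proof. exact: tt. Qed.
Definition pull : {mpoly C[n]} -> {mpoly C[n]} := locked_with pull_key
  (mmap (@mpolyC n C) (fun i => linear_form (delta_mx 0 i *m average))).

Lemma pullE : pull = mmap (@mpolyC n C) (fun i => linear_form (delta_mx 0 i *m average)).
Proof. by rewrite /pull unlock. Qed.

Fact pull_zmod_morphism : zmod_morphism pull.
Proof. by rewrite pullE; exact: rmorphB. Qed.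
Fact pull_monoid_morphism : monoid_morphism pull.
Proof. by rewrite pullE; split; [exact: rmorph1 | exact: rmorphM]. Qed.
HB.instance Definition _ := GRing.isZmodMorphism.Build _ _ pull pull_zmod_morphism.
HB.instance Definition _ := GRing.isMonoidMorphism.Build _ _ pull pull_monoid_morphism.

Lemma pullD p q : pull (p + q) = pull p + pull q. Proof. exact: rmorphD. Qed.
Lemma pullB p q : pull (p - q) = pull p - pull q. Proof. exact: rmorphB. Qed.
Lemma pullM p q : pull (p * q) = pull p * pull q. Proof. exact: rmorphM. Qed.
Lemma pull0 : pull 0 = 0. Proof. exact: rmorph0. Qed.
Lemma pull1 : pull 1 = 1. Proof. exact: rmorph1. Qed.
Lemma pullC c : pull c%:MP = c%:MP. Proof. by rewrite pullE mmapC. Qed.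
Lemma pullX i : pull 'X_i = linear_form (delta_mx 0 i *m average).
Proof. by rewrite pullE mmapX mmap1U. Qed.
Lemma pull_sum (J : Type) (r : seq J) (P : pred J) (F : J -> {mpoly C[n]}) :
  pull (\sum_(j <- r | P j) F j) = \sum_(j <- r | P j) pull (F j).
Proof. exact: (big_morph pull pullD pull0). Qed.
Lemma pull_prod (J : Type) (r : seq J) (P : pred J) (F : J -> {mpoly C[n]}) :
  pull (\prod_(j <- r | P j) F j) = \prod_(j <- r | P j) pull (F j).
Proof. exact: (big_morph pull pullM pull1). Qed.

Lemma pull_linear_form x : pull (linear_form x) = linear_form (x *m average).
Proof.
rewrite [in LHS]/linear_form pull_sum {2}[x](matrix_sum_delta x) big_ord1.
rewrite mulmx_suml linear_sum; apply: eq_bigr => i _.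
by rewrite -mul_mpolyC pullM pullC pullX mul_mpolyC -(scalemxAl (x 0 i)) linearZ_LR.
Qed.

Lemma meval_pull p (u : 'cV[C]_n) :
  (pull p).@[fun i => u i 0] = p.@[fun i => (average *m u) i 0].
Proof.
rewrite pullE meval_comp; apply: meval_eq => i; rewrite meval_linear_form.
by rewrite /pairing -mulmxA -rowE mxE.
Qed.

Lemma pullK p : pull (pull p) = pull p.
Proof.
elim/mpoly_alg_ind: p => [c|i|p q IHp IHq|p q IHp IHq].
- by rewrite !pullC.
- by rewrite pullX pull_linear_form -mulmxA averageK.
- by rewrite (pullD p q) (pullD (pull p)) IHp IHq.
- by rewrite (pullM p q) (pullM (pull p)) IHp IHq.
Qed.

(** These span the row space of 1 - [average], that is, the linear forms vanishing on the fixed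
    space. *)
Definition normal_form (i : 'I_n) : 'rV[C]_n := delta_mx 0 i - delta_mx 0 i *m average.

Lemma pull_normal_form i : pull (linear_form (normal_form i)) = 0.
Proof.
by rewrite pull_linear_form mulmxBl -mulmxA averageK subrr linear0.
Qed.

(** Hence the kernel of [pull], the ideal of the fixed space, is generated by the normal forms. *)
Lemma pull_decomposition p :
  exists q : 'I_n -> {mpoly C[n]}, p = pull p + \sum_i linear_form (normal_form i) * q i.
Proof.
elim/mpoly_alg_ind: p => [c|i|p p' [q E] [q' E']|p p' [q E] [q' E']].
- by exists (fun _ => 0); rewrite pullC big1 ?addr0 // => i _; rewrite mulr0.
- exists (fun j => if j == i then 1 else 0).
  have -> : \sum_j linear_form (normal_form j) * (if j == i then 1 else 0) =
      linear_form (normal_form i).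
    rewrite (eq_bigr (fun j => if j == i then linear_form (normal_form j) else 0)).
      by rewrite -big_mkcond big_pred1_eq.
    by move=> j _; case: (j == i); rewrite ?mulr1 ?mulr0.
  by rewrite pullX linearB /= linear_form_delta addrC subrK.
- exists (fun j => q j + q' j); rewrite {1}E {1}E' pullD addrACA -big_split; congr (_ + _).
  by apply: eq_bigr => j _; rewrite mulrDr.
exists (fun j => q j * p' + pull p * q' j).
rewrite {1}E mulrDl {1}E' mulrDr pullM -addrA; congr (_ + _).
rewrite addrC mulr_suml mulr_sumr -big_split; apply: eq_bigr => j _ /=.
by rewrite [RHS]mulrDr; congr (_ + _); [rewrite mulrA | exact: mulrCA].
Qed.

Lemma pull_prime : prime_ideal (fun p => pull p = 0).
Proof.
split=> [|/eqP|a b ha hb|a b hb|a b /eqP].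
- exact: pull0.
- by rewrite pull1 oner_eq0.
- by rewrite pullB ha hb subrr.
- by rewrite pullM hb mulr0.
- by rewrite pullM mulf_eq0 => /orP[]/eqP; [left|right].
Qed.

Lemma pull_neq0_point p : pull p <> 0 -> exists2 v, fixed v & p.@[fun i => v i 0] != 0.
Proof.
move=> /eqP /mpoly_neq0_point [u pu]; pose u' : 'cV[C]_n := \col_i u i.
exists (average *m u'); first exact: average_fixed.
rewrite -meval_pull (@meval_eq _ _ _ u) // => i; by rewrite mxE.
Qed.

Lemma pull_fixed p v : fixed v -> (pull p).@[fun i => v i 0] = p.@[fun i => v i 0].
Proof. by move=> fv; rewrite meval_pull average_id. Qed.

Definition restrict_line (v : 'cV[C]_n) : {mpoly C[n]} -> {poly C} :=
  mmap (@polyC C) (fun i => v i 0 *: 'X).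

Lemma restrict_line_pull v p : restrict_line v (pull p) = restrict_line (average *m v) p.
Proof.
rewrite /restrict_line pullE mmap_comp; apply: eq_bigr => m _; congr (_ * _).
apply: eq_bigr => i _; congr (_ ^+ _).
rewrite (_ : mmap _ _ _ = mmap (@polyC C) (fun k => (\col_k' (v k' 0 *: 'X)) k 0) (linear_form (delta_mx 0 i *m average))); last first.
  by apply: eq_bigr => m' _; congr (_ * _); apply: eq_bigr => k _; rewrite mxE.
rewrite mmap_linear_form -rowE /pairing mxE.
have -> : (average *m v) i 0 = \sum_k average i k * v k 0 by rewrite mxE.
rewrite scaler_suml; apply: eq_bigr => k _.
have -> : map_mx (@polyC C) (row i average) 0 k = (average i k)%:P by rewrite 2!mxE.
by rewrite [fun_of_matrix (\col_ _ _) _ _]mxE mul_polyC scalerA.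
Qed.

End Projection.

(** * Degrees on lines and their uniform bounds *)

Section HomogeneousParts.
Variables (R : realType) (n : nat).
Local Notation C := R[i].

Lemma restrict_lineD (v : 'cV[C]_n) p q :
  restrict_line v (p + q) = restrict_line v p + restrict_line v q.
Proof. exact: rmorphD. Qed.
Lemma restrict_lineM (v : 'cV[C]_n) p q :
  restrict_line v (p * q) = restrict_line v p * restrict_line v q.
Proof. exact: rmorphM. Qed.

Lemma restrict_line_coef (v : 'cV[C]_n) p e :
  (restrict_line v p)`_e = (pihomog mdeg e p).@[fun i => v i 0].
Proof.
have E m : mmap1 (fun i => v i 0 *: 'X : {poly C}) m =
    (\prod_(i < n) v i 0 ^+ m i) *: 'X^(mdeg m).
  rewrite /mmap1 mdegE; elim: (index_enum _) => [|i s IH].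
    by rewrite !big_nil scale1r expr0.
  by rewrite !big_cons IH exprZn -scalerAl -scalerAr scalerA -exprD.
rewrite pihomogE raddf_sum big_mkcond /= /restrict_line /mmap coef_sum.
apply: eq_bigr => m _; rewrite E coefCM coefZ coefXn eq_sym.
case: eqP => _; last by rewrite !mulr0.
by rewrite mulr1 mevalZ mevalX.
Qed.

Lemma pihomog_lead (p : {mpoly C[n]}) : p != 0 -> pihomog mdeg (msize p).-1 p != 0.
Proof.
move=> p0; apply/eqP => /(congr1 (mcoeff (mlead p))).
rewrite pihomogE raddf_sum mcoeff0 /= big_mkcond (bigD1_seq (mlead p)) ?msupp_uniq ?mlead_supp //=.
rewrite -(mlead_deg p0) eqxx mcoeffZ mcoeffX eqxx mulr1 big1 => [|m /negbTE h]; last first.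
  by rewrite mcoeffZ mcoeffX h mulr0; case: eqP.
by rewrite addr0 => /eqP; rewrite mleadc_eq0 (negbTE p0).
Qed.

End HomogeneousParts.

Section UniformBound.
Variables (R : realType) (n : nat) (W : finGroupType).
Local Notation C := R[i].
Variables (d : cherednik_datum R n W) (W' : {group W}) (M : lmodType (Hc d)).
Local Notation pull := (pull d W').

(* The degrees are bounded on every line of the stratum; if they were not       *)
(* uniformly bounded, some line would avoid the zeros of countably many leading *)
(* forms of unbounded degree.                                                   *)
Lemma degree_uniformly_bounded (v0 : 'cV[C]_n) (kap : M -> {mpoly C[n]}) :
  has_regular_singularities W' M -> stabiliser (rep d) v0 = W' ->
  {morph kap : m m' / m + m'} -> (forall p m, kap (hPoly d p *: m) = pull p * kap m) ->
  (forall m, pull (kap m) = kap m) ->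
  forall m, exists N, forall k, (msize (kap (euler_nabla d W' ^+ k *: m)) <= N)%N.
Proof.
move=> reg st kapD kapP kapK m; apply: contrapT => unbounded.
have /choice [k kP] : forall N, exists k, (N < msize (kap (euler_nabla d W' ^+ k *: m)))%N.
  move=> N; apply: contrapT => h; apply: unbounded; exists N => k.
  by rewrite leqNgt; apply/negP => ?; apply: h; exists k.
pose q N := kap (euler_nabla d W' ^+ k N *: m).
have q0 N : q N != 0 by rewrite -msize_poly_eq0 -lt0n (leq_trans _ (kP N)).
pose lead N := pihomog mdeg (msize (q N)).-1 (q N).
have fix0 : fixed_points (rep d) W' v0.
  by move=> w; rewrite -st inE => /eqP.
(* For [w] outside W' some coordinate of w v0 - v0 is nonzero; composed with the projection it is a
   linear form, and [w] moves the projection of any vector at which this form is nonzero. *)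
have /choice [l lP] : forall w, exists l : {mpoly C[n]}, w \notin W' ->
    l != 0 /\ forall u : 'cV[C]_n, l.@[fun i => u i 0] != 0 ->
      act_h (rep d) w (average d W' *m u) != average d W' *m u.
  move=> w; case: (boolP (w \in W')) => wW; first by exists 0.
  have : act_h (rep d) w v0 != v0 by move: wW; rewrite -st inE.
  have lE i (u : 'cV[C]_n) : (pull (linear_form (delta_mx 0 i *m (rep d w - 1%:M)))).@[fun i => u i 0] =
      (act_h (rep d) w (average d W' *m u) - average d W' *m u) i 0.
    rewrite meval_pull meval_linear_form /pairing -mulmxA -rowE mxE.
    by rewrite mulmxBl mul1mx.
  move=> h; have [i hi] : exists i, (act_h (rep d) w v0 - v0) i 0 != 0.
    apply: contrapT => h'; case/eqP: h; apply/eqP; rewrite -subr_eq0; apply/eqP/colP => i.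
    by rewrite [RHS]mxE; apply/eqP; apply: contrapT => /negP ?; apply: h'; exists i.
  exists (pull (linear_form (delta_mx 0 i *m (rep d w - 1%:M)))) => _; split.
    by apply: contraNneq hi => l0; rewrite -{1 2}(average_id fix0) -lE l0 meval0.
  by move=> u; rewrite lE; apply: contraNneq => ->; rewrite subrr mxE.
pose F := \prod_(w | w \notin W') l w.
have F0 : F != 0 by apply/prodf_neq0 => w /lP [].
have [|u' u'P] := mpoly_avoid_point (p := fun N => F * lead N).
  by move=> N; apply: mpoly_neq0_point; rewrite mulf_neq0 // pihomog_lead.
pose u : 'cV[C]_n := \col_i u' i.
have uE p : p.@[u'] = p.@[fun i => u i 0] by apply: meval_eq => i; rewrite mxE.
pose v := average d W' *m u.
have fv : fixed_points (rep d) W' v by exact: average_fixed.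
have Fu : F.@[fun i => u i 0] != 0.
  by have := u'P 0%N; rewrite uE mevalM mulf_eq0 negb_or => /andP[].
have leadu N : (restrict_line v (q N))`_(msize (q N)).-1 != 0.
  have := u'P N; rewrite uE mevalM mulf_eq0 negb_or => /andP[_].
  by rewrite -restrict_line_pull kapK restrict_line_coef.
have stv : stabiliser (rep d) v = W'.
  apply/setP => w; rewrite inE; apply/idP/idP => [|/fv /eqP //].
  apply: contraLR => wW; apply: (lP w wW).2.
  move: Fu; rewrite /F (big_morph (meval _) (mevalM _) (meval1 _)) => /prodf_neq0.
  exact.
have v0' : v != 0.
  apply/eqP => v00; have := leadu 1%N.
  have -> : restrict_line v (q 1%N) = ((restrict_line v (q 1%N))`_0)%:P.
    rewrite v00 /restrict_line; elim/mpoly_alg_ind: (q 1%N) => [c|i|x y hx hy|x y hx hy].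
    - by rewrite mmapC coefC.
    - by rewrite mmapX mmap1U mxE scale0r coef0.
    - by rewrite raddfD /= hx hy -polyCD coefC.
    - by rewrite rmorphM /= hx hy -polyCM coefC.
  rewrite coefC; case: ifP => [/eqP h _|_]; last by rewrite eqxx.
  by move: (kP 1%N) h; rewrite -/(q 1%N); case: (msize _) => [|[|s]].
have [|p m'|B BP] := regular_on_line (kap := restrict_line v \o kap) reg stv v0' _ _ m.
- by move=> x y /=; rewrite kapD restrict_lineD.
- by rewrite /= kapP restrict_lineM restrict_line_pull average_id.
(* With [B] the bound on this line, the [B]-th chosen iterate has a nonzero coefficient in some
   degree at least [B]. *)
have := leadu B; rewrite -/(restrict_line v _) => /negP; apply.
rewrite nth_default // (leq_trans (BP (k B))) // -ltnS prednK; last first.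
  by rewrite (leq_trans _ (kP B)).
exact: kP.
Qed.

End UniformBound.

Section RestrictedCoordinates.
Variables (R : realType) (n : nat) (W : finGroupType).
Local Notation C := R[i].
Variables (d : cherednik_datum R n W) (W' : {group W}) (M : lmodType (Hc d)).
Local Notation pull := (pull d W').
Local Notation hPoly := (hPoly d).
Local Notation normal i := (linear_form (normal_form d W' i)).

(** The submodule I M, with I the ideal of the fixed space. *)
Definition normal_span (m : M) : Prop :=
  exists u : 'I_n -> M, m = \sum_i hPoly (normal i) *: u i.

(* The kernel of the map from M to the generic fibre of its restriction to the  *)
(* fixed space.                                                                 *)
Definition generically_zero (m : M) : Prop :=
  exists2 p, pull p <> 0 & normal_span (hPoly p *: m).

Lemma normal_spanD m m' : normal_span m -> normal_span m' -> normal_span (m + m').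
Proof.
move=> [u ->] [u' ->]; exists (fun i => u i + u' i); rewrite -big_split.
by apply: eq_bigr => i _; rewrite scalerDr.
Qed.

Lemma normal_span_hPoly p m : normal_span m -> normal_span (hPoly p *: m).
Proof.
move=> [u ->]; exists (fun i => hPoly p *: u i); rewrite scaler_sumr.
by apply: eq_bigr => i _; rewrite !scalerA hPoly_comm.
Qed.

Lemma pull_mul_neq0 p q : pull p <> 0 -> pull q <> 0 -> pull (p * q) <> 0.
Proof. by move=> hp hq; have [_ _ _ _ h] := pull_prime d W'; case/h. Qed.

Lemma generically_zeroD m m' :
  generically_zero m -> generically_zero m' -> generically_zero (m + m').
Proof.
move=> [p hp hm] [p' hp' hm']; exists (p * p'); first exact: pull_mul_neq0.
rewrite hPolyM scalerDr -[_ *: m']scalerA hPoly_comm -[_ *: m]scalerA.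
by apply: normal_spanD; apply: normal_span_hPoly.
Qed.

Lemma generically_zero_hPoly q m :
  generically_zero m -> generically_zero (hPoly q *: m).
Proof.
move=> [p hp hm]; exists p => //; rewrite scalerA hPoly_comm -scalerA.
exact: normal_span_hPoly.
Qed.

Lemma generically_zero_cancel q m :
  pull q <> 0 -> generically_zero (hPoly q *: m) -> generically_zero m.
Proof.
move=> hq [p hp]; rewrite scalerA -hPolyM => h; exists (p * q) => //.
exact: pull_mul_neq0.
Qed.

Lemma generically_zero_ideal p m : pull p = 0 -> generically_zero (hPoly p *: m).
Proof.
move=> hp; exists 1; first by rewrite pull1; apply/eqP; exact: oner_neq0.
rewrite hPoly1 scale1r; have [q ->] := pull_decomposition d W' p.
exists (fun i => hPoly (q i) *: m); rewrite hp add0r hPoly_sum scaler_suml.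
by apply: eq_bigr => i _; rewrite hPolyM scalerA.
Qed.

Lemma generically_zero0 : generically_zero 0.
Proof. by rewrite -(scale0r 0) -(hPoly0 d); apply: generically_zero_ideal; exact: pull0. Qed.

Lemma generically_zeroB m m' :
  generically_zero m -> generically_zero m' -> generically_zero (m - m').
Proof.
move=> hm /(generically_zero_hPoly (-1)); rewrite hPolyN hPoly1 scaleN1r.
exact: generically_zeroD.
Qed.

Lemma generically_zero_sum (J : finType) (P : pred J) (F : J -> M) :
  (forall j, P j -> generically_zero (F j)) -> generically_zero (\sum_(j | P j) F j).
Proof.
move=> h; elim/big_ind: _ => //; first exact: generically_zero0.
exact: generically_zeroD.
Qed.

(* The coordinates, up to a common denominator, with respect to a maximal       *)
(* subset of generators which is independent in the generic fibre.              *)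
Lemma restricted_coordinates : coh M ->
  exists (J : finType) (kap : J -> M -> {mpoly C[n]}),
    [/\ forall j, {morph kap j : m m' / m + m'},
        forall j p m, kap j (hPoly p *: m) = pull p * kap j m,
        forall j m, pull (kap j m) = kap j m
      & forall m, (forall j, kap j m = 0) -> generically_zero m].
Proof.
move=> [k [g gen]].
pose comb (Z : {set 'I_k}) (c : 'I_k -> {mpoly C[n]}) : M := \sum_(i in Z) hPoly (c i) *: g i.
pose indep (Z : {set 'I_k}) := `[< forall c, generically_zero (comb Z c) ->
  forall i, i \in Z -> pull (c i) = 0 >].
have combD Z c c' : comb Z (fun i => c i + c' i) = comb Z c + comb Z c'.
  by rewrite -big_split; apply: eq_bigr => i _ /=; rewrite hPolyD scalerDl.
have combM Z p c : comb Z (fun i => p * c i) = hPoly p *: comb Z c.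
  by rewrite scaler_sumr; apply: eq_bigr => i _ /=; rewrite hPolyM scalerA.
have [|Z /maxsetP [/asboolP indZ maxZ]] := @ex_maxset _ indep.
  by exists (finset.set0)%SET; apply/asboolP => c _ i; rewrite inE.
(* Adding [j] to the maximal [Z] creates a relation; if its coefficient at [j] were generically
   zero, it would be a relation within [Z]. *)
have /choice [q0 q0P] : forall j, exists q, pull q <> 0 /\
    exists c, generically_zero (hPoly q *: g j - comb Z c).
  move=> j; case: (boolP (j \in Z)) => jZ.
    exists 1; split; first by rewrite pull1; apply/eqP; exact: oner_neq0.
    exists (fun i => if i == j then 1 else 0); rewrite /comb (bigD1 j) //= eqxx big1 => [|i].
      by rewrite addr0 subrr; exact: generically_zero0.
    by move=> /andP[_ /negbTE ->]; rewrite hPoly0 scale0r.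
  have nind : ~ indep (j |: Z).
    move=> /maxZ /(_ (subsetU1 j Z)) /setP /(_ j).
    by rewrite !inE eqxx (negbTE jZ).
  have [c hc [i iZ ci]] : exists2 c, generically_zero (comb (j |: Z) c) &
      exists2 i, i \in j |: Z & pull (c i) <> 0.
    apply: contrapT => h; apply: nind; apply/asboolP => c hc i iZ.
    by apply: contrapT => ci; apply: h; exists c => //; exists i.
  have E : comb (j |: Z) c = hPoly (c j) *: g j + comb Z c.
    by rewrite /comb big_setU1.
  exists (c j); split=> [cj|].
    have hZ : generically_zero (comb Z c).
      rewrite -[comb Z c](addrK (hPoly (c j) *: g j)) addrC [X in _ + X]addrC -E addrC.
      by apply: generically_zeroB => //; exact: generically_zero_ideal.
    apply: ci; move: iZ; rewrite in_setU1 => /orP[/eqP -> //|]; exact: indZ.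
  exists (fun i => -1 * c i); rewrite combM hPolyN hPoly1 scaleN1r opprK -E.
  exact: hc.
pose q := \prod_j q0 j.
have hq : pull q <> 0.
  by rewrite pull_prod; apply/eqP/prodf_neq0 => j _; apply/eqP; case: (q0P j).
have /choice [c cP] : forall m, exists c, generically_zero (hPoly q *: m - comb Z c).
  pose D m := exists c, generically_zero (hPoly q *: m - comb Z c).
  have DD m m' : D m -> D m' -> D (m + m').
    move=> [c hc] [c' hc']; exists (fun i => c i + c' i).
    by rewrite combD scalerDr opprD addrACA; exact: generically_zeroD.
  have DP p m : D m -> D (hPoly p *: m).
    move=> [c hc]; exists (fun i => p * c i).
    rewrite combM scalerA hPoly_comm -scalerA -scalerBr.
    exact: generically_zero_hPoly.
  have Dg j : D (g j).
    have [_ [c hc]] := q0P j; exists (fun i => (\prod_(l | l != j) q0 l) * c i).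
    rewrite combM /q (bigD1 j) //= mulrC hPolyM -scalerA -scalerBr.
    exact: generically_zero_hPoly.
  move=> m; have [p ->] := gen m; rewrite -/(D _).
  elim/big_ind: _ => [|x y|i _]; [|exact: DD|exact: DP].
  exists (fun _ => 0); rewrite scaler0 /comb big1 ?subr0; first exact: generically_zero0.
  by move=> i _; rewrite hPoly0 scale0r.
(* Independence of [Z] makes coordinates unique after [pull], whence their additivity and
   linearity. *)
have cU m (c' : 'I_k -> {mpoly C[n]}) : generically_zero (hPoly q *: m - comb Z c') ->
    forall i, i \in Z -> pull (c m i) = pull (c' i).
  move=> h i iZ; apply/eqP; rewrite -subr_eq0 -pullB; apply/eqP.
  apply: (indZ (fun i => c m i - c' i)) => //.
  have -> : comb Z (fun i => c m i - c' i) = hPoly q *: m - comb Z c' - (hPoly q *: m - comb Z (c m)).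
    rewrite opprB [RHS]addrC addrA subrK -[- comb Z c']scaleN1r -(hPoly1 d) -hPolyN.
    rewrite -combM -combD /comb.
    by apply: eq_bigr => l _; rewrite mulN1r.
  exact: generically_zeroB.
exists 'I_k, (fun i m => if i \in Z then pull (c m i) else 0); split.
- move=> j m m'; case: ifP => [jZ|_]; last by rewrite addr0.
  rewrite (cU _ (fun i => c m i + c m' i)) ?pullD // combD scalerDr opprD addrACA.
  exact: generically_zeroD.
- move=> j p m; case: ifP => [jZ|_]; last by rewrite mulr0.
  rewrite (cU _ (fun i => p * c m i)) ?pullM // combM scalerA hPoly_comm -scalerA -scalerBr.
  exact: generically_zero_hPoly.
- by move=> j m; case: ifP => _; [exact: pullK | exact: pull0].
move=> m hm; apply: (generically_zero_cancel hq).
rewrite -[_ *: m](subrK (comb Z (c m))); apply: generically_zeroD => //.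
apply: generically_zero_sum => i iZ; apply: generically_zero_ideal.
by have := hm i; rewrite iZ.
Qed.

End RestrictedCoordinates.

(** * Polynomials in the Euler element *)

Section EulerFinite.
Variables (R : realType) (n : nat) (W : finGroupType).
Local Notation C := R[i].
Variable d : cherednik_datum R n W.
Local Notation hC := (hC d).
Local Notation euler := (euler d).

Definition euler_prod (s : seq C) : Hc d := \prod_(a <- s) (euler - hC a).

Lemma euler_prod_cons a s : euler_prod (a :: s) = (euler - hC a) * euler_prod s.
Proof. by rewrite /euler_prod big_cons. Qed.

Lemma euler_prod_expand s : euler_prod s =
  \sum_(i < (size s).+1) hC (\prod_(a <- s) ('X - a%:P))`_i * euler ^+ i.
Proof.
elim: s => [|a s IH].
  by rewrite /euler_prod !big_nil big_ord1 coef1 expr0 mulr1.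
rewrite euler_prod_cons IH big_cons; set P := \prod_(b <- s) _.
have PS : P`_(size s).+1 = 0 by rewrite nth_default // size_prod_XsubC.
rewrite (eq_bigr (fun i : 'I_(size s).+2 =>
    hC ('X * P)`_i * euler ^+ i - hC a * (hC P`_i * euler ^+ i))) => [|i _].
  rewrite sumrB -mulr_sumr [X in _ = X - _]big_ord_recl [X in _ = _ - _ * X]big_ord_recr /=.
  rewrite coefXM hC0 mul0r add0r PS hC0 mul0r addr0 mulrBl mulr_sumr; congr (_ - _).
  by apply: eq_bigr => i _; rewrite coefXM /= exprS !mulrA hC_comm.
by rewrite mulrBl coefB coefCM hCB hCM mulrBl mulrA.
Qed.

End EulerFinite.

Section RegularEulerFinite.
Variables (R : realType) (n : nat) (W : finGroupType).
Local Notation C := R[i].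
Variables (d : cherednik_datum R n W) (W' : {group W}) (M : lmodType (Hc d)).
Local Notation hC := (hC d).
Local Notation hW := (hW d).
Local Notation hPoly := (hPoly d).
Local Notation euler := (euler d).
Local Notation pull := (pull d W').
Local Notation theta := (euler_nabla d W').
Local Notation generically_zero := (@generically_zero R n W d W' M).

(** The vectors lie in a space of dimension [L], so L + 1 of them are dependent; the coefficients
    come from the left kernel of their matrix. *)
Lemma bounded_dependence (J : finType) (N : nat) (kap : nat -> J -> {mpoly C[n]}) :
  (forall k j, (msize (kap k j) <= N)%N) ->
  exists p : {poly C}, p != 0 /\ forall j, \sum_(k < size p) p`_k *: kap k j = 0.
Proof.
move=> bnd; pose L := #|{: J * 'X_{1..n < N}}|.
pose A : 'M[C]_(L.+1, L) :=
  \matrix_(k < L.+1, l < L) (kap k (enum_val l).1)@_((enum_val l).2).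
have : nz_row (kermx A) != 0.
  by rewrite nz_row_eq0 kermx_eq0 /row_free neq_ltn ltnS rank_leq_col.
have /sub_kermxP := nz_row_sub (kermx A); move: (nz_row _) => u uA u0.
pose p := \poly_(k < L.+1) u 0 (inord k).
have pE (k : 'I_L.+1) : p`_k = u 0 k by rewrite coef_poly ltn_ord inord_val.
exists p; split=> [|j].
  apply: contraNneq u0 => p0; apply/eqP/rowP => k.
  by rewrite -pE p0 coef0 mxE.
have -> : \sum_(k < size p) p`_k *: kap k j = \sum_(k < L.+1) p`_k *: kap k j.
  rewrite (big_ord_widen L.+1 (fun k => p`_k *: kap k j)) ?size_poly // big_mkcond.
  by apply: eq_bigr => k _; case: ltnP => // h; rewrite nth_default // scale0r.
apply/mpolyP => m; rewrite raddf_sum mcoeff0 /=; case: (ltnP (mdeg m) N) => hm.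
  have := congr1 (fun B : 'rV_L => B 0 (enum_rank (j, BMultinom hm))) uA.
  rewrite mxE [RHS]mxE; apply: etrans; apply: eq_bigr => k _.
  by rewrite mcoeffZ pE mxE enum_rankK.
apply: big1 => k _; rewrite mcoeffZ memN_msupp_eq0 ?mulr0 //.
apply: contraL hm => /msize_mdeg_lt h; rewrite -ltnNge.
exact: leq_trans h (bnd k j).
Qed.

Lemma euler_nabla_sub_comm : euler * (theta - euler) = (theta - euler) * euler.
Proof.
have -> : theta - euler =
    \sum_(s in reflections (rep d) :\: W') hC (kappa d s) * (hW s - 1)
    - \sum_(s in reflections (rep d)) hC (kappa d s) * hW s.
  by rewrite /euler_nabla /euler opprD addrACA subrr add0r.
rewrite mulrBr mulrBl !mulr_sumr !mulr_suml; congr (_ - _); apply: eq_bigr => s _.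
  by rewrite mulrA -hC_comm -!mulrA mulrBr mulrBl mulr1 mul1r euler_hW.
by rewrite mulrA -hC_comm -!mulrA euler_hW.
Qed.

(** Put z = [theta] - [euler], a combination of group elements commuting with [euler], hence with
    [theta]. Expanding ([theta] - z)^k, the factors z move to the right and act through W. *)
Lemma euler_pow_span (m : M) k : cspan (fun v => exists l w, v = theta ^+ l *: (hW w *: m))
  (euler ^+ k *: m).
Proof.
set S := (fun v => _).
have zS v : cspan S v -> cspan S ((theta - euler) *: v).
  elim=> [|x y _ hx _ hy|a _ [l [w ->]]].
  - by rewrite scaler0; exact: cspan0.
  - by rewrite scalerDr; exact: cspanD.
  rewrite scalerA -hC_comm -scalerA; apply: cspanZ.
  have -> : (theta - euler) *: (theta ^+ l *: (hW w *: m)) =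
      theta ^+ l *: ((theta - euler) *: (hW w *: m)).
    move: (hW w *: m) => v'; rewrite 2!scalerA; congr (_ *: _); apply: commrX.
    rewrite (_ : GRing.comm _ theta = GRing.comm (theta - euler) (theta - euler + euler)).
      by apply: commrD => //; exact/esym/euler_nabla_sub_comm.
    by rewrite subrK.
  have -> : theta - euler =
      \sum_(s in reflections (rep d) :\: W') hC (kappa d s) * (hW s - 1)
      - \sum_(s in reflections (rep d)) hC (kappa d s) * hW s.
    by rewrite /euler_nabla /euler opprD addrACA subrr add0r.
  have hS b s : cspan S (theta ^+ l *: (hC b * hW s *: (hW w *: m))).
    rewrite !scalerA mulrA -hC_comm -!mulrA -hWM; rewrite -2!scalerA; apply: cspan_gen.
    by exists l, (s * w)%g.
  rewrite scalerBl scalerBr; apply: cspanD; last apply: cspanN.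
    rewrite scaler_suml scaler_sumr; apply: cspan_sum => s _.
    rewrite mulrBr scalerBl scalerBr; apply: cspanD; first exact: hS.
    by apply: cspanN; rewrite -(hW1 d); exact: hS.
  by rewrite scaler_suml scaler_sumr; apply: cspan_sum => s _; exact: hS.
have tS v : cspan S v -> cspan S (theta *: v).
  elim=> [|x y _ hx _ hy|a _ [l [w ->]]].
  - by rewrite scaler0; exact: cspan0.
  - by rewrite scalerDr; exact: cspanD.
  rewrite scalerA -hC_comm -scalerA; apply: cspan_gen.
  by exists l.+1, w; rewrite scalerA -exprS.
elim: k => [|k IH].
  rewrite expr0 scale1r; apply: cspan_id; exists 0%N, 1%g.
  by rewrite expr0 scale1r hW1 scale1r.
rewrite exprS -scalerA -[X in X *: _](subKr theta) scalerBl.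
by apply: cspanD; [exact: tS | apply: cspanN; exact: zS].
Qed.

(** The coordinates of all [euler ^+ k *: m] have bounded degree, thanks to the bounds for the
    finitely many translates of [m]. A dependence among them is a polynomial in [euler] killing all
    coordinates, and it splits over C. *)
Lemma regular_euler_finite (v0 : 'cV[C]_n) :
  coh M -> has_regular_singularities W' M -> stabiliser (rep d) v0 = W' ->
  forall m, exists s, generically_zero (euler_prod d s *: m).
Proof.
move=> /(@restricted_coordinates R n W d W' M) [J [kap [kapD kapP kapK kap0]]] reg st m.
have kap00 j : kap j 0 = 0 by rewrite -(scale0r m) -(hPoly0 d) kapP pull0 mul0r.
have /choice [N NP] : forall jw : J * W, exists N, forall k,
    (msize (kap jw.1 (theta ^+ k *: (hW jw.2 *: m))) <= N)%N.
  by move=> [j w]; exact: (degree_uniformly_bounded reg st).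
have bnd k j : (msize (kap j (euler ^+ k *: m)) <= \max_jw N jw)%N.
  elim: (euler_pow_span m k) => [|x y _ hx _ hy|a _ [l [w ->]]].
  - by rewrite kap00 msize0.
  - by rewrite kapD (leq_trans (msizeD_le _ _)) // geq_max hx hy.
  rewrite -hPolyC kapP pullC mul_mpolyC (leq_trans (msizeZ_le _ _)) //.
  by apply: leq_trans (NP (j, w) l) _; exact: leq_bigmax.
have [p [p0 pP]] := @bounded_dependence J _ (fun k j => kap j (euler ^+ k *: m)) bnd.
have [s ps] := closed_field_poly_normal p; exists s.
have l0 : lead_coef p != 0 by rewrite lead_coef_eq0.
have szp : size p = (size s).+1 by rewrite ps size_scale // size_prod_XsubC.
apply: kap0 => j.
have : lead_coef p *: kap j (euler_prod d s *: m) = 0.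
  rewrite -(pP j) -mul_mpolyC -(pullC d W') -kapP hPolyC euler_prod_expand szp.
  rewrite scalerA mulr_sumr scaler_suml (big_morph (kap j) (kapD j) (kap00 j)).
  apply: eq_bigr => i _; rewrite mulrA -hCM -scalerA -hPolyC kapP pullC mul_mpolyC.
  by rewrite -coefZ -ps.
by move=> /eqP; rewrite scaler_eq0 (negbTE l0) /= => /eqP.
Qed.

End RegularEulerFinite.

(** * Stalks along orbits *)

Section PrimeAvoiding.
Variable T : comNzRingType.

Definition ideal (I : T -> Prop) : Prop :=
  [/\ I 0, forall a b, I a -> I b -> I (a - b) & forall a b, I b -> I (a * b)].

Lemma ideal_closedD I a b : ideal I -> I a -> I b -> I (a + b).
Proof.
move=> [I0 IB IM] ha hb; rewrite -[b]opprK; apply: (IB) => //.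
by rewrite -sub0r; apply: IB.
Qed.

(** An ideal maximal among those containing [A] and missing [S] is prime: if two elements lie
    outside it, both enlarged ideals meet [S], and multiplying shows that the product lies outside
    as well. *)
Lemma prime_avoiding (A S : T -> Prop) :
  ideal A -> S 1 -> (forall a b, S a -> S b -> S (a * b)) -> (forall a, A a -> ~ S a) ->
  exists P, [/\ prime_ideal P, forall a, A a -> P a & forall a, P a -> ~ S a].
Proof.
move=> idA S1 SM AS.
pose good (X : set T) := ideal X /\ forall a, X a -> ~ S a.
(* Joining [A] to every set keeps the union of the empty chain admissible in Zorn's lemma. *)
pose plus (X : set T) : set T := fun a => X a \/ A a.
have [F FF tot|X [[idX XS] maxX]] := @Zorn_bigcup T (fun X => good (plus X)).
  have bigE : plus (\bigcup_(X in F) X)%classic = (fun a => A a \/ exists2 X, F X & plus X a).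
    apply/funext => a; apply/propext; split=> [[[X FX Xa]|]|[|[X FX [Xa|]]]].
    - by right; exists X => //; left.
    - by left.
    - by right.
    - by left; exists X.
    - by right.
  have [A0 AB AM] := idA.
  rewrite bigE; split; last by move=> a [/AS //|[X /FF [_ h] /h]].
  split; first by left.
    move=> a b [Aa|[X FX Xa]] [Ab|[Y FY Yb]].
    - by left; exact: AB.
    - right; exists Y => //; have [[_ h _] _] := FF _ FY; apply: h => //; by right.
    - right; exists X => //; have [[_ h _] _] := FF _ FX; apply: h => //; by right.
    have [XY|YX] := tot _ _ FX FY; right.
      exists Y => //; have [[_ h _] _] := FF _ FY; apply: (h) => //.
      by case: Xa => [/XY|]; [left|right].
    exists X => //; have [[_ h _] _] := FF _ FX; apply: (h) => //.
    by case: Yb => [/YX|]; [left|right].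
  move=> a b [Ab|[X FX Xb]]; first by left; exact: AM.
  by right; exists X => //; have [[_ _ h] _] := FF _ FX; exact: h.
pose P := plus X; have [P0 PB PM] := idX.
have ext a : ~ P a -> exists2 p, P p & exists c, S (p + c * a).
  move=> Pa; apply: contrapT => h.
  pose Y : set T := fun z => exists2 p, P p & exists c, z = p + c * a.
  have PY z : P z -> Y z by move=> Pz; exists z => //; exists 0; rewrite mul0r addr0.
  have plusY : plus Y = Y.
    apply/funext => z; apply/propext; split=> [[//|Az]|]; last by left.
    by apply: PY; right.
  apply: (maxX Y); last first.
    rewrite plusY; split; last first.
      by move=> z [p Pp [c ->]] Sz; apply: h; exists p => //; exists c.
    split; first exact: PY.
      move=> z z' [p Pp [c ->]] [p' Pp' [c' ->]]; exists (p - p'); first exact: PB.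
      by exists (c - c'); rewrite mulrBl opprD addrACA.
    move=> z z' [p Pp [c ->]]; exists (z * p); first exact: PM.
    by exists (z * c); rewrite mulrDr mulrA.
  rewrite classical_sets.properEneq; split; last by move=> z Xz; apply: PY; left.
  apply/eqP => XY; apply: Pa; left; rewrite XY; exists 0 => //.
  by exists 1; rewrite mul1r add0r.
exists P; split; last exact: XS; last by move=> a; right.
split=> //; first by move=> /XS; apply.
move=> a b Pab; apply: contrapT => /not_orP [Pa Pb].
have [p Pp [c Sc]] := ext a Pa; have [p' Pp' [c' Sc']] := ext b Pb.
apply: (XS _ _ (SM _ _ Sc Sc')); rewrite mulrDl.
apply: ideal_closedD => //; first by rewrite mulrC; exact: PM.
rewrite mulrDr; apply: ideal_closedD => //; first exact: PM.
by rewrite mulrACA; apply: PM.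
Qed.

End PrimeAvoiding.

Section GenericNilpotency.
Variables (R : realType) (n : nat) (W : finGroupType).
Local Notation C := R[i].
Variables (d : cherednik_datum R n W) (W' : {group W}) (M : lmodType (Hc d)).
Local Notation hPoly := (hPoly d).
Local Notation pull := (pull d W').
Local Notation fixed := (fixed_points (rep d) W').

Definition annihilator (p : {mpoly C[n]}) : Prop := forall m : M, hPoly p *: m = 0.

Lemma annihilator_ideal : ideal annihilator.
Proof.
split=> [m|p q hp hq m|p q hq m]; first by rewrite hPoly0 scale0r.
  by rewrite hPolyB scalerBl hp hq subr0.
by rewrite hPolyM -scalerA hq scaler0.
Qed.

(** The product of multipliers for the finitely many generators kills all of [M]. *)
Lemma local_annihilator (U : {mpoly C[n]} -> Prop) :
  coh M -> U 1 -> (forall p q, U p -> U q -> U (p * q)) ->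
  (forall m : M, exists2 p, U p & hPoly p *: m = 0) -> exists2 p, U p & annihilator p.
Proof.
move=> [k [g gen]] U1 UM loc.
have /choice [p pP] : forall i, exists p, U p /\ hPoly p *: g i = 0.
  by move=> i; have [p] := loc (g i); exists p.
exists (\prod_i p i).
  by elim/big_ind: _ => // i _; case: (pP i).
move=> m; have [q ->] := gen m; rewrite scaler_sumr big1 // => i _.
have [_ pi] := pP i.
by rewrite scalerA -hPolyM (bigD1 i) //= -mulrA mulrC hPolyM -scalerA pi scaler0.
Qed.

Lemma support_annihilator v : coh M ->
  sheaf_support M v <-> forall p, annihilator p -> p.@[fun i => v i 0] = 0.
Proof.
move=> cohM; split=> [[m mP] p hp|h].
  by apply/eqP; apply: contrapT => /negP pv; exact: mP pv (hp m).
apply: contrapT => nsupp.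
have [||m|p pv hp] := @local_annihilator (fun p => p.@[fun i => v i 0] != 0) cohM.
- by rewrite meval1 oner_neq0.
- by move=> p q hp hq; rewrite mevalM mulf_neq0.
- apply: contrapT => hm; apply: nsupp; exists m => p pv pm; apply: hm; by exists p.
by move: pv; rewrite h // eqxx.
Qed.

(** If neither closed set contained the zero set, each would have an equation outside [P]; their
    product is outside [P], hence nonzero at some zero of [P]. *)
Lemma prime_zero_set_irreducible (P : {mpoly C[n]} -> Prop) : prime_ideal P ->
  irreducible_set (fun v : 'cV[C]_n => forall p, P p -> p.@[fun i => v i 0] = 0).
Proof.
move=> hP; have [_ P1 _ _ Pprime] := hP.
split; first by have [v] := prime_ideal_zero hP P1; exists v.
move=> Z1 Z2 [I1 I1P] [I2 I2P] cover.
have cut (Z : 'cV[C]_n -> Prop) I : (forall v, Z v <-> forall p, I p -> p.@[fun i => v i 0] = 0) ->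
    (forall v : 'cV[C]_n, (forall p, P p -> p.@[fun i => v i 0] = 0) -> Z v) \/
    exists p, ~ P p /\ I p.
  move=> ZI; case: (pselect (exists p, ~ P p /\ I p)); first by right.
  move=> h; left => v Pv; apply/ZI => p Ip; apply: Pv; apply: contrapT => Pp.
  by apply: h; exists p.
have [|[p1 [P1' I1p]]] := cut _ _ I1P; first by left.
have [|[p2 [P2' I2p]]] := cut _ _ I2P; first by right.
have Pp : ~ P (p1 * p2) by case/Pprime.
have [v Pv] := prime_ideal_zero hP Pp; rewrite mevalM mulf_eq0 negb_or => /andP[h1 h2].
case: (cover v Pv) => [/I1P /(_ _ I1p)|/I2P /(_ _ I2p)] /eqP.
  by rewrite (negbTE h1).
by rewrite (negbTE h2).
Qed.

Lemma support_not_generically_annihilated p : coh M ->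
  (forall v, fixed v -> sheaf_support M v) -> annihilator p -> pull p = 0.
Proof.
move=> cohM supp hp; apply: contrapT => /pull_neq0_point [v fv].
by have /(support_annihilator v cohM) -> // := supp v fv; rewrite eqxx.
Qed.

(* Otherwise a prime ideal containing the annihilator and disjoint from the     *)
(* products r * f ^+ N would have a zero set strictly larger than the fixed     *)
(* space but contained in the support.                                          *)
Lemma generically_nilpotent f : coh M ->
  irreducible_component (sheaf_support M) fixed -> pull f = 0 ->
  exists N r, pull r <> 0 /\ annihilator (f ^+ N * r).
Proof.
move=> cohM [_ supp maxi] f0; apply: contrapT => h.
pose S p := exists N r, pull r <> 0 /\ p = f ^+ N * r.
have one : pull 1 <> 0 by rewrite pull1; apply/eqP; exact: oner_neq0.
have [||p hp [N [r [hr E]]]|P [hP AP PS]] := prime_avoiding (S := S) annihilator_ideal.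
- by exists 0%N, 1; rewrite expr0 mul1r.
- move=> a b [N [r [hr ->]]] [N' [r' [hr' ->]]]; exists (N + N')%N, (r * r').
  rewrite exprD mulrACA; split=> //.
  by have [_ _ _ _ prm] := pull_prime d W'; case/prm.
- by apply: h; exists N, r; rewrite -E.
have Pf : ~ P f by move=> /PS; apply; exists 1%N, 1; rewrite expr1 mulr1.
have [v Pv] := prime_ideal_zero hP Pf.
have fv : fixed v.
  apply: (maxi _ (prime_zero_set_irreducible hP)) Pv => {v}[v Pv|v fv p Pp].
    by apply/(support_annihilator v cohM) => p /AP /Pv.
  rewrite -(pull_fixed (d := d) (W' := W') p fv).
  have -> : pull p = 0; last by rewrite meval0.
  by apply: contrapT => hp; apply: (PS _ Pp); exists 0%N, p; rewrite expr0 mul1r.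
by rewrite -(pull_fixed (d := d) (W' := W') f fv) f0 meval0 eqxx.
Qed.

End GenericNilpotency.

Section OrbitStalks.
Variables (R : realType) (n : nat) (W : finGroupType).
Local Notation C := R[i].
Variables (d : cherednik_datum R n W) (M : lmodType (Hc d)).
Local Notation hPoly := (hPoly d).
Local Notation hX := (hX d).
Local Notation hY := (hY d).
Local Notation hW := (hW d).
Local Notation hC := (hC d).
Local Notation act_h := (act_h (rep d)).
Local Notation poly_act := (poly_act d).
Local Notation refl := (reflections (rep d)).
Implicit Types (v : 'cV[C]_n) (m : M).

Definition stalk_zero v m : Prop :=
  exists2 p : {mpoly C[n]}, p.@[fun i => v i 0] != 0 & hPoly p *: m = 0.

Definition orbit_stalks_zero v m : Prop := forall w, stalk_zero (act_h w v) m.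

Lemma stalk_zeroD v m m' : stalk_zero v m -> stalk_zero v m' -> stalk_zero v (m + m').
Proof.
move=> [p hp pm] [p' hp' pm']; exists (p * p'); first by rewrite mevalM mulf_neq0.
by rewrite hPolyM scalerDr -[_ *: m']scalerA pm' scaler0 addr0 hPoly_comm -scalerA pm scaler0.
Qed.

Lemma stalk_zero_hPoly v q m : stalk_zero v m -> stalk_zero v (hPoly q *: m).
Proof.
move=> [p hp pm]; exists p => //.
by rewrite scalerA hPoly_comm -scalerA pm scaler0.
Qed.

Lemma stalk_zero_hC v a m : stalk_zero v m -> stalk_zero v (hC a *: m).
Proof. by rewrite -hPolyC; exact: stalk_zero_hPoly. Qed.

Lemma stalk_zero_sum v (J : finType) (P : pred J) (F : J -> M) :
  (forall j, P j -> stalk_zero v (F j)) -> stalk_zero v (\sum_(j | P j) F j).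
Proof.
move=> h; elim/big_ind: _ => //; last by move=> x y; exact: stalk_zeroD.
by exists 1; rewrite ?meval1 ?oner_neq0 // scaler0.
Qed.

Lemma stalk_zero_hW v w m : stalk_zero (act_h w^-1%g v) m -> stalk_zero v (hW w *: m).
Proof.
move=> [p hp pm]; exists (poly_act w p); first by rewrite meval_poly_act.
by rewrite scalerA -hW_hPoly -scalerA pm scaler0.
Qed.

Lemma act_hM w w' v : act_h (w * w')%g v = act_h w (act_h w' v).
Proof. by rewrite /Defs.act_h rhoM mulmxA. Qed.

Lemma orbit_stalks_zero_hW v w m : orbit_stalks_zero v m -> orbit_stalks_zero v (hW w *: m).
Proof. by move=> h w'; apply: stalk_zero_hW; rewrite -act_hM; exact: h. Qed.

(** Whole orbits give stability under [y]: for [p] killing [m], the commutation rule writes p y m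
    through multiples of [m] and of the s m, and the stalks of s m are those of [m] at translated
    points. *)
Lemma orbit_stalks_zero_submodule v : submodule (orbit_stalks_zero v).
Proof.
split=> [w|m m' h h' w|a].
- by exists 1; rewrite ?meval1 ?oner_neq0 // scaler0.
- exact: stalk_zeroD.
move: a; apply: (@hc_generated R n W d (fun a => forall m, orbit_stalks_zero v m ->
  orbit_stalks_zero v (a *: m))) => [x|y|w|c|a b ha hb|a b ha hb] m h.
- by move=> w; rewrite -hPoly_linear_form; exact: stalk_zero_hPoly.
- move=> w; have [p hp pm] := h w; have [q [_ /(_ y) qE]] := hY_hPoly d p.
  have : hPoly p *: (hY y *: m) = - (hPoly (directional y p) *: m) +
      \sum_(s in refl) hC (dunkl_coef d s y) *: (hPoly (q s) *: (hW s *: m)).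
    move: (congr1 (fun a => a *: m) qE) => /=.
    rewrite -scalerA pm scaler0 scalerBl scalerDl -scalerA => /esym/eqP.
    rewrite subr_eq0 addrC => /eqP E; apply/(addrI (hPoly (directional y p) *: m)).
    rewrite E addrA subrr add0r scaler_suml; apply: eq_bigr => s _.
    by rewrite -!scalerA.
  move=> E; suff [r hr rE] : stalk_zero (act_h w v) (hPoly p *: (hY y *: m)).
    by exists (r * p); rewrite ?mevalM ?mulf_neq0 // hPolyM -scalerA.
  rewrite E; apply: stalk_zeroD.
    rewrite -scaleN1r -(hC1 d) -hCN; apply: stalk_zero_hC; exact: stalk_zero_hPoly.
  apply: stalk_zero_sum => s _; apply: stalk_zero_hC; apply: stalk_zero_hPoly.
  exact: orbit_stalks_zero_hW.
- exact: orbit_stalks_zero_hW.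
- by move=> w; exact: stalk_zero_hC.
- by rewrite scalerDl => w; apply: stalk_zeroD; [exact: ha | exact: hb].
by rewrite -scalerA; apply: ha; exact: hb.
Qed.

Lemma orbit_stalks_zero_eq0 v m : irreducible_module M -> sheaf_support M v ->
  orbit_stalks_zero v m -> m = 0.
Proof.
move=> [_ irr] [m0 m0P] hm.
have [/(_ m hm) //|h] := irr _ (orbit_stalks_zero_submodule v).
have [p] := h m0 1%g; rewrite /Defs.act_h rho1 mul1mx => /m0P hp pm.
by case: (hp pm).
Qed.

End OrbitStalks.

(** * Finiteness under the Euler element *)

Section EulerShift.
Variables (R : realType) (n : nat) (W : finGroupType).
Local Notation C := R[i].
Variable d : cherednik_datum R n W.
Local Notation hPoly := (hPoly d).
Local Notation hC := (hC d).
Local Notation euler := (euler d).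
Local Notation euler_prod := (euler_prod d).

Definition euler_shift (h : Hc d) (e : C) : Prop := euler * h = h * (euler + hC e).

Lemma euler_shift1 : euler_shift 1 0.
Proof. by rewrite /euler_shift hC0 addr0 mulr1 mul1r. Qed.

Lemma euler_shiftM h h' e e' :
  euler_shift h e -> euler_shift h' e' -> euler_shift (h * h') (e + e').
Proof.
move=> E E'; rewrite /euler_shift mulrA E -mulrA mulrDl E' hC_comm -mulrDr.
by rewrite -addrA -hCD [e' + e]addrC mulrA.
Qed.

Lemma euler_shift_hX x : euler_shift (hX d x) 1.
Proof. by rewrite /euler_shift hC1 mulrDr mulr1 euler_hX. Qed.
Lemma euler_shift_hY y : euler_shift (hY d y) (-1).
Proof. by rewrite /euler_shift hCN hC1 mulrDr mulrN1 euler_hY. Qed.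
Lemma euler_shift_hW w : euler_shift (hW d w) 0.
Proof. by rewrite /euler_shift hC0 addr0 euler_hW. Qed.
Lemma euler_shift_hC c : euler_shift (hC c) 0.
Proof. by rewrite /euler_shift hC0 addr0 hC_comm. Qed.

Lemma euler_shift_prod (J : finType) (F : J -> Hc d) :
  (forall j, exists e, euler_shift (F j) e) -> exists e, euler_shift (\prod_j F j) e.
Proof.
move=> h; elim/big_ind: _ => //; first by exists 0; exact: euler_shift1.
by move=> x y [e ex] [e' ey]; exists (e + e'); exact: euler_shiftM.
Qed.

Lemma euler_prod_shift h e s : euler_shift h e ->
  euler_prod [seq a + e | a <- s] * h = h * euler_prod s.
Proof.
move=> hh; elim: s => [|a s IH]; first by rewrite /euler_prod !big_nil mul1r mulr1.
rewrite /= !euler_prod_cons -mulrA IH !mulrA; congr (_ * _).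
rewrite mulrBl hh hCD mulrDl !hC_comm -mulrDr -mulrBr; congr (_ * _).
by rewrite opprD addrA addrAC addrK.
Qed.

End EulerShift.

Section GenericTorsion.
Variables (R : realType) (n : nat) (W : finGroupType).
Local Notation C := R[i].
Variables (d : cherednik_datum R n W) (W' : {group W}) (M : lmodType (Hc d)).
Local Notation hPoly := (hPoly d).
Local Notation pull := (pull d W').
Local Notation fixed := (fixed_points (rep d) W').
Local Notation normal i := (linear_form (normal_form d W' i)).
Local Notation component := (irreducible_component (sheaf_support M) fixed).
Local Notation euler_prod := (euler_prod d).
Local Notation generically_zero := (@generically_zero R n W d W' M).

(** The kernel of localising [M] itself at the generic point of the fixed space, whereas
    [generically_zero] also divides by the ideal of that space. *)
Definition generic_torsion (m : M) : Prop := exists2 p, pull p <> 0 & hPoly p *: m = 0.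

Lemma generic_torsionD m m' :
  generic_torsion m -> generic_torsion m' -> generic_torsion (m + m').
Proof.
move=> [p hp pm] [p' hp' pm']; exists (p * p'); first exact: pull_mul_neq0.
by rewrite hPolyM scalerDr -[_ *: m']scalerA pm' scaler0 addr0 hPoly_comm -scalerA pm scaler0.
Qed.

Lemma generic_torsion_hPoly q m : generic_torsion m -> generic_torsion (hPoly q *: m).
Proof.
move=> [p hp pm]; exists p => //.
by rewrite scalerA hPoly_comm -scalerA pm scaler0.
Qed.

Lemma generic_torsion_cancel q m :
  pull q <> 0 -> generic_torsion (hPoly q *: m) -> generic_torsion m.
Proof.
move=> hq [p hp]; rewrite scalerA -hPolyM => h; exists (p * q) => //.
exact: pull_mul_neq0.
Qed.

Lemma generic_torsion_sum (J : finType) (F : J -> M) :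
  (forall j, generic_torsion (F j)) -> generic_torsion (\sum_j F j).
Proof.
move=> h; elim/big_ind: _ => //; last by move=> x y; exact: generic_torsionD.
by exists 1; rewrite ?pull1 ?scaler0 //; apply/eqP; exact: oner_neq0.
Qed.

Lemma not_all_generic_torsion : coh M -> component -> exists m, ~ generic_torsion m.
Proof.
move=> cohM [_ supp _]; apply: contrapT => h.
have [||m|p hp pM] := @local_annihilator _ _ _ d M (fun p => pull p <> 0) cohM.
- by rewrite pull1; apply/eqP; exact: oner_neq0.
- exact: pull_mul_neq0.
- by have [p hp pm] : generic_torsion m; [apply: contrapT => hm; apply: h; exists m|exists p].
exact: hp (support_not_generically_annihilated cohM supp pM).
Qed.

(** Normal forms are generically nilpotent, so each in turn is raised to the largest power that does
    not make everything generic torsion. Powers of linear forms only shift [euler]. *)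
Lemma normal_multiplier : coh M -> component ->
  exists mu e, [/\ euler_shift (hPoly mu) e, exists m, ~ generic_torsion (hPoly mu *: m)
    & forall i m, generic_torsion (hPoly (normal i) *: (hPoly mu *: m))].
Proof.
move=> cohM comp.
suff step (s : seq 'I_n) : exists mu e, [/\ euler_shift (hPoly mu) e,
    exists m, ~ generic_torsion (hPoly mu *: m)
    & forall i m, i \in s -> generic_torsion (hPoly (normal i) *: (hPoly mu *: m))].
  have [mu [e [h1 h2 h3]]] := step (enum 'I_n); exists mu, e; split=> // i m.
  by apply: h3; rewrite mem_enum.
elim: s => [|i s [mu [e [h1 h2 h3]]]].
  exists 1, 0; rewrite hPoly1; split=> //; first exact: euler_shift1.
  by have [m hm] := not_all_generic_torsion cohM comp; exists m; rewrite scale1r.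
have [N [r [hr nilp]]] := generically_nilpotent cohM comp (pull_normal_form d W' i).
pose Q k := `[< forall m, generic_torsion (hPoly (normal i ^+ k) *: (hPoly mu *: m)) >].
have QN : exists k, Q k.
  exists N; apply/asboolP => m; exists r => //.
  by rewrite scalerA -hPolyM mulrC nilp.
case: (ex_minnP QN) => [[|k] /asboolP Qk kmin].
  by have [m []] := h2; move: (Qk m); rewrite expr0 hPoly1 scale1r.
have [m hm] : exists m, ~ generic_torsion (hPoly (normal i ^+ k) *: (hPoly mu *: m)).
  apply: contrapT => h; have : Q k; last by move=> /kmin; rewrite ltnn.
  by apply/asboolP => m; apply: contrapT => hm; apply: h; exists m.
have [e' he'] : exists e', euler_shift (hPoly (normal i ^+ k)) e'.
  elim: k {Qk kmin m hm} => [|k [e' IH]].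
    by exists 0; rewrite expr0 hPoly1; exact: euler_shift1.
  exists (1 + e'); rewrite exprS hPolyM; apply: euler_shiftM => //.
  by rewrite hPoly_linear_form; exact: euler_shift_hX.
exists (normal i ^+ k * mu), (e' + e); rewrite hPolyM; split.
- exact: euler_shiftM.
- by exists m; rewrite -scalerA.
move=> j m'; rewrite inE => /orP[/eqP ->|js]; rewrite -[(_ * _) *: m']scalerA.
  by rewrite scalerA -hPolyM -exprS; exact: Qk.
rewrite scalerA hPoly_comm -scalerA; apply: generic_torsion_hPoly; exact: h3.
Qed.

Lemma generically_zero_torsion mu m :
  (forall i m, generic_torsion (hPoly (normal i) *: (hPoly mu *: m))) ->
  generically_zero m -> generic_torsion (hPoly mu *: m).
Proof.
move=> h [p hp [u E]]; apply: (generic_torsion_cancel hp).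
rewrite scalerA hPoly_comm -scalerA E scaler_sumr; apply: generic_torsion_sum => i.
by rewrite scalerA hPoly_comm -scalerA.
Qed.

(* If w moves the fixed space away from itself, then some linear form vanishes  *)
(* on w h^{W'} but not on h^{W'}; by nilpotency one of its powers kills the     *)
(* module near the generic point of w h^{W'}.                                   *)
Lemma orbit_multiplier w m : coh M -> component -> generic_torsion m ->
  exists omega r, [/\ exists e, euler_shift (hPoly omega) e, pull omega <> 0, pull r <> 0
    & hPoly (poly_act d w r * omega) *: m = 0].
Proof.
move=> cohM comp [p hp pm].
have one : pull 1 <> 0 by rewrite pull1; apply/eqP; exact: oner_neq0.
pose x i := act_dual (rep d) w (normal_form d W' i).
case: (pselect (exists i, pull (linear_form (x i)) <> 0)) => [[i xi]|vanish].
  have [N [r [hr nilp]]] := generically_nilpotent cohM comp (pull_normal_form d W' i).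
  exists (linear_form (x i) ^+ N), r; split=> //.
  - elim: N {nilp} => [|N [e IH]]; first by exists 0; rewrite expr0 hPoly1; exact: euler_shift1.
    exists (1 + e); rewrite exprS hPolyM; apply: euler_shiftM => //.
    by rewrite hPoly_linear_form; exact: euler_shift_hX.
  - by elim: N {nilp} => [|N IH]; rewrite ?expr0 // exprS; exact: pull_mul_neq0.
  have -> : poly_act d w r * linear_form (x i) ^+ N = poly_act d w (normal i ^+ N * r).
    rewrite (poly_actM d w (normal i ^+ N) r) (poly_actXn d w (normal i)).
    by rewrite (poly_act_linear_form d w (normal_form d W' i)) [RHS]mulrC.
  rewrite -[m]scale1r -(hWV d w) scalerA mulrA -hW_hPoly -!scalerA.
  by rewrite nilp scaler0.
exists 1, (poly_act d w^-1%g p); split=> //.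
- by exists 0; rewrite hPoly1; exact: euler_shift1.
- have [v fv pv] := pull_neq0_point hp; pose u := act_h (rep d) w^-1%g v.
  have fu : fixed u.
    suff -> : u = average d W' *m u by exact: average_fixed.
    apply/colP => i; apply/eqP; rewrite -subr_eq0; apply/eqP.
    have : (pull (linear_form (x i))).@[fun i => v i 0] = 0.
      by rewrite (_ : pull _ = 0) ?meval0 //; apply: contrapT => xi; apply: vanish; exists i.
    rewrite pull_fixed // meval_linear_form /pairing /x /act_dual -mulmxA mulmxBl.
    by rewrite -mulmxA -!rowE !mxE.
  move=> h; have := pull_fixed (poly_act d w^-1%g p) fu.
  rewrite h meval0 meval_poly_act /u /act_h mulmxA rhoVK mul1mx => /esym /eqP.
  by rewrite (negbTE pv).
rewrite mulr1 -[m]scale1r -(hWV d w) scalerA mulrA -hW_hPoly -mulrA -hW_hPoly mulrA hWV mul1r.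
exact: pm.
Qed.

(** If P(eu) m is generically zero, [mu] makes it generic torsion, and the product [om] of the orbit
    multipliers makes its stalks zero along an orbit in the support; so om mu P(eu) m = 0. Moving
    P(eu) to the left shifts its roots, and om mu m is nonzero since [om] is generically nonzero. *)
Lemma euler_finite_vector : coh M -> irreducible_module M -> component ->
  (forall m : M, exists s, generically_zero (euler_prod s *: m)) ->
  exists (m : M) s, m <> 0 /\ euler_prod s *: m = 0.
Proof.
move=> cohM irr comp gz.
have [mu [e [shift_mu [m hm] norm_mu]]] := normal_multiplier cohM comp.
have [s hs] := gz m; pose y := hPoly mu *: (euler_prod s *: m).
have ty : generic_torsion y by exact: generically_zero_torsion.
have /choice [omega /choice [r orP]] := fun w => orbit_multiplier w cohM comp ty.
pose om := \prod_w omega w.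
have om0 : pull om <> 0.
  by rewrite pull_prod; apply/eqP/prodf_neq0 => w _; apply/eqP; case: (orP w).
have [e' shift_om] : exists e', euler_shift (hPoly om) e'.
  rewrite (big_morph hPoly (hPolyM d) (hPoly1 d)); apply: euler_shift_prod => w.
  by case: (orP w).
(* A fixed point where every [r w] is nonzero; the transport of [r w] by [w] is then nonzero at w
   v. *)
have [v fv rv] : exists2 v, fixed v & (\prod_w r w).@[fun i => v i 0] != 0.
  apply: (pull_neq0_point (d := d) (W' := W')).
  by rewrite pull_prod; apply/eqP/prodf_neq0 => w _; apply/eqP; case: (orP w).
have [_ supp _] := comp.
have y0 : hPoly om *: y = 0.
  apply: (orbit_stalks_zero_eq0 irr (supp v fv)) => w.
  exists (poly_act d w (r w)).
    rewrite meval_poly_act /act_h mulmxA rhoVK mul1mx.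
    by move: rv; rewrite (bigD1 w) //= mevalM mulf_eq0 negb_or => /andP[].
  have [_ _ _ h] := orP w; rewrite scalerA -hPolyM /om (bigD1 w) //= mulrA mulrC hPolyM -scalerA.
  by rewrite h scaler0.
exists (hPoly om *: (hPoly mu *: m)), [seq a + (e' + e) | a <- s]; split.
  move=> h; apply: hm; apply: (generic_torsion_cancel om0); rewrite h.
  by exists 1; rewrite ?pull1 ?scaler0 //; apply/eqP; exact: oner_neq0.
rewrite [hPoly om *: _]scalerA scalerA (euler_prod_shift _ (euler_shiftM shift_om shift_mu)) -scalerA.
by move: y0; rewrite /y !scalerA.
Qed.

End GenericTorsion.

(** * Eigenvalues of the Euler element and local nilpotency *)

Section EulerEigenvalues.
Variables (R : realType) (n : nat) (W : finGroupType).
Local Notation C := R[i].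
Variables (d : cherednik_datum R n W) (M : lmodType (Hc d)).
Local Notation hPoly := (hPoly d).
Local Notation hC := (hC d).
Local Notation hY := (hY d).
Local Notation euler := (euler d).
Local Notation euler_prod := (euler_prod d).

Implicit Types (m : M) (s t u : seq C).

Definition euler_finite (m : M) : Prop := exists s, euler_prod s *: m = 0.

Lemma euler_prod_cat s t : euler_prod (s ++ t) = euler_prod s * euler_prod t.
Proof. by rewrite /euler_prod big_cat. Qed.

Lemma euler_prod_comm s t : euler_prod s * euler_prod t = euler_prod t * euler_prod s.
Proof.
have comm1 a u : GRing.comm (euler - hC a) (euler_prod u).
  elim: u => [|b u IH]; first by rewrite /euler_prod big_nil; exact: commr1.
  rewrite euler_prod_cons; apply: commrM => //.
  have cC h c : GRing.comm h (hC c) by rewrite /GRing.comm hC_comm.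
  have cE : GRing.comm (euler - hC a) euler.
    by apply/commr_sym/commrB; [exact: commr_refl | exact: cC].
  exact: commrB cE (cC _ _).
elim: s => [|a s IH]; first by rewrite /euler_prod big_nil mulr1 mul1r.
by rewrite euler_prod_cons -mulrA IH mulrA (comm1 a t) mulrA.
Qed.

Lemma euler_prod_kill s t m : euler_prod t *: m = 0 -> euler_prod (s ++ t) *: m = 0.
Proof. by move=> h; rewrite euler_prod_cat -scalerA h scaler0. Qed.

Lemma euler_prod_kill_l s t m : euler_prod s *: m = 0 -> euler_prod (s ++ t) *: m = 0.
Proof. by move=> h; rewrite euler_prod_cat euler_prod_comm -scalerA h scaler0. Qed.

Lemma euler_finite_shift h e m : euler_shift h e -> euler_finite m -> euler_finite (h *: m).
Proof.
move=> hh [s hs]; exists [seq a + e | a <- s].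
by rewrite scalerA euler_prod_shift // -scalerA hs scaler0.
Qed.

Lemma euler_finite_submodule : submodule euler_finite.
Proof.
have FD m m' : euler_finite m -> euler_finite m' -> euler_finite (m + m').
  move=> [s hs] [t ht]; exists (s ++ t); rewrite scalerDr.
  by rewrite euler_prod_kill_l // euler_prod_kill // addr0.
split=> [||a]; [by exists [::]; rewrite scaler0|exact: FD|].
move: a; apply: (@hc_generated R n W d (fun a => forall m, euler_finite m -> euler_finite (a *: m))).
- by move=> x m; exact/euler_finite_shift/euler_shift_hX.
- by move=> y m; exact/euler_finite_shift/euler_shift_hY.
- by move=> w m; exact/euler_finite_shift/euler_shift_hW.
- by move=> c m; exact/euler_finite_shift/euler_shift_hC.
- by move=> a b ha hb m hm; rewrite scalerDl; apply: FD; [exact: ha | exact: hb].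
by move=> a b ha hb m hm; rewrite -scalerA; apply: ha; exact: hb.
Qed.

Lemma euler_prod_eigen a t m : (euler - hC a) *: m = 0 ->
  euler_prod t *: m = hC (\prod_(b <- t) (a - b)) *: m.
Proof.
move=> h; elim: t => [|b t IH]; first by rewrite /euler_prod !big_nil hC1.
rewrite euler_prod_cons big_cons -scalerA IH scalerA -hC_comm -scalerA.
have -> : (euler - hC b) *: m = hC (a - b) *: m.
  by rewrite hCB -[euler](subrK (hC a)) -addrA scalerDl h add0r.
by rewrite scalerA -hCM mulrC.
Qed.

(** The roots in [u] are removed one at a time: each leaves a vector that is zero or an eigenvector,
    on which [euler_prod t] is an invertible scalar. *)
Lemma euler_prod_disjoint u t m : (forall a, a \in u -> a \notin t) ->
  euler_prod u *: m = 0 -> euler_prod t *: m = 0 -> m = 0.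
Proof.
elim: u => [|a u IH] dis hu ht; first by move: hu; rewrite /euler_prod big_nil scale1r.
apply: IH => //; first by move=> b bu; apply: dis; rewrite inE bu orbT.
have at_ : a \notin t by apply: dis; rewrite inE eqxx.
set m' := euler_prod u *: m.
have E : (euler - hC a) *: m' = 0 by rewrite scalerA -euler_prod_cons.
have : hC (\prod_(b <- t) (a - b)) *: m' = 0.
  by rewrite -euler_prod_eigen // scalerA euler_prod_comm -scalerA ht scaler0.
move=> /(congr1 (fun z => hC (\prod_(b <- t) (a - b))^-1 *: z)).
rewrite scaler0 scalerA -hCM mulVf ?hC1 ?scale1r //.
rewrite prodf_seq_neq0; apply/allP => b bt /=; rewrite subr_eq0.
by apply: contraNneq at_ => ->.
Qed.

Definition eigenvalues_above s m : Prop := exists t,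
  (forall a, a \in t -> exists b l, b \in s /\ a = b + l%:R) /\ euler_prod t *: m = 0.

Lemma eigenvalues_above_hPoly s p m :
  eigenvalues_above s m -> eigenvalues_above s (hPoly p *: m).
Proof.
elim/mpoly_alg_ind: p m => [c|i|p q IHp IHq|p q IHp IHq] m.
- move=> [t [ht tm]]; exists t; split=> //.
  by rewrite hPolyC scalerA -hC_comm -scalerA tm scaler0.
- move=> [t [ht tm]]; exists [seq a + 1 | a <- t]; split=> [a /mapP[a' /ht [b [l [bs ->]]] ->]|].
    by exists b, l.+1; rewrite -addrA natr1.
  by rewrite hPolyX scalerA (euler_prod_shift _ (euler_shift_hX d _)) -scalerA tm scaler0.
- move=> hm; have [t [ht tm]] := IHp _ hm; have [t' [ht' tm']] := IHq _ hm.
  exists (t ++ t'); split=> [a|]; first by rewrite mem_cat => /orP[/ht|/ht'].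
  by rewrite hPolyD scalerDl scalerDr euler_prod_kill_l // euler_prod_kill // addr0.
by move=> hm; rewrite hPolyM -scalerA; apply: IHp; exact: IHq.
Qed.

Lemma eigenvalues_above_sum (J : finType) s (F : J -> M) :
  (forall j, eigenvalues_above s (F j)) -> eigenvalues_above s (\sum_j F j).
Proof.
move=> h; elim/big_ind: _ => //; first by exists [::]; rewrite scaler0.
move=> x y [t [ht tx]] [t' [ht' ty]]; exists (t ++ t').
split=> [a|]; first by rewrite mem_cat => /orP[/ht|/ht'].
by rewrite scalerDr euler_prod_kill_l // euler_prod_kill // addr0.
Qed.

Lemma euler_shift_hY_prod N (y : 'I_N -> 'cV[C]_n) :
  euler_shift (\prod_(i < N) hY (y i)) (- N%:R).
Proof.
elim: N y => [|N IH] y; first by rewrite big_ord0 oppr0; exact: euler_shift1.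
rewrite big_ord_recr /= -natr1 opprD; apply: euler_shiftM (IH _) _.
exact: euler_shift_hY.
Qed.

Lemma natural_bound s : exists N : nat, forall c l, c \in s -> (N <= l)%N -> c <> l%:R.
Proof.
elim: s => [|c s [N NP]]; first by exists 0%N.
case: (pselect (exists k : nat, c = k%:R)) => [[k ck]|h].
  exists (maxn N k.+1) => c' l; rewrite inE geq_max => /orP[/eqP ->|cs] /andP[Nl kl].
    by rewrite ck => /eqP; rewrite eqr_nat => /eqP kl'; rewrite kl' ltnn in kl.
  exact: NP.
exists N => c' l; rewrite inE => /orP[/eqP -> _ cl|cs]; last exact: NP.
by apply: h; exists l.
Qed.

(** All eigenvalues lie above those of finitely many C[h]-generators, up to natural numbers, while
    [N] letters [y] lower those of [m] by [N]. For large [N] the two conditions are incompatible, so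
    the product kills [m]. *)
Lemma euler_finite_category_O : coh M -> (forall m, euler_finite m) -> category_O M.
Proof.
move=> cohM fin; split; first exact: coh_fin_gen.
have [k [g gen]] := cohM.
have /choice [sg sgP] := fun j => fin (g j).
pose s := flatten [seq sg j | j <- enum 'I_k].
have above m : eigenvalues_above s m.
  have [p ->] := gen m; apply: eigenvalues_above_sum => j; apply: eigenvalues_above_hPoly.
  exists (sg j); split=> // a aj; exists a, 0%N; rewrite addr0; split=> //.
  by apply/flattenP; exists (sg j) => //; apply/mapP; exists j; rewrite ?mem_enum.
move=> m; have [t tm] := fin m.
have [N NP] := natural_bound [seq a - b | a <- t, b <- s].
exists N => y; have [u [hu um]] := above ((\prod_(i < N) hY (y i)) *: m).
apply: (euler_prod_disjoint (u := [seq a + - N%:R | a <- t]) _ _ um); last first.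
  by rewrite scalerA (euler_prod_shift _ (euler_shift_hY_prod y)) -scalerA tm scaler0.
move=> c /mapP[a at_ ->]; apply/negP => /hu [b [l [bs E]]].
apply: (NP (a - b) (N + l)%N _ (leq_addr _ _)); first by apply: allpairs_f.
by rewrite natrD -[a](subrK N%:R) E addrAC [b + _]addrC addrK addrC.
Qed.

End EulerEigenvalues.

(** One nonzero [euler]-finite vector suffices, as such vectors form a submodule of the irreducible
    [M]. *)
Lemma regular_singularities_category_O (R : realType) (n : nat) (W : finGroupType)
    (d : cherednik_datum R n W) (M : lmodType (Hc d)) (W' : {group W}) (v : 'cV[R[i]]_n) :
  coh M -> irreducible_module M -> stabiliser (rep d) v = W' ->
  irreducible_component (sheaf_support M) (fixed_points (rep d) W') ->
  has_regular_singularities W' M -> category_O M.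
Proof.
move=> cohM irr stv comp reg; apply: euler_finite_category_O => //.
have [m [s [m0 sm]]] :=
  euler_finite_vector cohM irr comp (regular_euler_finite cohM reg stv).
have [_ /(_ _ (euler_finite_submodule M))] := irr.
by case=> // h; case: m0; apply: h; exists s.
Qed.

Theorem proposition1p3 (R : realType) (n : nat) (W : finGroupType)
    (d : cherednik_datum R n W) :
  serre_subcategory (@category_O R n W d) (@coh R n W d) /\
  forall (M : lmodType (Hc d)) (W' : {group W}),
    coh M -> irreducible_module M ->
    (exists v : 'cV[R[i]%C]_n, stabiliser (rep d) v = W') ->
    irreducible_component (sheaf_support M) (fixed_points (rep d) W') ->
    (category_O M <-> has_regular_singularities W' M).
Proof.
split=> [|M W' cohM irr [v stv] comp]; first exact: category_O_serre.
split; first exact: category_O_has_regular_singularities.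
exact: regular_singularities_category_O stv comp.
Qed.
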